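(* The special fiber ring $\mathbb{K}[\mathbf{f}]$ of a rational normal scroll is a Koszul algebra.
   Context: Let $\mathbb{K}$ be an arbitrary field, $n_1,\ldots,n_d$ positive integers, $c=\sum_i n_i$, and $R=\mathbb{K}[x_{i,j}\mid 1\le i\le d,\ 0\le j\le n_i]$. The rational normal scroll $\mathcal{S}_{n_1,\ldots,n_d}\subseteq\mathbb{P}^{c+d-1}$ is the projective variety whose homogeneous ideal $I\subseteq R$ is generated by the set $\mathbf{f}$ of $2\times2$ minors of the $2\times c$ matrix obtained by juxtaposing, for $i=1,\ldots,d$, the blocks $$\begin{pmatrix}x_{i,0}&x_{i,1}&\cdots&x_{i,n_i-1}\\ x_{i,1}&x_{i,2}&\cdots&x_{i,n_i}\end{pmatrix}.$$ Its special fiber ring is the subalgebra $\mathbb{K}[\mathbf{f}]\subseteq R$ generated by $\mathbf{f}$, a standard graded $\mathbb{K}$-algebra with the elements of $\mathbf{f}$ in degree $1$. A standard graded $\mathbb{K}$-algebra $A$ is Koszul if $\mathrm{Tor}_i^A(\mathbb{K},\mathbb{K})_j=0$ whenever $i\ne j$. *)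

(* Defs.v *)
From HB Require Import structures.
From mathcomp Require Import all_boot all_algebra.
From mathcomp Require Import boolp.
From mathcomp.multinomials Require Import freeg mpoly.

Set Implicit Arguments.
Unset Strict Implicit.
Unset Printing Implicit Defensive.

Import GRing.Theory.
Local Open Scope ring_scope.

(* Koszul algebras.  A is a nonnegatively graded K-algebra with A_0 = K: its
   graded pieces are A_ m and eps : A -> K is the projection onto A / A_+ = K,
   through which K is an A-module. *)
Section Koszul.
Variables (K : fieldType) (A : comAlgType K).
Variables (A_ : nat -> A -> Prop) (eps : {rmorphism A -> K}).

Definition zpiece (j : int) (a : A) : Prop :=
  match j with Posz m => A_ m a | Negz _ => a = 0 end.

(* {freeg B / A} is the free A-module on B, graded by giving the basis element
   b degree deg b; this is the graded module \bigoplus_b A(- deg b). *)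
Definition homogA (B : choiceType) (deg : B -> int) (j : int)
    (x : {freeg B / A}) : Prop :=
  forall b : B, zpiece (j - deg b) (coeff b x).

(* A graded free resolution ... -> F_1 -> F_0 -> K -> 0 of the A-module K,
   with K concentrated in degree 0. *)
Record resolution := Resolution {
  base : nat -> choiceType;
  bdeg : forall i, base i -> int;
  diff : forall i, {linear {freeg (base i.+1) / A} -> {freeg (base i) / A}};
  aug : {linear {freeg (base 0) / A} -> K | (eps \; *%R)};
  diff_homog : forall i (b : base i.+1),
    homogA (@bdeg i) (bdeg b) (diff i << b >>);
  aug_homog : forall b : base 0, bdeg b != 0 -> aug << b >> = 0;
  aug_surj : forall c : K, exists x, aug x = c;
  aug_exact : forall x, aug x = 0 <-> exists y, x = diff 0 y;
  diff_exact : forall i (x : {freeg (base i.+1) / A}),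
    diff i x = 0 <-> exists y, x = diff i.+1 y
}.

(* Under the identification A^(B) (x)_A K = K^(B), this is x |-> x (x) 1. *)
Definition tensK (B : choiceType) (x : {freeg B / A}) : {freeg B / K} :=
  \sum_(b <- dom x) << eps (coeff b x) *g b >>.

Section Tor.
Variable F : resolution.

(* The differential of F (x)_A K. *)
Definition diffK (i : nat) : {freeg (base F i.+1) / K} -> {freeg (base F i) / K} :=
  fglift (fun b => tensK (diff F i << b >>)).

Definition homogK (i : nat) (j : int) (z : {freeg (base F i) / K}) : Prop :=
  forall b, coeff b z != 0 -> bdeg b = j.

Definition cycleK (i : nat) : {freeg (base F i) / K} -> Prop :=
  match i with
  | 0 => fun _ => True
  | i'.+1 => fun z => diffK z = 0
  end.

(* Tor_i^A(K, K)_j = 0, computed as H_i(F (x)_A K)_j. *)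
Definition Tor_eq0 (i : nat) (j : int) : Prop :=
  forall z, homogK j z -> cycleK z ->
    exists2 w : {freeg (base F i.+1) / K}, homogK j w & z = diffK w.

End Tor.

(* Tor does not depend on the resolution: the vanishing is asked of all of
   them, and the first conjunct makes sure that this is not vacuous. *)
Definition Koszul : Prop :=
  inhabited resolution /\
  forall (F : resolution) (i : nat) (j : int), i%:Z != j -> Tor_eq0 F i j.

End Koszul.

Arguments Koszul {K} A A_ eps.

(* The subalgebra K[f] of K[x_1, ..., x_n] generated by f_1, ..., f_m. *)
Section GeneratedAlgebra.
Variables (K : fieldType) (n m : nat) (f : m.-tuple {mpoly K[n]}).

Definition gen_pred : {pred {mpoly K[n]}} :=
  fun p => `[< exists P : {mpoly K[m]}, p = P \mPo f >].

Lemma gen_pred_subalg : subalg_closed gen_pred.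
Proof.
split=> [|c p q|p q]; rewrite /in_mem /=.
- by apply/asboolP; exists 1; rewrite comp_mpoly1.
- move=> /asboolP[P ->] /asboolP[Q ->]; apply/asboolP; exists (c *: P + Q).
  by rewrite comp_mpolyD comp_mpolyZ.
- move=> /asboolP[P ->] /asboolP[Q ->]; apply/asboolP; exists (P * Q).
  by rewrite rmorphM.
Qed.

HB.instance Definition _ :=
  GRing.isSubalgClosed.Build K {mpoly K[n]} gen_pred gen_pred_subalg.

Record gen_alg := GenAlg { gen_val :> {mpoly K[n]}; _ : gen_val \in gen_pred }.

HB.instance Definition _ := [isSub for gen_val].
HB.instance Definition _ := [Choice of gen_alg by <:].
HB.instance Definition _ := [SubChoice_isSubComNzRing of gen_alg by <:].
HB.instance Definition _ := [SubZmodule_isSubLmodule of gen_alg by <:].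
HB.instance Definition _ := [SubNzRing_SubLmodule_isSubLalgebra of gen_alg by <:].
HB.instance Definition _ := [SubLalgebra_isSubAlgebra of gen_alg by <:].

(* The elements of f have degree 1.  For f_k homogeneous of one and the same
   positive degree, as below, this is a grading of K[f] and the constant
   coefficient is the projection onto its piece of degree 0. *)
Definition gen_piece (j : nat) (a : gen_alg) : Prop :=
  exists2 P : {mpoly K[m]}, P \is j.-homog & val a = P \mPo f.

Definition gen_eps : {rmorphism gen_alg -> K} := mcoeff 0%MM \o val.

End GeneratedAlgebra.

Arguments gen_piece {K n m} f.

Section Scroll.
Variables (K : fieldType) (d : nat) (n : 'I_d -> nat).

(* x_(i,j) with i < d and j <= n_i *)
Definition scroll_index : finType := {i : 'I_d & 'I_(n i).+1}.

Definition scroll_ring := {mpoly K[#|scroll_index|]}.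

Definition scroll_var (i : 'I_d) (j : 'I_(n i).+1) : scroll_ring :=
  'X_(enum_rank (Tagged (fun i => 'I_(n i).+1) j)).

Definition scroll_block (i : 'I_d) : 'M[scroll_ring]_(2, n i) :=
  \matrix_(r, j) scroll_var (inord (j + r)%N : 'I_(n i).+1).

Definition scroll_mx : 'M[scroll_ring]_(2, \sum_i n i) :=
  \mxrow_i scroll_block i.

Definition column_pair : finType :=
  {pq : 'I_(\sum_i n i) * 'I_(\sum_i n i) | (pq.1 < pq.2)%N}.

Definition scroll_minor (s : column_pair) : scroll_ring :=
  \det (colsub (fun k : 'I_2 => if k == 0 then (val s).1 else (val s).2)
               scroll_mx).

Definition scroll_minors : #|column_pair|.-tuple scroll_ring :=
  [tuple scroll_minor (enum_val k) | k < #|column_pair|].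

End Scroll.

(* Main.v *)
Require Import Defs.
From HB Require Import structures.
From mathcomp Require Import all_boot all_order all_algebra.
From mathcomp Require Import boolp.
From mathcomp.multinomials Require Import freeg mpoly.
From mathcomp Require Import zify ring.

(** Let c be the number of columns of the scroll matrix and s + 1 the number of
its blocks.  The ring K[f] is Koszul because it has a basis of standard
monomials for a quadratic rewriting rule, in generators that are well chosen
linear combinations of the minors.

Which rewriting rules give Koszulness.  Let A be generated in degree 1 by
letters, let a symmetric and reflexive relation say which pairs of letters are
standard, and call a monomial standard when all pairs of its letters are.
Suppose that a nonstandard product of two letters is a combination of products
of smaller weight ([straightening]), and that the standard monomials are
independent in A.  In other words the relations of A have a quadratic Groebner
basis, and this implies that A is Koszul ([standard_basis_Koszul]).  The proof
builds a free resolution of K whose differentials have linear entries: the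
leading terms of the syzygies can be predicted and are linear at each step
([next]), as in the theorem of Schreyer.  The linear resolution kills the
off-diagonal Tor of every other resolution by a zigzag in the double complex
([chase]).

Which letters.  Let e(k,j) = (x_(k,j), x_(k,j+1)) be the columns of the matrix.
Replace the first column of block k+1 by X_k = e(k+1,0) - e(k,n_k - 1).  The
remaining columns Y_0, Y_1, ... form one chain, in which the blocks follow each
other: modulo the X_k they look like the columns of a rational normal curve of
degree c - s.  Positions 0, ..., s-1 are those of the X_k, positions s, ..., c-1
those of the chain, and the letters are the minors [a b] with a < b.  A letter
[a b] is an arc if both columns belong to the chain, and a stub if only b does.
Nonstandard products are rewritten by the Pluecker relations, and, for two arcs
that are far apart, by expanding a 4 x 4 determinant with two equal rows that
expresses the shift along the chain ([straighten_nonstd]).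

Why the standard monomials are independent.  Specialize the variables so that
X_k becomes (p_k nu, p_k mu + z_k) and Y_b becomes (y_b, y_(b+1)) plus smaller
terms, and replace the letters by leading forms.  A relation between values of
monomials persists, for part of its monomials, between the leading forms
([leading_relation]).  After passing to leading forms several times all letters
become monomials ([descent]), and a standard monomial is determined by its
value because it is determined by the numbers of letters that begin and that
end at each position ([std_unique]).  The choice of the leading forms depends
on the relation: they are taken at the positions of the chain one after the
other, until an arc is met. *)

Set Implicit Arguments.
Unset Strict Implicit.
Unset Printing Implicit Defensive.

Import GRing.Theory.
Local Open Scope ring_scope.

(** * Normal forms with respect to standard monomials *)
Section MonomialWeight.
Variables (N : nat) (wt : 'I_N -> nat).

Definition mwt (m : 'X_{1..N}) : nat := (\sum_i m i * wt i)%N.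

Lemma mwtD m1 m2 : mwt (m1 + m2) = (mwt m1 + mwt m2)%N.
Proof.
by rewrite /mwt -big_split; apply: eq_bigr => i _; rewrite mnmDE mulnDl.
Qed.

Lemma mwtU i : mwt U_(i) = wt i.
Proof.
rewrite /mwt (bigD1 i) //= mnm1E eqxx mul1n big1 ?addn0 // => j ne_ji.
by rewrite mnm1E eq_sym (negbTE ne_ji).
Qed.

End MonomialWeight.

Lemma mnm_rem1 N (m : 'X_{1..N}) i : m i != 0%N -> m = (m - U_(i) + U_(i))%MM.
Proof. by move=> mi; rewrite submK // lep1mP. Qed.

Section StandardMonomials.
Variables (N : nat) (std : rel 'I_N).

Definition mstd (m : 'X_{1..N}) : bool :=
  [forall s, forall t, (m s != 0%N) && (m t != 0%N) ==> std s t].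

Lemma mstdP (m : 'X_{1..N}) : reflect (forall s t, m s != 0%N -> m t != 0%N -> std s t) (mstd m).
Proof.
apply: (iffP forallP) => [h s t ms mt|h s].
  by have /forallP/(_ t) := h s; rewrite ms mt.
by apply/forallP => t; apply/implyP => /andP[]; apply: h.
Qed.

Lemma mstd_le (m m' : 'X_{1..N}) : (forall i, m i != 0%N -> m' i != 0%N) -> mstd m' -> mstd m.
Proof. by move=> le_mm' /mstdP std_m'; apply/mstdP => s t ? ?; apply/std_m'; apply/le_mm'. Qed.

Lemma mstd_sub (m u : 'X_{1..N}) : mstd m -> mstd (m - u)%MM.
Proof. by apply: mstd_le => i; rewrite mnmBE; lia. Qed.

Lemma mstdN (m : 'X_{1..N}) : ~~ mstd m -> exists s t, [/\ m s != 0%N, m t != 0%N & ~~ std s t].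
Proof.
rewrite negb_forall => /existsP[s]; rewrite negb_forall => /existsP[t].
by rewrite negb_imply => /andP[/andP[ms mt] st]; exists s, t.
Qed.

Definition pstd (K : fieldType) (p : {mpoly K[N]}) : bool := all mstd (msupp p).

Variable K : fieldType.
Implicit Types p q : {mpoly K[N]}.

Lemma pstd0 : pstd (0 : {mpoly K[N]}).
Proof. by rewrite /pstd msupp0. Qed.

Lemma pstdX (m : 'X_{1..N}) : pstd ('X_[m] : {mpoly K[N]}) = mstd m.
Proof. by rewrite /pstd msuppX /= andbT. Qed.

Lemma pstdD p q : pstd p -> pstd q -> pstd (p + q).
Proof.
move=> /allP sp /allP sq; apply/allP => m /msuppD_le; rewrite mem_cat.
by case/orP => [/sp|/sq].
Qed.

Lemma pstdZ c p : pstd p -> pstd (c *: p).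
Proof. by move=> /allP sp; apply/allP => m /msuppZ_le /sp. Qed.

Lemma pstdB p q : pstd p -> pstd q -> pstd (p - q).
Proof. by move=> sp sq; rewrite -scaleN1r; apply: pstdD => //; exact: pstdZ. Qed.

Lemma pstd_sum I (r : seq I) (P : pred I) (F : I -> {mpoly K[N]}) :
  (forall i, P i -> pstd (F i)) -> pstd (\sum_(i <- r | P i) F i).
Proof.
move=> sF; elim/big_rec: _ => [|i p Pi sp]; first exact: pstd0.
by apply: pstdD => //; apply: sF.
Qed.

End StandardMonomials.

Section StandardBasis.
Variables (K : fieldType) (N : nat) (A : comAlgType K) (l : 'I_N -> A).
Variables (std : rel 'I_N) (wt : 'I_N -> nat).

Definition ev : {mpoly K[N]} -> A := mmap (in_alg A) l.

HB.instance Definition _ := GRing.RMorphism.copy ev (mmap (in_alg A) l).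

Lemma evZ c p : ev (c *: p) = c *: ev p.
Proof. by rewrite /ev mmapZ /= mulr_algl. Qed.

Lemma evC c : ev c%:MP = c%:A.
Proof. exact: mmapC. Qed.

Lemma evE p : ev p = \sum_(m <- msupp p) p@_m *: ev 'X_[m].
Proof. by rewrite {1}[p]mpolyE rmorph_sum; apply: eq_bigr => m _; exact: evZ. Qed.

Lemma evXU i : ev 'X_i = l i.
Proof. by rewrite /ev mmapX mmap1U. Qed.

(** The decrease of the weight makes the rewriting of nonstandard products
terminate. *)
Definition straightening := forall s t, ~~ std s t ->
  exists q, [/\ q \is 2.-homog, ev q = l s * l t
    & forall m, m \in msupp q -> (mwt wt m < wt s + wt t)%N].

Hypothesis std_refl : reflexive std.
Hypothesis std_sym : ssrbool.symmetric std.
Hypothesis straighten : straightening.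

(** Rewriting one nonstandard pair of letters of m lowers the weight, so that
induction on the weight applies. *)
Lemma straighten_monomial m : exists q,
  [/\ pstd std q, ev q = ev 'X_[m], q \is (mdeg m).-homog &
   if mstd std m then q = 'X_[m]
   else forall m', m' \in msupp q -> (mwt wt m' < mwt wt m)%N].
Proof.
have [w] := ubnP (mwt wt m); elim: w m => // w IH m lt_mw.
have [sm|/[dup] nsm /mstdN[s [t [ms mt nst]]]] := boolP (mstd std m).
  by exists 'X_[m]; split; rewrite ?pstdX ?dhomogX.
have [q [q2 evq wq]] := straighten nst.
have nest : s != t by apply: contraNneq nst => ->.
have Em : m = (m - U_(s) - U_(t) + (U_(s) + U_(t)))%MM.
  apply/mnmP => i; move: ms mt nest; rewrite !mnmDE !mnmBE !mnm1E.
  by case: (eqVneq s i) => [->|_]; case: (eqVneq t i) => [->|_]; rewrite ?eqxx //=; lia.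
set m0 := (m - U_(s) - U_(t))%MM in Em.
have Ed : mdeg m = (mdeg m0 + 2)%N by rewrite Em !mdegD !mdeg1.
have Ew : mwt wt m = (mwt wt m0 + (wt s + wt t))%N by rewrite Em !mwtD !mwtU.
have step m' : m' \in msupp q -> exists q',
  [/\ pstd std q', ev q' = ev 'X_[m0 + m'], q' \is (mdeg m).-homog
    & forall m'', m'' \in msupp q' -> (mwt wt m'' < mwt wt m)%N].
  move=> m'q; have w1 : (mwt wt (m0 + m') < mwt wt m)%N.
    by rewrite mwtD Ew ltn_add2l wq.
  have [|q' [sq' eq' hq' wq']] := IH (m0 + m')%MM.
    by apply: (leq_trans w1); lia.
  exists q'; split=> //.
    by move: hq'; rewrite mdegD Ed (dhomog_mf q2 m'q).
  move=> m'' m''q; case: ifP wq' => [_ Eq'|_ /(_ _ m''q) h].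
    by move: m''q; rewrite Eq' msuppX inE => /eqP->.
  exact: ltn_trans h w1.
pose F m' := if boolP (m' \in msupp q) is AltTrue h then sval (cid (step m' h)) else 0.
have FP m' : m' \in msupp q ->
  [/\ pstd std (F m'), ev (F m') = ev 'X_[m0 + m'], F m' \is (mdeg m).-homog
    & forall m'', m'' \in msupp (F m') -> (mwt wt m'' < mwt wt m)%N].
  by rewrite /F => m'q; case: {-}_ / boolP => [h|/negP//]; case: cid.
exists (\sum_(m' <- msupp q) q@_m' *: F m'); split.
- by rewrite big_seq; apply: pstd_sum => m' /FP[? _ _ _]; apply: pstdZ.
- have -> : ev 'X_[m] = ev 'X_[m0] * ev q.
    by rewrite evq {1}Em !mpolyXD !rmorphM /= !evXU.
  rewrite rmorph_sum (evE q) /= mulr_sumr big_seq [RHS]big_seq.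
  apply: eq_bigr => m' /FP[_ h _ _].
  by rewrite evZ h mpolyXD rmorphM scalerAr.
- rewrite big_seq; apply: rpred_sum => m' /FP[_ _ h _]; exact: rpredZ.
- move=> m'' /msupp_sum_le /flattenP[s' /mapP[m']]; rewrite filter_predT.
  by move=> /FP[_ _ _ h] -> /msuppZ_le /h.
Qed.

Hypothesis indep : forall p, pstd std p -> ev p = 0 -> p = 0.
Hypothesis ev_surj : forall a, exists p, ev p = a.

Definition nfm m : {mpoly K[N]} := sval (cid (straighten_monomial m)).

Lemma nfmP m : [/\ pstd std (nfm m), ev (nfm m) = ev 'X_[m],
    nfm m \is (mdeg m).-homog & if mstd std m then nfm m = 'X_[m]
    else forall m', m' \in msupp (nfm m) -> (mwt wt m' < mwt wt m)%N].
Proof. by rewrite /nfm; case: cid. Qed.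

Definition red p : {mpoly K[N]} := \sum_(m <- msupp p) p@_m *: nfm m.

Lemma pstd_red p : pstd std (red p).
Proof. by apply: pstd_sum => m _; apply: pstdZ; case: (nfmP m). Qed.

Lemma ev_red p : ev (red p) = ev p.
Proof.
rewrite [in RHS]evE rmorph_sum; apply: eq_bigr => m _ /=.
by rewrite evZ; case: (nfmP m) => _ ->.
Qed.

Definition nf a : {mpoly K[N]} := red (sval (cid (ev_surj a))).

Lemma pstd_nf a : pstd std (nf a).
Proof. exact: pstd_red. Qed.

Lemma nfK a : ev (nf a) = a.
Proof. by rewrite ev_red; case: cid. Qed.

Lemma pstd_inj p q : pstd std p -> pstd std q -> ev p = ev q -> p = q.
Proof.
move=> sp sq epq; apply/eqP; rewrite -subr_eq0; apply/eqP/indep.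
  exact: pstdB.
by rewrite rmorphB /= epq subrr.
Qed.

Lemma evK p : pstd std p -> nf (ev p) = p.
Proof. by move=> sp; apply: pstd_inj; rewrite ?pstd_nf ?nfK. Qed.

Lemma nf_ev p : nf (ev p) = red p.
Proof. by apply: pstd_inj; rewrite ?pstd_nf ?pstd_red // nfK ev_red. Qed.

Lemma nfD a b : nf (a + b) = nf a + nf b.
Proof.
by apply: pstd_inj; rewrite ?pstdD ?pstd_nf // rmorphD /= !nfK.
Qed.

Lemma nf0 : nf 0 = 0.
Proof. by apply: pstd_inj; rewrite ?pstd_nf ?pstd0 // nfK rmorph0. Qed.

Lemma nfN a : nf (- a) = - nf a.
Proof. by apply/eqP; rewrite -addr_eq0 -nfD addNr nf0. Qed.

Lemma nfB a b : nf (a - b) = nf a - nf b.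
Proof. by rewrite nfD nfN. Qed.

Lemma nf_sum I (r : seq I) (P : pred I) (F : I -> A) :
  nf (\sum_(i <- r | P i) F i) = \sum_(i <- r | P i) nf (F i).
Proof. exact: (big_morph nf nfD nf0). Qed.

Lemma nf_eq0 a : (nf a == 0) = (a == 0).
Proof.
apply/eqP/eqP => [h|->]; last exact: nf0.
by rewrite -(nfK a) h rmorph0.
Qed.

Lemma nf_mstd a m : m \in msupp (nf a) -> mstd std m.
Proof. by apply/allP/pstd_nf. Qed.

Lemma nf_homog k p : p \is k.-homog -> nf (ev p) \is k.-homog.
Proof.
move=> hp; rewrite nf_ev /red big_seq; apply: rpred_sum => m mp; apply: rpredZ.
by have [_ _ + _] := nfmP m; rewrite (dhomog_mf hp mp).
Qed.

Lemma nf_supp p m : m \in msupp (nf (ev p)) ->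
  exists m', [/\ m' \in msupp p, (mwt wt m <= mwt wt m')%N & mdeg m = mdeg m'].
Proof.
rewrite nf_ev => /msupp_sum_le /flattenP[s /mapP[m']]; rewrite filter_predT.
move=> m'p -> /msuppZ_le mm'; exists m'; have [_ _ hm' hw] := nfmP m'.
split=> //; last exact: (dhomog_mf hm').
case: ifP hw mm' => [_ ->|_ h /h/ltnW//]; by rewrite msuppX inE => /eqP->.
Qed.

(** Rewriting a nonstandard monomial yields smaller weights only, so a standard
monomial whose weight is maximal in p keeps its coefficient. *)
Lemma nf_top p m : mstd std m ->
  (forall m', m' \in msupp p -> (mwt wt m' <= mwt wt m)%N) ->
  (nf (ev p))@_m = p@_m.
Proof.
move=> sm wp; rewrite nf_ev /red [in RHS](mpolyE p) !raddf_sum /= big_seq [RHS]big_seq.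
apply: eq_bigr => m' m'p; rewrite !mcoeffZ; congr (_ * _).
have [_ _ _] := nfmP m'; case: ifP => [_ -> //|nsm' h].
have ne : m' != m by apply: contraFneq nsm' => ->.
rewrite mcoeffX (negbTE ne); apply: memN_msupp_eq0; apply/negP => /h.
by rewrite ltnNge wp.
Qed.

End StandardBasis.

(** * The linear resolution given by a standard basis *)

(** A resolution ... -> A^(W 1) -> A^(W 0) = A -> K, where W p is [lr_basis p]
and [lr_diff x w] is the w-th coordinate of the image of the basis element x.
The basis of the p-th module is in degree p. *)
Record linear_resolution (K : fieldType) (A : comAlgType K) (A_ : nat -> A -> Prop)
    (eps : {rmorphism A -> K}) := LinearResolution {
  lr_basis : nat -> finType;
  lr_point : lr_basis 0;
  lr_diff : forall p, lr_basis p.+1 -> lr_basis p -> A;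
  lr_point_uniq : forall w, w = lr_point;
  lr_diff_linear : forall p x w, A_ 1 (@lr_diff p x w);
  lr_exact0 : forall a : A, eps a = 0 <->
    exists h : {ffun lr_basis 1 -> A}, a = \sum_x h x * lr_diff x lr_point;
  lr_exact : forall p (g : {ffun lr_basis p.+1 -> A}),
    (forall w, \sum_x g x * lr_diff x w = 0) <->
    exists h : {ffun lr_basis p.+2 -> A}, forall x, g x = \sum_y h y * lr_diff y x }.

Section LiftedResolution.
Variables (K : fieldType) (N : nat) (A : comAlgType K) (l : 'I_N -> A).
Variables (std : rel 'I_N) (wt : 'I_N -> nat).
Hypothesis std_refl : reflexive std.
Hypothesis std_sym : ssrbool.symmetric std.
Hypothesis straighten : straightening l std wt.
Hypothesis indep : forall p, pstd std p -> ev l p = 0 -> p = 0.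
Hypothesis ev_surj : forall a, exists p, ev l p = a.

Local Notation ev := (ev l).
Local Notation nf := (nf std_refl straighten ev_surj).
Local Notation mwt := (mwt wt).

(** A submodule Z = [st_mod] of a free module A^W, with a description of its
leading terms.  A standard monomial m times the basis element w of A^W has
level [st_scale * mwt m + st_level w].  By [st_gen], the term y w is the leading
term of an element of Z with linear coordinates whenever [st_lead w y].  By
[st_leading], there are no leading terms but the multiples of these: if none of
the terms of level L of an element of Z of level at most L is such a multiple,
then there is no term of level L. *)
Record stage := Stage {
  st_index : finType;
  st_lead : st_index -> pred 'I_N;
  st_scale : nat;
  st_level : st_index -> nat;
  st_mod : {ffun st_index -> A} -> Prop;
  st_scale_gt0 : (0 < st_scale)%N;
  st_mod0 : st_mod 0;
  st_modD : forall u v, st_mod u -> st_mod v -> st_mod (u + v);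
  st_modM : forall a u, st_mod u -> st_mod [ffun w => a * u w];
  st_gen : forall w y, st_lead w y -> exists z : {ffun st_index -> A},
    [/\ st_mod z, forall w', nf (z w') \is 1.-homog &
      forall w' m, m \in msupp (nf (z w' - l y *+ (w' == w))) ->
        (st_scale * mwt m + st_level w' < st_scale * wt y + st_level w)%N];
  st_leading : forall (z : {ffun st_index -> A}) L, st_mod z ->
    (forall w m, m \in msupp (nf (z w)) -> (st_scale * mwt m + st_level w < L.+1)%N) ->
    (forall w m, m \in msupp (nf (z w)) -> (st_scale * mwt m + st_level w)%N = L ->
       forall y, st_lead w y -> m y = 0%N) ->
    forall w m, m \in msupp (nf (z w)) -> (st_scale * mwt m + st_level w < L)%N }.

Section Division.
Variable S : stage.

Definition lead_term : finType := {wy : st_index S * 'I_N | st_lead wy.1 wy.2}.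
Definition lead_index (x : lead_term) : st_index S := (val x).1.
Definition lead_var (x : lead_term) : 'I_N := (val x).2.

Definition gen (x : lead_term) : {ffun st_index S -> A} := sval (cid (st_gen (valP x))).

Lemma genP (x : lead_term) :
  [/\ st_mod (gen x), forall w', nf (gen x w') \is 1.-homog &
      forall w' m, m \in msupp (nf (gen x w' - l (lead_var x) *+ (w' == lead_index x))) ->
        (st_scale S * mwt m + st_level w' < st_scale S * wt (lead_var x) + st_level (lead_index x))%N].
Proof. by rewrite /gen; case: cid. Qed.

Lemma st_modN u : st_mod u -> st_mod (- u : {ffun st_index S -> A}).
Proof.
move=> /(st_modM (-1)); congr st_mod; apply/ffunP => w.
by rewrite !ffunE mulN1r.
Qed.

Lemma st_mod_sum I (r : seq I) (F : I -> {ffun st_index S -> A}) :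
  (forall i, st_mod (F i)) -> st_mod (\sum_(i <- r) F i).
Proof. by move=> h; elim/big_rec: _ => [|i x _]; [apply: st_mod0|apply: st_modD]. Qed.

(** Here L bounds the levels of the products of the quotients by the generators,
and D the degrees of the quotients. *)
Definition divides (D : pred nat) (L : nat) (z : {ffun st_index S -> A}) :=
  exists a : {ffun lead_term -> A},
  [/\ forall w, z w = \sum_x a x * gen x w,
      forall x m, m \in msupp (nf (a x)) ->
        (st_scale S * (mwt m + wt (lead_var x)) + st_level (lead_index x) < L)%N &
      forall x m, m \in msupp (nf (a x)) -> D (mdeg m)].

Lemma divides0 D L : divides D L 0.
Proof.
exists 0; split=> [w|x m|x m]; rewrite ?ffunE ?nf0 ?msupp0 //.
by rewrite big1 // => x _; rewrite ffunE mul0r.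
Qed.

Lemma dividesD D L u v : divides D L u -> divides D L v -> divides D L (u + v).
Proof.
move=> [a [Ea wa da]] [b [Eb wb db]]; exists (a + b); split.
- by move=> w; rewrite ffunE Ea Eb -big_split; apply: eq_bigr => x _; rewrite ffunE mulrDl.
- move=> x m; rewrite ffunE nfD // => /msuppD_le; rewrite mem_cat => /orP[].
    exact: wa. exact: wb.
- move=> x m; rewrite ffunE nfD // => /msuppD_le; rewrite mem_cat => /orP[].
    exact: da. exact: db.
Qed.

Lemma divides_sum D L I (r : seq I) (F : I -> {ffun st_index S -> A}) :
  (forall i, divides D L (F i)) -> divides D L (\sum_(i <- r) F i).
Proof. by move=> h; elim/big_rec: _ => [|i x _]; [apply: divides0|apply: dividesD]. Qed.

Lemma divides1 (D : pred nat) L a x :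
  (forall m, m \in msupp (nf a) -> (st_scale S * (mwt m + wt (lead_var x)) + st_level (lead_index x) < L)%N) ->
  (forall m, m \in msupp (nf a) -> D (mdeg m)) ->
  divides D L [ffun w => a * gen x w].
Proof.
move=> wa da; exists [ffun x' => a *+ (x' == x)]; split.
- move=> w; rewrite ffunE (bigD1 x) //= ffunE eqxx big1 ?addr0 // => x' /negbTE ne.
  by rewrite ffunE ne mul0r.
- move=> x' m; rewrite ffunE; case: eqP => [->|_]; first exact: wa.
  by rewrite nf0 ?msupp0.
- move=> x' m; rewrite ffunE; case: eqP => _; first exact: da.
  by rewrite nf0 ?msupp0.
Qed.

(** Rewriting a product to normal form does not raise weights, and keeps
degrees. *)
Lemma nf_mul_supp a b m : m \in msupp (nf (a * b)) ->
  exists m1 m2, [/\ m1 \in msupp (nf a), m2 \in msupp (nf b),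
    (mwt m <= mwt m1 + mwt m2)%N & mdeg m = (mdeg m1 + mdeg m2)%N].
Proof.
have -> : a * b = ev (nf a * nf b) by rewrite rmorphM /= !nfK.
move=> /(nf_supp indep)[m' [/msuppM_le/allpairsP[[m1 m2] /= [h1 h2 ->]] h3 ->]].
by exists m1, m2; split=> //; rewrite -?mwtD -?mdegD.
Qed.

(** The terms of top level of z that are multiples m y w of the leading term y w
of a generator are removed by subtracting m times that generator, whose other
terms are lower.  What is left at top level has to vanish by [st_leading], so
that the level has dropped. *)
Lemma division (D : pred nat) L (z : {ffun st_index S -> A}) : st_mod z ->
  (forall w m, m \in msupp (nf (z w)) -> (st_scale S * mwt m + st_level w < L)%N) ->
  (forall w m, m \in msupp (nf (z w)) -> mdeg m != 0%N -> D (mdeg m).-1) ->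
  divides D L z.
Proof.
elim: L z => [|L IH] z Zz wz dz.
  suff -> : z = 0 by apply: divides0.
  apply/ffunP => w; rewrite ffunE; apply/eqP.
  rewrite -(nf_eq0 std_refl straighten indep ev_surj) -msupp_eq0.
  by case E: (msupp _) => [//|m s]; have := wz w m; rewrite E mem_head => /(_ isT).
pose sel (w : st_index S) (m : 'X_{1..N}) := [pick y | st_lead w y && (m y != 0%N)].
pose hit (w : st_index S) (m : 'X_{1..N}) := ((st_scale S * mwt m + st_level w)%N == L) && (sel w m : bool).
have selP w m y : sel w m = Some y -> st_lead w y && (m y != 0%N).
  by rewrite /sel; case: pickP => // y' ? [<-].
(* The multiple of a generator that removes the term m of the coordinate w. *)
pose T (w : st_index S) (m : 'X_{1..N}) : {ffun st_index S -> A} :=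
  if sel w m is Some y then
    if (st_scale S * mwt m + st_level w)%N == L then
    if insub (w, y) is Some x then
      [ffun w' => ev ((nf (z w))@_m *: 'X_[m - U_(y)]) * gen x w'] else 0 else 0 else 0.
have TP w m : m \in msupp (nf (z w)) -> hit w m -> exists y (x : lead_term),
    [/\ m y != 0%N, lead_index x = w, lead_var x = y &
     T w m = [ffun w' => ev ((nf (z w))@_m *: 'X_[m - U_(y)]) * gen x w']].
  rewrite /hit /T => _ /andP[-> /=]; case E: (sel w m) => [y|//] _.
  have /andP[Vy my] := selP _ _ _ E.
  by exists y, (Sub (w, y) Vy : lead_term); rewrite insubT.
have T0 w m : ~~ hit w m -> T w m = 0.
  by rewrite /hit /T; case: (sel w m) => [y|//]; case: eqP.
have nfmon w m y : m \in msupp (nf (z w)) ->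
    nf (ev ((nf (z w))@_m *: 'X_[m - U_(y)])) = (nf (z w))@_m *: 'X_[m - U_(y)].
  by move=> mz; rewrite evK // pstdZ // pstdX mstd_sub // (nf_mstd mz).
have divT w m : m \in msupp (nf (z w)) -> divides D L.+1 (T w m).
  move=> mz; have [h|/T0->] := boolP (hit w m); last exact: divides0.
  have [y [x [my Ew Ey ->]]] := TP w m mz h; case/andP: (h) => /eqP EL _.
  have Em := mnm_rem1 my.
  apply: divides1 => m'; rewrite nfmon // => /msuppZ_le; rewrite msuppX inE => /eqP ->.
    by rewrite Ew Ey -(mwtU wt y) -mwtD -Em EL.
  have := dz w m mz; rewrite {1 2}Em mdegD mdeg1 addn1 /=; exact.
have Tlow w m w' : m \in msupp (nf (z w)) -> exists r,
    T w m w' = ev ((nf (z w))@_m *: 'X_[m]) *+ ((w' == w) && hit w m) + r /\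
    forall m', m' \in msupp (nf r) -> (st_scale S * mwt m' + st_level w' < L)%N.
  move=> mz; have [h|/T0->] := boolP (hit w m); last first.
    by exists 0; rewrite ffunE andbF addr0 nf0 // msupp0.
  have [y [x [my Ew Ey ->]]] := TP w m mz h; case/andP: (h) => /eqP EL _.
  have Em := mnm_rem1 my.
  set q := _ *: 'X_[m - _].
  exists (ev q * (gen x w' - l (lead_var x) *+ (w' == lead_index x))); split.
    rewrite ffunE andbT mulrBr Ew Ey.
    have -> : ev ((nf (z w))@_m *: 'X_[m]) = ev q * l y.
      by rewrite {2}Em mpolyXD -evXU -rmorphM /= /q scalerAl.
    by rewrite mulrnAr addrC subrK.
  move=> m' /nf_mul_supp[m1 [m2 [+ h2 h3 _]]].
  rewrite nfmon // => /msuppZ_le; rewrite msuppX inE => /eqP E1.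
  have [_ _ /(_ w' m2 h2) h4] := genP x.
  have Ewt : mwt m = (mwt m1 + wt y)%N by rewrite Em mwtD mwtU E1.
  rewrite -EL Ewt; move: h4; rewrite Ew Ey => h4.
  have := leq_mul (leqnn (st_scale S)) h3; rewrite !mulnDr => h5.
  lia.
pose z1 := z - \sum_w \sum_(m <- msupp (nf (z w))) T w m.
have divTT : divides D L.+1 (\sum_w \sum_(m <- msupp (nf (z w))) T w m).
  apply: divides_sum => w; rewrite big_seq; elim/big_rec: _ => [|m x mz].
    exact: divides0.
  by apply: dividesD; apply: divT.
have ZTT : st_mod (\sum_w \sum_(m <- msupp (nf (z w))) T w m).
  apply: st_mod_sum => w; apply: st_mod_sum => m.
  have [|/T0->] := boolP (hit w m); last exact: st_mod0.
  case/andP=> EL _; rewrite /T EL; case: (sel w m) => [y|]; last exact: st_mod0.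
  case: insub => [x|]; last exact: st_mod0.
  by apply: st_modM; case: (genP x).
have Zz1 : st_mod z1 by apply: st_modD => //; apply: st_modN.
suff div1 : divides D L z1.
  have -> : z = z1 + \sum_w \sum_(m <- msupp (nf (z w))) T w m by rewrite subrK.
  apply: dividesD => //; case: div1 => a [Ea wa da]; exists a; split=> //.
  by move=> x m /wa; lia.
(* The terms that are not removed. *)
pose top w := \sum_(m <- msupp (nf (z w)) | ~~ hit w m) (nf (z w))@_m *: 'X_[m].
have z1E w : exists r, z1 w = ev (top w) + r /\
    forall m', m' \in msupp (nf r) -> (st_scale S * mwt m' + st_level w < L)%N.
  have sumT w' : exists r, (\sum_(m <- msupp (nf (z w'))) T w' m) w =
      ev (\sum_(m <- msupp (nf (z w')) | hit w' m) (nf (z w'))@_m *: 'X_[m]) *+ (w == w') + r /\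
      forall m', m' \in msupp (nf r) -> (st_scale S * mwt m' + st_level w < L)%N.
    rewrite sum_ffunE; have : {subset msupp (nf (z w')) <= msupp (nf (z w'))} by [].
    move: {1 3 4}(msupp _) => s; elim: s => [_|m s IHs sub].
      by exists 0; rewrite !big_nil rmorph0 mul0rn addr0 nf0 // msupp0.
    have [|r [E1 l1]] := IHs; first by move=> m' m's; apply: sub; rewrite inE m's orbT.
    have [r2 [E2 l2]] := Tlow w' m w (sub _ (mem_head _ _)).
    exists (r2 + r); split.
      rewrite !big_cons E1 E2; case: (hit w' m); rewrite ?andbF ?andbT ?add0r ?addrA.
        by rewrite rmorphD mulrnDl /= -!addrA; congr (_ + _); rewrite addrCA.
      by congr (_ + r); rewrite addrC.
    by move=> m'; rewrite nfD // => /msuppD_le; rewrite mem_cat => /orP[/l2|/l1].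
  have sumTT : exists r, (\sum_w' \sum_(m <- msupp (nf (z w'))) T w' m) w =
      ev (\sum_(m <- msupp (nf (z w)) | hit w m) (nf (z w))@_m *: 'X_[m]) + r /\
      forall m', m' \in msupp (nf r) -> (st_scale S * mwt m' + st_level w < L)%N.
    pose R w' := sval (cid (sumT w')).
    exists (\sum_w' R w'); split.
      rewrite sum_ffunE (eq_bigr (fun w' => ev (\sum_(m <- msupp (nf (z w')) | hit w' m)
        (nf (z w'))@_m *: 'X_[m]) *+ (w == w') + R w')); last first.
        by move=> w' _; rewrite /R; case: cid => r [].
      rewrite big_split; congr (_ + _); rewrite (bigD1 w) //= eqxx.
      by rewrite [X in _ + X = _]big1 ?addr0 // => w' /negbTE ne; rewrite eq_sym ne.
    move=> m'; rewrite nf_sum // => /msupp_sum_le /flattenP[s /mapP[w' _ ->]].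
    by rewrite /R; case: cid => r [_ ] /= h /h.
  have [r [Er lr]] := sumTT; exists (- r); split.
    rewrite /z1 ffunE ffunE Er opprD addrA; congr (_ - r).
    have Ez : z w = ev (\sum_(m <- msupp (nf (z w)) | hit w m) (nf (z w))@_m *: 'X_[m])
        + ev (top w).
      by rewrite -rmorphD -[in LHS](nfK std_refl straighten ev_surj (z w)) [in LHS](mpolyE (nf (z w))) (bigID (hit w)).
    by rewrite {1}Ez addrC addKr.
  by move=> m'; rewrite nfN // (perm_mem (msuppN _)); apply: lr.
have std_top w : pstd std (top w).
  by rewrite /top big_seq_cond; apply: pstd_sum => m /andP[mz _]; rewrite pstdZ // pstdX (nf_mstd mz).
have top_supp w m : m \in msupp (top w) -> m \in msupp (nf (z w)) /\ ~~ hit w m.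
  rewrite /top => /msupp_sum_le/flattenP[s /mapP[m']]; rewrite mem_filter => /andP[h m'z ->].
  by move=> /msuppZ_le; rewrite msuppX inE => /eqP ->.
apply: IH => //.
- apply: st_leading => //.
    move=> w m; have [r [-> lr]] := z1E w; rewrite nfD // => /msuppD_le.
    rewrite mem_cat evK // => /orP[/top_supp[/wz]//|/lr]; lia.
  move=> w m; have [r [-> lr]] := z1E w; rewrite nfD // => /msuppD_le.
  rewrite mem_cat evK // => /orP[/top_supp[mz]|/lr]; last by lia.
  rewrite /hit => + EL y Vy; rewrite EL eqxx /= /sel.
  by case: pickP => // /(_ y); rewrite Vy /= => /negbT; rewrite negbK => /eqP.
- move=> w m; rewrite /z1 ffunE nfD // => /msuppD_le; rewrite mem_cat => /orP[/dz//|].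
  rewrite ffunE nfN // (perm_mem (msuppN _)); case: divTT => a [-> _ da].
  rewrite nf_sum // => /msupp_sum_le /flattenP[s /mapP[x _ ->]].
  move=> /nf_mul_supp[m1 [m2 [/da D1 h2 _ ->]]] _.
  have [_ /(_ w) h1 _] := genP x.
  by rewrite (dhomog_mf h1 h2) addn1.
Qed.

Lemma st_mod_generated (z : {ffun st_index S -> A}) :
  st_mod z <-> exists a : {ffun lead_term -> A}, forall w, z w = \sum_x a x * gen x w.
Proof.
split=> [Zz|[a Ez]].
  pose L := (\sum_w \sum_(m <- msupp (nf (z w))) (st_scale S * mwt m + st_level w)).+1.
  have [|//|a [Ea _ _]] := division (D := predT) (L := L) Zz; last by exists a.
  move=> w m mz; rewrite ltnS (bigD1 w) //= (bigD1_seq m) ?msupp_uniq //=.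
  by rewrite -addnA leq_addr.
have -> : z = \sum_(x <- index_enum lead_term) [ffun w => a x * gen x w].
  by apply/ffunP => w; rewrite sum_ffunE Ez; apply: eq_bigr => x _; rewrite ffunE.
by apply: st_mod_sum => x; apply: st_modM; case: (genP x).
Qed.

Lemma nfl y : nf (l y) = 'X_y.
Proof.
rewrite -evXU evK // pstdX; apply/mstdP => s t; rewrite !mnm1E.
by have [<-|//] := eqVneq y s; have [<-|//] := eqVneq y t.
Qed.

Lemma nf_mul_homog a b i j : nf a \is i.-homog -> nf b \is j.-homog ->
  nf (a * b) \is (i + j).-homog.
Proof.
move=> ha hb; have -> : a * b = ev (nf a * nf b) by rewrite rmorphM /= !nfK.
by apply: nf_homog => //; apply: dhomogM.
Qed.

(** The leading terms of the syzygies between the generators with leading terms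
y w: to the generator for y w belong the variables y' < y for which y' w is also
a leading term (the S-pair of y w and y' w), and those for which y' y is not
standard. *)
Definition next_lead (x : lead_term) : pred 'I_N :=
  [pred y | st_lead (lead_index x) y && (y < lead_var x)%N || ~~ std y (lead_var x)].
Definition next_scale : nat := (N.+1 * st_scale S)%N.

(** The level of a syzygy is the level of the products that it cancels; ties are
broken by the number of the leading variable, for which the factor N.+1 leaves
room. *)
Definition next_level (x : lead_term) : nat := (N.+1 * (st_scale S * wt (lead_var x) + st_level (lead_index x)) + lead_var x)%N.
Definition syzygy (g : {ffun lead_term -> A}) := forall w, \sum_x g x * gen x w = 0.

Lemma syzygy0 : syzygy 0.
Proof. by move=> w; rewrite big1 // => x _; rewrite ffunE mul0r. Qed.

Lemma syzygyD u v : syzygy u -> syzygy v -> syzygy (u + v).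
Proof.
move=> Zu Zv w; under eq_bigr do rewrite ffunE mulrDl.
by rewrite big_split /= Zu Zv addr0.
Qed.

Lemma syzygyM a u : syzygy u -> syzygy [ffun x => a * u x].
Proof.
move=> Zu w; under eq_bigr do rewrite ffunE -mulrA.
by rewrite -mulr_sumr Zu mulr0.
Qed.

Lemma level_lmul y z L m (Cb Ca : nat) :
  (forall m, m \in msupp (nf z) -> (st_scale S * mwt m + Cb < Ca)%N) ->
  (st_scale S * wt y + Ca <= L)%N ->
  m \in msupp (nf (l y * z)) -> (st_scale S * mwt m + Cb < L)%N.
Proof.
move=> hz hL /nf_mul_supp[m1 [m2 [+ /hz h2 h3 _]]].
rewrite nfl msuppX inE => /eqP E1; rewrite E1 mwtU in h3.
by have := leq_mul (leqnn (st_scale S)) h3; rewrite mulnDr; lia.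
Qed.

(** The product of the generator x by l y' has leading term y' y w, y being the
leading variable of x.  If y' y is nonstandard this term can be rewritten into
lower ones; otherwise y' w is the leading term of a generator x', and y times x'
has the same leading term.  In both cases an element h of the module, of degree
2 and of smaller level, remains, and dividing it by the generators, with
quotients of degree 1, gives the syzygy. *)
Lemma next_gen x y' : next_lead x y' -> exists g : {ffun lead_term -> A},
    [/\ syzygy g, forall x', nf (g x') \is 1.-homog &
      forall x' m, m \in msupp (nf (g x' - l y' *+ (x' == x))) ->
        (next_scale * mwt m + next_level x' < next_scale * wt y' + next_level x)%N].
Proof.
move=> Vy'; have [Zx hx wx] := genP x.
pose ty := std y' (lead_var x).
have [x' x'P] : exists x', ty -> [/\ lead_index x' = lead_index x, lead_var x' = y' & (y' < lead_var x)%N].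
  have [st|nst] := boolP ty; last by exists x => /negP.
  move: Vy'; rewrite /next_lead /= -/ty st orbF => /andP[Vwy lt].
  by exists (Sub (lead_index x, y') Vwy : lead_term).
have [Zx' hx' wx'] := genP x'.
(* If y' y is nonstandard only the generator x is used, whatever x' is. *)
pose h : {ffun st_index S -> A} :=
  [ffun w => l y' * gen x w] - [ffun w => (if ty then l (lead_var x) else 0) * gen x' w].
have Zh : st_mod h by apply: st_modD; [|apply: st_modN]; apply: st_modM.
pose Lh := (st_scale S * (wt y' + wt (lead_var x)) + st_level (lead_index x))%N.
have wh w m : m \in msupp (nf (h w)) -> (st_scale S * mwt m + st_level w < Lh)%N.
  rewrite !ffunE; have -> : l y' * gen x w =
      l y' * (gen x w - l (lead_var x) *+ (w == lead_index x)) + (l y' * l (lead_var x)) *+ (w == lead_index x).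
    by rewrite mulrBr mulrnAr subrK.
  have low1 : m \in msupp (nf (l y' * (gen x w - l (lead_var x) *+ (w == lead_index x)))) ->
      (st_scale S * mwt m + st_level w < Lh)%N.
    by apply: level_lmul => [m'|]; [apply: wx|rewrite /Lh; lia].
  have [st|nst] := boolP ty.
    have [Ew' Ey' lty] := x'P st.
    have -> : l (lead_var x) * gen x' w =
        l (lead_var x) * (gen x' w - l y' *+ (w == lead_index x)) + (l y' * l (lead_var x)) *+ (w == lead_index x).
      by rewrite mulrBr mulrnAr [l y' * _]mulrC subrK.
    rewrite opprD addrACA subrr addr0 nfB // => /msuppB_le; rewrite mem_cat => /orP[//|].
    apply: level_lmul => [m'|]; first by rewrite -Ey' -Ew'; apply: wx'.
    by rewrite Ey' Ew' /Lh; lia.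
  rewrite mul0r subr0 nfD // => /msuppD_le; rewrite mem_cat => /orP[//|].
  case: eqP => [->|_]; last by rewrite mulr0n nf0 // msupp0.
  have [q [_ Eq wq]] := straighten nst.
  rewrite mulr1n -Eq => /(nf_supp indep)[m' [/wq h1 h2 _]].
  by rewrite /Lh ltn_add2r ltn_mul2l st_scale_gt0; apply: leq_ltn_trans h1.
have hl y : nf (l y) \is 1.-homog by rewrite nfl dhomogX; apply/eqP; exact: mdeg1.
have hh w : nf (h w) \is 2.-homog.
  rewrite !ffunE nfB // rpredB //; first exact: nf_mul_homog (hl _) (hx _).
  case: ifP => _; first exact: nf_mul_homog (hl _) (hx' _).
  by rewrite mul0r nf0 // rpred0.
have [|a [Ea wa da]] := division (D := pred1 1%N) Zh wh.
  by move=> w m /(dhomog_mf (hh w)) ->.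
pose g : {ffun lead_term -> A} := [ffun x2 =>
  l y' *+ (x2 == x) - (if ty then l (lead_var x) else 0) *+ (x2 == x') - a x2].
exists g; split.
- move=> w; under eq_bigr do rewrite ffunE !mulrBl.
  rewrite !sumrB -Ea !ffunE; apply/eqP; rewrite subr_eq0; apply/eqP; congr (_ - _).
    rewrite (bigD1 x) //= eqxx big1 ?addr0 // => x2 /negbTE ->.
    by rewrite mulr0n mul0r.
  rewrite (bigD1 x') //= eqxx big1 ?addr0 // => x2 /negbTE ->.
  by rewrite mulr0n mul0r.
- move=> x2; rewrite ffunE !nfB // !rpredB //.
  + by case: eqP => _; rewrite ?mulr1n ?mulr0n ?nf0 ?rpred0 ?hl.
  + by case: eqP => _; case: ifP => _; rewrite ?mulr1n ?mulr0n ?nf0 ?rpred0 ?hl.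
  + by apply/dhomogP => m /da/eqP.
- move=> x2 m; rewrite ffunE addrC !addrA addNr add0r -opprD nfN // (perm_mem (msuppN _)).
  rewrite nfD // => /msuppD_le; rewrite mem_cat => /orP[|/wa].
    case: eqP => [->|_]; last by rewrite mulr0n nf0 // msupp0.
    have [st|nst] := boolP ty; last by rewrite mul0rn nf0 // msupp0.
    have [Ew' Ey' lty] := x'P st.
    rewrite mulr1n nfl msuppX inE => /eqP ->; rewrite mwtU /next_scale /next_level Ew' Ey'.
    by rewrite !mulnDr !mulnA; lia.
  rewrite /Lh /next_scale /next_level => h1.
  have := leq_mul (leqnn N.+1) h1; have := ltn_ord (lead_var x2).
  by rewrite !mulnDr !mulnS !mulnDr !mulnA; lia.
Qed.

(** Suppose that m at x is a term of top level that avoids [next_lead x].  Then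
M = m y is standard, y being the leading variable of x, and its coefficient in
the coordinate w of the vanishing combination can be computed.  Another x2 over
the same w contributes to it only if its variable y2 divides M and comes before
y, but then y2 divides m and belongs to [next_lead x].  Hence the coefficient
is that of m in g x, which is therefore 0. *)
Lemma next_leading (g : {ffun lead_term -> A}) L : syzygy g ->
    (forall x m, m \in msupp (nf (g x)) -> (next_scale * mwt m + next_level x < L.+1)%N) ->
    (forall x m, m \in msupp (nf (g x)) -> (next_scale * mwt m + next_level x)%N = L ->
       forall y, next_lead x y -> m y = 0%N) ->
    forall x m, m \in msupp (nf (g x)) -> (next_scale * mwt m + next_level x < L)%N.
Proof.
move=> Zg wg Vg x m mg; have := wg x m mg; rewrite ltnS leq_eqVlt => /orP[/eqP EL|//].
have Vm := Vg x m mg EL; pose M := (m + U_(lead_var x))%MM.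
have mstdM : mstd std M.
  have sm := nf_mstd mg; move/mstdP: (sm) => smP.
  have st y : m y != 0%N -> std y (lead_var x).
    by move=> my; apply: contraNT my => nst; rewrite Vm // /next_lead /= nst orbT.
  apply/mstdP => s t; rewrite !mnmDE !mnm1E.
  have [<-|ns] := eqVneq (lead_var x) s; have [<-|nt] := eqVneq (lead_var x) t => //=.
  - by rewrite addn0 => _ mt; rewrite std_sym; apply: st.
  - by rewrite addn0 => ms _; apply: st.
  - by rewrite !addn0; apply: smP.
(* The level L determines that of M at w and the number of the variable y, by
   division by N.+1. *)
pose l0 := (st_scale S * mwt M + st_level (lead_index x))%N.
have EL0 : L = (N.+1 * l0 + lead_var x)%N.
  by rewrite -EL /l0 /M mwtD mwtU /next_scale /next_level !mulnDr !mulnA; lia.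
have lev x2 m1 : m1 \in msupp (nf (g x2)) ->
    (st_scale S * (mwt m1 + wt (lead_var x2)) + st_level (lead_index x2) <= l0)%N /\
    ((st_scale S * (mwt m1 + wt (lead_var x2)) + st_level (lead_index x2))%N = l0 -> (lead_var x2 <= lead_var x)%N).
  move=> /wg; rewrite ltnS EL0.
  have -> : (next_scale * mwt m1 + next_level x2 =
      N.+1 * (st_scale S * (mwt m1 + wt (lead_var x2)) + st_level (lead_index x2)) + lead_var x2)%N.
    by rewrite /next_scale /next_level !mulnDr !mulnA; lia.
  move: (_ + st_level (lead_index x2))%N => X h; have := ltn_ord (lead_var x); split; last by lia.
  rewrite leqNgt; apply/negP => h2; have := leq_mul (leqnn N.+1) h2; lia.
have coefM x2 : (nf (g x2 * gen x2 (lead_index x)))@_M = (nf (g x))@_m *+ (x2 == x).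
  have [_ _ wx2] := genP x2.
  have -> : g x2 * gen x2 (lead_index x) = g x2 * (gen x2 (lead_index x) - l (lead_var x2) *+ (lead_index x == lead_index x2)) +
      (g x2 * l (lead_var x2)) *+ (lead_index x == lead_index x2) by rewrite mulrBr mulrnAr subrK.
  rewrite nfD // mcoeffD.
  rewrite [X in X + _](_ : _ = 0) ?add0r; last first.
    apply: memN_msupp_eq0; apply/negP => /nf_mul_supp[m1 [m2 [/lev[h1 _] /wx2 h2 h3 _]]].
    have := leq_mul (leqnn (st_scale S)) h3; rewrite /l0 in h1; move: h1 h2.
    by rewrite !mulnDr; lia.
  have [Ew|ne] := eqVneq (lead_index x) (lead_index x2); last first.
    rewrite mulr0n nf0 // mcoeff0; case: eqP => [E|]; last by rewrite mulr0n.
    by rewrite E eqxx in ne.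
  have -> : g x2 * l (lead_var x2) = ev (nf (g x2) * 'X_(lead_var x2)) by rewrite rmorphM /= nfK evXU.
  rewrite mulr1n nf_top //; last first.
    move=> m' /msuppM_le/allpairsP[[m1 m2] /= [/lev[h1 _]]].
    rewrite msuppX inE => /eqP -> ->; rewrite mwtD mwtU.
    have : (st_scale S * (mwt m1 + wt (lead_var x2)) <= st_scale S * mwt M)%N by rewrite /l0 Ew in h1; lia.
    by rewrite leq_pmul2l ?st_scale_gt0.
  have [Ex|nx] := eqVneq x2 x; first by rewrite Ex /M addmC mcoeffMX.
  have ney : lead_var x2 != lead_var x.
    apply: contra nx => /eqP Ey; apply/eqP/val_inj.
    by rewrite [LHS]surjective_pairing [RHS]surjective_pairing; congr (_, _).
  rewrite mulr0n; have [M0|M1] := eqVneq (M (lead_var x2)) 0%N.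
    apply: memN_msupp_eq0; apply/negP => /msuppM_le/allpairsP[[m1 m2] /= [_]].
    rewrite msuppX inE => /eqP -> EM; move: M0; rewrite EM mnmDE mnm1E eqxx; lia.
  have EM := mnm_rem1 M1; rewrite EM addmC mcoeffMX.
  apply: memN_msupp_eq0; apply/negP => /lev[_].
  rewrite -(mwtU wt (lead_var x2)) -mwtD -EM /l0 -Ew => /(_ erefl) le.
  have m2 : m (lead_var x2) != 0%N.
    by move: M1; rewrite /M mnmDE mnm1E [lead_var x == _]eq_sym (negbTE ney) addn0.
  move/eqP: m2; apply; apply: Vm; rewrite /next_lead /= ltn_neqAle le andbT Ew val_eqE ney andbT.
  by have -> : st_lead (lead_index x2) (lead_var x2) := valP x2.
have := Zg (lead_index x) => /(congr1 (fun a => (nf a)@_M)); rewrite nf0 // mcoeff0 nf_sum // raddf_sum /=.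
rewrite (eq_bigr _ (fun x2 _ => coefM x2)) (bigD1 x) //= eqxx mulr1n big1 ?addr0.
  by move/eqP; rewrite mcoeff_eq0 mg.
by move=> x2 /negbTE ->.
Qed.

Lemma next_scale_gt0 : (0 < next_scale)%N.
Proof. by rewrite muln_gt0 st_scale_gt0. Qed.

Definition next : stage := Stage next_scale_gt0 syzygy0 syzygyD syzygyM next_gen next_leading.

End Division.

Variable eps : {rmorphism A -> K}.
Hypothesis eps_ev : forall p, eps (ev p) = p@_0%MM.

Definition start_mod (z : {ffun unit -> A}) := eps (z tt) = 0.

Lemma start_gen (w : unit) (y : 'I_N) : true -> exists z : {ffun unit -> A},
  [/\ start_mod z, forall w', nf (z w') \is 1.-homog &
    forall w' m, m \in msupp (nf (z w' - l y *+ (w' == w))) ->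
      (1 * mwt m + 0 < 1 * wt y + 0)%N].
Proof.
move=> _; exists [ffun=> l y]; split.
- by rewrite /start_mod ffunE -evXU eps_ev mcoeffX mnm1_eq0.
- by move=> w'; rewrite ffunE nfl // dhomogX; apply/eqP; exact: mdeg1.
- by move=> [] m; case: w; rewrite ffunE eqxx subrr nf0 // msupp0.
Qed.

Lemma start_lead (z : {ffun unit -> A}) L : start_mod z ->
  (forall w m, m \in msupp (nf (z w)) -> (1 * mwt m + 0 < L.+1)%N) ->
  (forall w m, m \in msupp (nf (z w)) -> (1 * mwt m + 0)%N = L ->
     forall y, true -> m y = 0%N) ->
  forall w m, m \in msupp (nf (z w)) -> (1 * mwt m + 0 < L)%N.
Proof.
move=> Zz wz Vz [] m mz; have := wz tt m mz; rewrite ltnS leq_eqVlt => /orP[/eqP EL|//].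
have m0 : m = 0%MM by apply/mnmP => y; rewrite mnm0E; exact: (Vz tt m mz EL).
by move: mz; rewrite m0 mcoeff_msupp -eps_ev nfK Zz eqxx.
Qed.

Lemma start_0 : start_mod 0.
Proof. by rewrite /start_mod ffunE rmorph0. Qed.

Lemma start_D u v : start_mod u -> start_mod v -> start_mod (u + v).
Proof. by rewrite /start_mod ffunE rmorphD => -> ->; rewrite addr0. Qed.

Lemma start_M a u : start_mod u -> start_mod [ffun w => a * u w].
Proof. by rewrite /start_mod ffunE rmorphM => ->; rewrite mulr0. Qed.

(** The kernel of the augmentation, in which all the variables are leading
terms. *)
Definition start : stage := @Stage unit (fun=> predT) 1 (fun=> 0%N) start_mod
  isT start_0 start_D start_M start_gen start_lead.

Fixpoint stages p : stage := if p is p'.+1 then next (stages p') else start.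

Variable A_ : nat -> A -> Prop.
Hypothesis A1P : forall a, nf a \is 1.-homog -> A_ 1 a.

Theorem standard_basis_resolution : linear_resolution A_ eps.
Proof.
pose W p := st_index (stages p).
pose d p : W p.+1 -> W p -> A := fun x w => @gen (stages p) x w.
exists W tt d.
- by case.
- by move=> p x w; apply: A1P; have [_ + _] := @genP (stages p) x; apply.
- move=> a; have := st_mod_generated (S := stages 0) [ffun=> a]; rewrite /= /start_mod ffunE => ->.
  by split=> -[h Eh]; exists h; [have := Eh tt|case]; rewrite ffunE.
- move=> p g; have := @st_mod_generated (stages p.+1) g; rewrite /= /syzygy => ->.
  by split=> -[h Eh]; exists h.
Qed.

End LiftedResolution.

(** * Tor is computed by a linear resolution *)
Section FreeModules.
Variables (R : comNzRingType) (B : choiceType).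
Implicit Types (x y : {freeg B / R}).

Lemma freegP x y : (forall b, coeff b x = coeff b y) -> x = y.
Proof. by move=> h; apply/eqP/freeg_eqP. Qed.

Definition fgbuild (s : seq B) (f : B -> R) : {freeg B / R} :=
  \sum_(b <- undup s) << f b *g b >>.

Lemma coeff_fgbuild s f b : coeff b (fgbuild s f) = f b *+ (b \in s).
Proof.
rewrite /fgbuild raddf_sum /=; under eq_bigr do rewrite coeffU.
have [bs|nbs] := boolP (b \in s).
  rewrite (bigD1_seq b) ?undup_uniq ?mem_undup //= eqxx mulr1 big1 ?addr0 //.
  by move=> i /negbTE ->; rewrite mulr0.
rewrite big_seq big1 // => i; rewrite mem_undup => i_s.
by case: eqP => [E|_]; [rewrite -E i_s in nbs|rewrite mulr0].
Qed.

Lemma freegU_scale (a : R) b : << a *g b >> = a *: << b >> :> {freeg B / R}.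
Proof. by apply: freegP => b'; rewrite coeffZ !coeffU mul1r. Qed.

Lemma freegE x : x = \sum_(b <- dom x) coeff b x *: << b >>.
Proof. by rewrite -{1}[x]freeg_sumE; apply: eq_bigr => b _; exact: freegU_scale. Qed.

End FreeModules.

Record grading (K : fieldType) (A : comAlgType K) (A_ : nat -> A -> Prop)
    (eps : {rmorphism A -> K}) := Grading {
  gr_proj : nat -> A -> A;
  gr_proj_additive : forall m, additive (gr_proj m);
  gr_proj_in : forall m a, A_ m (gr_proj m a);
  gr_proj_id : forall m a, A_ m a -> gr_proj m a = a;
  gr_proj_ne : forall m m' a, A_ m a -> m' != m -> gr_proj m' a = 0;
  gr_proj_sum : forall a, exists k, a = \sum_(m < k) gr_proj m a;
  gradM : forall i j a b, A_ i a -> A_ j b -> A_ (i + j)%N (a * b);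
  grad_scalar : forall c : K, A_ 0 c%:A;
  epsK : forall c : K, eps c%:A = c;
  eps_pos : forall m a, A_ m.+1 a -> eps a = 0 }.

Section Tor.
Variables (K : fieldType) (A : comAlgType K) (A_ : nat -> A -> Prop).
Variables (eps : {rmorphism A -> K}) (G : grading A_ eps).

HB.instance Definition _ m := GRing.isAdditive.Build A A (gr_proj G m) (@gr_proj_additive _ _ _ _ G m).

Definition zpr (j : int) : A -> A := if j is Posz m then gr_proj G m else fun=> 0.

Lemma zpr_is_additive j : additive (zpr j).
Proof. by case: j => m a b /=; [rewrite raddfB|rewrite subr0]. Qed.

HB.instance Definition _ j := GRing.isAdditive.Build A A (zpr j) (zpr_is_additive j).

Lemma piece0 m : A_ m 0.
Proof. by have := gr_proj_in G m 0; rewrite raddf0. Qed.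

Lemma zpiece0 j : zpiece A_ j 0.
Proof. by case: j => // m; apply: piece0. Qed.

Lemma zpr_in j a : zpiece A_ j (zpr j a).
Proof. by case: j => // m; apply: gr_proj_in. Qed.

Lemma zpr_id j a : zpiece A_ j a -> zpr j a = a.
Proof. by case: j => [m /gr_proj_id|m] /= ->. Qed.

Lemma gr_proj_mul m k a c : A_ k c -> gr_proj G m (a * c) = (if (k <= m)%N then gr_proj G (m - k) a else 0) * c.
Proof.
move=> kc; have [B Ea] := gr_proj_sum G a; rewrite {1}Ea mulr_suml raddf_sum /=.
have term i : gr_proj G m (gr_proj G i a * c) = (gr_proj G i a * c) *+ (m == i + k)%N.
  have h := gradM G (gr_proj_in G i a) kc; have [E|ne] := eqVneq m (i + k)%N.
    by rewrite E (gr_proj_id G h).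
  by rewrite (gr_proj_ne G h ne).
under eq_bigr do rewrite term.
case: leqP => [le_km|lt_mk]; last first.
  by rewrite mul0r big1 // => i _; case: eqP => // E; move: lt_mk; rewrite E; lia.
rewrite [in RHS]Ea raddf_sum mulr_suml; apply: eq_bigr => i _ /=.
have [E|ne] := eqVneq (m - k)%N i.
  by rewrite -E subnK // eqxx (gr_proj_id G (gr_proj_in G _ _)).
rewrite (gr_proj_ne G (gr_proj_in G _ _) ne) mul0r; case: eqP => // E.
by move: ne; rewrite E addnK eqxx.
Qed.

Lemma zpr_mul j k a c : zpiece A_ k c -> zpr j (a * c) = zpr (j - k) a * c.
Proof.
case: k => [k kc|k /= ->]; last by rewrite !mulr0 raddf0.
case: j => [m|m] /=.
  rewrite (gr_proj_mul _ _ kc); case: leqP => h; first by rewrite subzn.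
  by have [p ->] : exists p, m%:Z - k%:Z = Negz p by exists (k - m).-1; lia.
have [p ->] : exists p, Negz m - k%:Z = Negz p by exists (m + k)%N; lia.
by rewrite /= mul0r.
Qed.

Lemma eps_zpiece j a : zpiece A_ j a -> j != 0 -> eps a = 0.
Proof. by case: j => [[//|m]|m] /= => [/(eps_pos G)|->] //; rewrite rmorph0. Qed.

Section Projection.
Variables (B : choiceType) (deg : B -> int).
Implicit Types x y : {freeg B / A}.

Definition proj (j : int) x := fgbuild (dom x) (fun b => zpr (j - deg b) (coeff b x)).

Lemma coeff_proj j x b : coeff b (proj j x) = zpr (j - deg b) (coeff b x).
Proof.
rewrite coeff_fgbuild mem_dom; case: eqP => [->|_]; last by rewrite mulr1n.
by rewrite mulr0n raddf0.
Qed.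

Lemma proj_homog j x : homogA A_ deg j (proj j x).
Proof. by move=> b; rewrite coeff_proj; apply: zpr_in. Qed.

Lemma proj_id j x : homogA A_ deg j x -> proj j x = x.
Proof. by move=> hx; apply: freegP => b; rewrite coeff_proj zpr_id. Qed.

Lemma proj_is_additive j : additive (proj j).
Proof. by move=> x y; apply: freegP => b; rewrite coeffB !coeff_proj coeffB raddfB. Qed.

HB.instance Definition _ j := GRing.isAdditive.Build _ _ (proj j) (proj_is_additive j).

Lemma coeff_tensK x b : coeff b (tensK eps x) = eps (coeff b x).
Proof.
have -> : tensK eps x = fgbuild (dom x) (fun b => eps (coeff b x)).
  by rewrite /fgbuild undup_id // uniq_dom.
rewrite coeff_fgbuild mem_dom; case: eqP => [->|_]; last by rewrite mulr1n.
by rewrite mulr0n rmorph0.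
Qed.

Lemma tensKD x y : tensK eps (x + y) = tensK eps x + tensK eps y.
Proof. by apply: freegP => b; rewrite coeffD !coeff_tensK coeffD rmorphD. Qed.

Lemma tensK0 : tensK eps (0 : {freeg B / A}) = 0.
Proof. by apply: freegP => b; rewrite coeff_tensK !coeff0 rmorph0. Qed.

Lemma tensKZ a x : tensK eps (a *: x) = eps a *: tensK eps x.
Proof. by apply: freegP => b; rewrite coeffZ !coeff_tensK coeffZ rmorphM. Qed.

End Projection.

Variable L : linear_resolution A_ eps.
Local Notation W := (lr_basis L).
Local Notation d := (@lr_diff _ _ _ _ L).

(** Let G be the linear resolution.  An element of F_i (x) G_p is a family of
elements of F_i indexed by the basis of G_p, and [dW] is the differential of
F_i (x) G. *)
Section Tensor.
Variables (B : choiceType) (deg : B -> int).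
Implicit Types (p : nat).

Definition dW p (v : W p.+1 -> {freeg B / A}) : W p -> {freeg B / A} :=
  fun w => \sum_x d x w *: v x.

Lemma coeff_dW p v w b : coeff b (@dW p v w) = \sum_x coeff b (v x) * d x w.
Proof. by rewrite raddf_sum; apply: eq_bigr => x _ /=; rewrite coeffZ mulrC. Qed.

Lemma dW_proj p v j w : @dW p (fun x => proj deg (j - 1) (v x)) w = proj deg j (dW v w).
Proof.
apply: freegP => b; rewrite coeff_proj !coeff_dW raddf_sum; apply: eq_bigr => x _ /=.
have h : zpiece A_ (Posz 1) (d x w) by apply: lr_diff_linear.
by rewrite coeff_proj (zpr_mul (j - deg b) _ h) addrAC.
Qed.

(** A relation r between families of scalars that can be solved coefficient by
coefficient can be solved in a free module: only finitely many b give a nonzero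
problem. *)
Lemma assemble (W' : finType) (u : W' -> {freeg B / A}) (T : finType)
    (r : (W' -> A) -> (T -> A) -> Prop) :
  (forall b, exists h, r (fun w => coeff b (u w)) h) -> r (fun=> 0) (fun=> 0) ->
  exists v : T -> {freeg B / A}, forall b,
    r (fun w => coeff b (u w)) (fun x => coeff b (v x)).
Proof.
move=> ex r0; pose s := flatten [seq dom (u w) | w <- enum W'].
pose h b := sval (cid (ex b)).
exists (fun x => fgbuild s (fun b => h b x)) => b.
have [bs|nbs] := boolP (b \in s).
  rewrite (_ : (fun x => _) = h b); first by rewrite /h; case: cid.
  by apply/funext => x; rewrite coeff_fgbuild bs.
rewrite (_ : (fun w => _) = fun=> 0).
  by rewrite (_ : (fun x => _) = fun=> 0) //; apply/funext => x; rewrite coeff_fgbuild (negbTE nbs).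
apply/funext => w; apply: coeff_outdom; apply: contra nbs => bw.
by apply/flatten_mapP; exists w; rewrite ?mem_enum.
Qed.

Lemma dW_exact p (u : W p.+1 -> {freeg B / A}) : (forall w, dW u w = 0) ->
  exists v : W p.+2 -> {freeg B / A}, forall x, u x = dW v x.
Proof.
move=> du0; pose r (g : W p.+1 -> A) (h : W p.+2 -> A) := forall x, g x = \sum_y h y * d y x.
have [b||v hv] := @assemble _ u _ r.
- have [h hE] : exists h : {ffun W p.+2 -> A}, forall x, [ffun x => coeff b (u x)] x = \sum_y h y * d y x.
    apply/(lr_exact (l := L)) => w.
    under eq_bigr do rewrite ffunE.
    by rewrite -coeff_dW du0 coeff0.
  by exists h => x; rewrite -hE ffunE.
- by move=> x; rewrite big1 // => y _; rewrite mul0r.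
- by exists v => x; apply: freegP => b; rewrite coeff_dW hv.
Qed.

Lemma dW_exact0 (z : {freeg B / A}) : (forall b, eps (coeff b z) = 0) ->
  exists v : W 1 -> {freeg B / A}, z = dW v (lr_point L).
Proof.
move=> z0; pose r (g : unit -> A) (h : W 1 -> A) := g tt = \sum_y h y * d y (lr_point L).
have [b||v hv] := @assemble _ (fun _ : unit => z) _ r.
- by have /(lr_exact0 L)[h hE] := z0 b; exists h.
- by rewrite /r big1 // => y _; rewrite mul0r.
- by exists v; apply: freegP => b; rewrite coeff_dW hv.
Qed.

Lemma eps_lr_diff x : eps (d x (lr_point L)) = 0.
Proof.
apply/(lr_exact0 L); exists [ffun y => (y == x)%:R].
rewrite (bigD1 x) //= ffunE eqxx mul1r big1 ?addr0 // => y /negbTE ne.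
by rewrite ffunE ne mul0r.
Qed.

Lemma dW_dW p (v : W p.+2 -> {freeg B / A}) w : dW (dW v) w = 0.
Proof.
apply: freegP => b; rewrite coeff_dW coeff0.
have := (lr_exact (l := L) [ffun x => coeff b (dW v x)]).2.
have h : exists h : {ffun W p.+2 -> A}, forall x, [ffun x => coeff b (dW v x)] x = \sum_y h y * d y x.
  by exists [ffun y => coeff b (v y)] => x; rewrite ffunE coeff_dW; apply: eq_bigr => y _; rewrite ffunE.
by move=> /(_ h w); under eq_bigr do rewrite ffunE.
Qed.

End Tensor.

Section Chase.
Variable F : resolution A_ eps.
Local Notation bd i := (@bdeg _ _ _ _ F i).
Local Notation dF := (diff F).

Lemma diffE i x : dF i x = \sum_(b <- dom x) coeff b x *: dF i << b >>.
Proof. by rewrite {1}[x]freegE linear_sum; apply: eq_bigr => b _; rewrite linearZ. Qed.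

Lemma diff_proj i j x : dF i (proj (bd i.+1) j x) = proj (bd i) j (dF i x).
Proof.
have Ep : proj (bd i.+1) j x = \sum_(b <- dom x) zpr (j - bd i.+1 b) (coeff b x) *: << b >>.
  by rewrite /proj /fgbuild undup_id ?uniq_dom //; apply: eq_bigr => b _; exact: freegU_scale.
rewrite Ep linear_sum (diffE x) /=; apply: freegP => b'.
rewrite coeff_proj !raddf_sum /=; apply: eq_bigr => b _.
rewrite linearZ !coeffZ (zpr_mul _ _ (diff_homog b b')).
by congr (zpr _ _ * _); rewrite opprB addrA subrK.
Qed.

Lemma diff_dW i p (v : W p.+1 -> {freeg (base F i.+1) / A}) w :
  dF i (dW v w) = dW (fun x => dF i (v x)) w.
Proof. by rewrite /dW linear_sum; apply: eq_bigr => x _; rewrite linearZ. Qed.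

Lemma diff_diff i x : dF i (dF i.+1 x) = 0.
Proof. by apply/diff_exact; exists x. Qed.

(** The image of u in F_(i-1) (x) G_p lifts to F_(i-1) (x) G_(p+1). *)
Definition pre_cycle i p : (W p -> {freeg (base F i) / A}) -> Prop :=
  match i with
  | 0 => fun=> True
  | i'.+1 => fun u => exists v : W p.+1 -> {freeg (base F i') / A}, forall w, dF i' (u w) = dW v w
  end.

Lemma aug_homog0 j (x : {freeg (base F 0) / A}) : homogA A_ (bd 0) j x -> j != 0 -> aug F x = 0.
Proof.
move=> hx j0; rewrite [x]freegE linear_sum big1 // => b _.
rewrite linearZ /=; have [E|ne] := eqVneq j (bd 0 b).
  by rewrite aug_homog ?mulr0 // -E.
by rewrite (eps_zpiece (hx b)) ?mul0r // subr_eq0.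
Qed.

(** The zigzag in the double complex F (x) G.  Going from (i, p) to (i-1, p+1)
lowers the internal degree j by 1, because G is linear, and so keeps j - i; at
i = 0 the degree is not 0, so u is killed by the augmentation and is a boundary.
The way back uses the exactness of F at each step. *)
Lemma chase i p j (u : W p -> {freeg (base F i) / A}) :
  (forall w, homogA A_ (bd i) j (u w)) -> j != i%:Z -> pre_cycle u ->
  exists (y : W p -> {freeg (base F i.+1) / A}) (y' : W p.+1 -> {freeg (base F i) / A}),
    forall w, u w = dF i (y w) + dW y' w.
Proof.
elim: i p j u => [|i IH] p j u hu ne_ji pre_u.
  have ex w : exists y, u w = dF 0 y by apply/aug_exact/(aug_homog0 (hu w)).
  exists (fun w => sval (cid (ex w))), (fun=> 0) => w.
  case: cid => y /= <-; rewrite /dW big1 ?addr0 // => x _; exact: scaler0.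
have [v [hv Ev]] : exists v : W p.+1 -> {freeg (base F i) / A},
    (forall x, homogA A_ (bd i) (j - 1) (v x)) /\ forall w, dF i (u w) = dW v w.
  case: pre_u => v0 Ev0; exists (fun x => proj (bd i) (j - 1) (v0 x)); split=> [x|w].
    exact: proj_homog.
  by rewrite dW_proj -Ev0 -diff_proj proj_id.
have [||y [y' Ey]] := IH p.+1 (j - 1) v hv.
- by apply: contra ne_ji => /eqP; lia.
- case: i v {IH hu ne_ji pre_u hv} u Ev => [//|i] v u Ev /=.
  by apply: dW_exact => w; rewrite -diff_dW -Ev diff_diff.
have ex w : exists z, u w - dW y w = dF i.+1 z.
  apply/diff_exact; rewrite linearB /= Ev diff_dW.
  rewrite (_ : dW v w = dW (fun x => dF i (y x)) w + dW (dW y') w).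
    by rewrite dW_dW addr0 subrr.
  by rewrite -big_split; apply: eq_bigr => x _; rewrite Ey scalerDr.
exists (fun w => sval (cid (ex w))), y => w.
by case: cid => z /= <-; rewrite subrK.
Qed.

Lemma diffK_additive i : additive (@diffK _ _ _ _ F i).
Proof. exact: lift_is_additive. Qed.

HB.instance Definition _ i := GRing.isAdditive.Build _ _ (@diffK _ _ _ _ F i) (@diffK_additive i).

Lemma diffK_tensK i (y : {freeg (base F i.+1) / A}) :
  diffK (tensK eps y) = tensK eps (dF i y).
Proof.
rewrite {1}[y]freegE diffE; elim: (dom y) => [|b s IHs].
  by rewrite !big_nil !tensK0 raddf0.
rewrite !big_cons !tensKD !tensKZ -IHs raddfD /=; congr (_ + _).
have -> : tensK eps << b >> = << b >> :> {freeg (base F i.+1) / K}.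
  by apply: freegP => b'; rewrite coeff_tensK !coeffU !mul1r rmorph_nat.
by rewrite -freegU_scale /diffK liftU.
Qed.

(** A cycle z of F (x) K lifts to an element z' of F_i (x) G_0 that satisfies the
hypothesis of the zigzag, because the kernel of F_(i-1) -> F_(i-1) (x) K is the
image of F_(i-1) (x) G_1.  The resulting decomposition of z' becomes z = diff w
over K, where the entries of the differential of G vanish. *)
Theorem linear_resolution_Tor i j : i%:Z != j -> Tor_eq0 F i j.
Proof.
move=> ne_ij z hz cz.
pose z' : {freeg (base F i) / A} := fgbuild (dom z) (fun b => (coeff b z)%:A).
have cz' b : coeff b z' = (coeff b z)%:A.
  rewrite coeff_fgbuild mem_dom; case: eqP => [->|_]; last by rewrite mulr1n.
  by rewrite mulr0n scale0r.
have tz' : tensK eps z' = z.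
  by apply: freegP => b; rewrite coeff_tensK cz' (epsK G).
have hz' : homogA A_ (bd i) j z'.
  move=> b; rewrite cz'; have [->|ne0] := eqVneq (coeff b z) 0.
    by rewrite scale0r; apply: zpiece0.
  rewrite (hz b ne0) subrr; exact: (grad_scalar G).
have pz : @pre_cycle i 0 (fun=> z').
  case: i ne_ij z hz cz z' cz' tz' hz' => [//|i] ne_ij z hz /= cz z' cz' tz' hz'.
  have [|v Ev] := @dW_exact0 _ (dF i z').
    by move=> b; rewrite -coeff_tensK -diffK_tensK tz' cz coeff0.
  by exists v => w; rewrite (lr_point_uniq w).
have [||//|y [y' Ey]] := @chase i 0 j (fun=> z'); rewrite 1?eq_sym //.
pose y0 := proj (bd i.+1) j (y (lr_point L)).
have tdW v : tensK eps (dW v (lr_point L) : {freeg (base F i) / A}) = 0.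
  apply: freegP => b; rewrite coeff_tensK coeff_dW rmorph_sum coeff0 big1 // => x _ /=.
  by rewrite rmorphM /= eps_lr_diff mulr0.
exists (tensK eps y0).
  move=> b; rewrite coeff_tensK coeff_proj => h; apply/eqP; apply: contraNT h => ne.
  by rewrite (eps_zpiece (zpr_in _ _)) // subr_eq0 eq_sym.
rewrite diffK_tensK diff_proj -tz'.
have -> : dF i (y (lr_point L)) = z' - dW y' (lr_point L) by rewrite (Ey (lr_point L)) addrK.
rewrite raddfB /= proj_id // -dW_proj.
by rewrite -scaleN1r tensKD tensKZ tdW scaler0 addr0.
Qed.

End Chase.
End Tor.

(** * Koszulness from a standard basis *)
Section ResolutionOfLinear.
Variables (K : fieldType) (A : comAlgType K) (A_ : nat -> A -> Prop).
Variables (eps : {rmorphism A -> K}) (G : grading A_ eps).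
Variable L : linear_resolution A_ eps.
Local Notation W := (lr_basis L).
Local Notation d := (@lr_diff _ _ _ _ L).

Definition lbase (i : nat) : choiceType := W i.
Definition lbdeg (i : nat) (b : lbase i) : int := i%:Z.

Definition ldiff i (x : {freeg (lbase i.+1) / A}) : {freeg (lbase i) / A} :=
  fgbuild (enum (W i)) (fun w => \sum_b coeff b x * d b w).

Lemma coeff_ldiff i x w : coeff w (@ldiff i x) = \sum_b coeff b x * d b w.
Proof. by rewrite coeff_fgbuild mem_enum. Qed.

Lemma ldiff_is_linear i : linear (@ldiff i).
Proof.
move=> a x y; apply: freegP => w; rewrite coeffD coeffZ !coeff_ldiff mulr_sumr -big_split.
by apply: eq_bigr => b _; rewrite coeffD coeffZ mulrDl mulrA.
Qed.

HB.instance Definition _ i := GRing.isLinear.Build A _ _ _ (@ldiff i) (@ldiff_is_linear i).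

Definition laug (x : {freeg (lbase 0) / A}) : K := eps (coeff (lr_point L) x).

Lemma laug_is_linear : linear_for (eps \; *%R) laug.
Proof. by move=> a x y; rewrite /laug coeffD coeffZ rmorphD rmorphM. Qed.

HB.instance Definition _ :=
  GRing.isLinear.Build A {freeg (lbase 0) / A} K (eps \; *%R) laug laug_is_linear.

Lemma ldiff_homog i (b : lbase i.+1) :
  homogA A_ (@lbdeg i) (lbdeg b) (@ldiff i << b >>).
Proof.
move=> w; rewrite coeff_ldiff /lbdeg (_ : i.+1%:Z - i%:Z = 1%N); last by lia.
rewrite (bigD1 b) //= coeffU eqxx !mul1r big1 ?addr0; first by apply: lr_diff_linear.
by move=> b' ne; rewrite coeffU eq_sym (negbTE ne) mulr0 mul0r.
Qed.

Lemma laug_homog (b : lbase 0) : lbdeg b != 0 -> laug << b >> = 0.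
Proof. by []. Qed.

Lemma laug_surj c : exists x, laug x = c.
Proof. by exists << c%:A *g lr_point L >>; rewrite /laug coeffU eqxx mulr1 (epsK G). Qed.

Lemma laug_exact x : laug x = 0 <-> exists y, x = ldiff y.
Proof.
rewrite /laug (lr_exact0 L); split=> [[h Eh]|[y ->]].
  exists (fgbuild (enum (W 1)) h); apply: freegP => w; rewrite coeff_ldiff (lr_point_uniq w) Eh.
  by apply: eq_bigr => b _; rewrite coeff_fgbuild mem_enum.
exists [ffun b => coeff b y]; rewrite coeff_ldiff.
by apply: eq_bigr => b _; rewrite ffunE.
Qed.

Lemma ldiff_exact i (x : {freeg (lbase i.+1) / A}) :
  ldiff x = 0 <-> exists y, x = @ldiff i.+1 y.
Proof.
have -> : ldiff x = 0 <-> forall w, \sum_b [ffun b => coeff b x] b * d b w = 0.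
  split=> [E w|E].
    by under eq_bigr do rewrite ffunE; rewrite -coeff_ldiff E coeff0.
  apply: freegP => w; rewrite coeff_ldiff coeff0; have := E w.
  by under eq_bigr do rewrite ffunE.
rewrite (lr_exact (l := L)); split=> [[h Eh]|[y ->]].
  exists (fgbuild (enum (W i.+2)) h); apply: freegP => b; rewrite coeff_ldiff.
  have := Eh b; rewrite ffunE => ->.
  by apply: eq_bigr => b' _; rewrite coeff_fgbuild mem_enum.
exists [ffun b => coeff b y] => b; rewrite ffunE coeff_ldiff.
by apply: eq_bigr => b' _; rewrite ffunE.
Qed.

Definition resolution_of_linear : resolution A_ eps :=
  @Resolution _ _ A_ eps lbase lbdeg (fun i => @ldiff i) laug
    ldiff_homog laug_homog laug_surj laug_exact ldiff_exact.

Theorem linear_resolution_Koszul : Koszul A A_ eps.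
Proof.
split; first exact: (inhabits resolution_of_linear).
by move=> F i j; apply: (linear_resolution_Tor G L).
Qed.

End ResolutionOfLinear.

Section KoszulOfStandardBasis.
Variables (K : fieldType) (N : nat) (A : comAlgType K) (l : 'I_N -> A).
Variables (A_ : nat -> A -> Prop) (eps : {rmorphism A -> K}).
Variables (std : rel 'I_N) (wt : 'I_N -> nat).
Hypothesis std_refl : reflexive std.
Hypothesis std_sym : ssrbool.symmetric std.
Hypothesis straighten : straightening l std wt.
Hypothesis indep : forall p, pstd std p -> ev l p = 0 -> p = 0.
Hypothesis ev_surj : forall a, exists p, ev l p = a.
Hypothesis A_P : forall k a, A_ k a <-> exists2 p, p \is k.-homog & ev l p = a.
Hypothesis eps_ev : forall p, eps (ev l p) = p@_0%MM.

Local Notation ev := (ev l).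
Local Notation nf := (nf std_refl straighten ev_surj).

Lemma piece_nf k a : A_ k a <-> nf a \is k.-homog.
Proof.
rewrite A_P; split=> [[p hp <-]|h]; first exact: nf_homog.
by exists (nf a); rewrite ?nfK.
Qed.

Definition nf_pr m a := ev (pihomog mdeg m (nf a)).

Lemma pstd_pihomog m (p : {mpoly K[N]}) : pstd std p -> pstd std (pihomog mdeg m p).
Proof.
move=> sp; rewrite /pihomog big_seq_cond; apply: pstd_sum => m' /andP[m'p _].
by rewrite pstdZ // pstdX; move/allP: sp; apply.
Qed.

(** The homogeneous components of an element are those of its normal form. *)
Lemma nf_grading : grading A_ eps.
Proof.
have nfpr m a : nf (nf_pr m a) = pihomog mdeg m (nf a).
  by rewrite /nf_pr evK // pstd_pihomog // pstd_nf.
exists nf_pr.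
- by move=> m a b; rewrite /nf_pr nfB // !raddfB.
- by move=> m a; rewrite piece_nf nfpr pihomogP.
- by move=> m a /piece_nf h; rewrite /nf_pr pihomog_dE ?nfK.
- move=> m m' a /piece_nf h ne; rewrite /nf_pr (pihomog_ne0 _ h) ?rmorph0 //.
  by rewrite eq_sym.
- move=> a; exists (msize (nf a)); rewrite -raddf_sum /= -pihomog_partitionE ?nfK //.
- move=> i j a b /A_P[p hp <-] /A_P[q hq <-]; apply/A_P; exists (p * q).
    exact: dhomogM.
  by rewrite rmorphM.
- by move=> c; apply/A_P; exists c%:MP; rewrite ?evC // -alg_mpolyC rpredZ // dhomog1.
- by move=> c; rewrite -(evC l) eps_ev mcoeffC eqxx mulr1.
- move=> m a /A_P[p hp <-]; rewrite eps_ev (dhomog_nemf_coeff hp) //.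
  by rewrite /= mdeg0.
Qed.

Theorem standard_basis_Koszul : Koszul A A_ eps.
Proof.
apply: (linear_resolution_Koszul nf_grading).
apply: (@standard_basis_resolution _ _ _ _ _ _ std_refl std_sym straighten indep ev_surj eps eps_ev A_).
by move=> a /piece_nf.
Qed.

End KoszulOfStandardBasis.

(** * Letters and their straightening *)
Section Letters.
Variables (c s : nat).

Definition letter : finType := {pq : 'I_c * 'I_c | (pq.1 < pq.2)%N}.
Local Notation N := #|letter|.
Implicit Types k : 'I_N.

Definition lo k : nat := (val (enum_val k)).1.
Definition hi k : nat := (val (enum_val k)).2.

Lemma lo_hi k : (lo k < hi k)%N.
Proof. exact: (valP (enum_val k)). Qed.

Lemma hi_lt k : (hi k < c)%N.
Proof. exact: ltn_ord. Qed.

Lemma lo_hi_inj k k' : lo k = lo k' -> hi k = hi k' -> k = k'.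
Proof.
move=> /val_inj E1 /val_inj E2; apply: enum_val_inj; apply: val_inj.
by case: (val _) (val _) E1 E2 => ? ? [? ?] /= -> ->.
Qed.

Lemma letterP a b : (a < b)%N -> (b < c)%N -> exists k, lo k = a /\ hi k = b.
Proof.
move=> ab bc; have ac := ltn_trans ab bc.
pose l : letter := exist _ (Ordinal ac, Ordinal bc) ab.
by exists (enum_rank l); rewrite /lo /hi enum_rankK.
Qed.

(** Positions below s are those of the X-columns.  Of the three products of letters
with the same four columns, the first two conditions choose the one that the
Pluecker relation eliminates.  The third condition comes from the shift along the
chain. *)
Definition nonstd a b g h : bool :=
  [|| [&& a < s, a < g, g < b & b < h], [&& s <= a, a < g & h < b]
    | (s <= a) && (b.+2 <= g)]%N.

Definition std_pair k k' : bool :=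
  ~~ nonstd (lo k) (hi k) (lo k') (hi k') && ~~ nonstd (lo k') (hi k') (lo k) (hi k).

Lemma std_pair_refl : reflexive std_pair.
Proof. by move=> k; have := lo_hi k; rewrite /std_pair /nonstd; lia. Qed.

Lemma std_pair_sym : ssrbool.symmetric std_pair.
Proof. by move=> k k'; rewrite /std_pair andbC. Qed.

Definition numY a b : nat := ((s <= a) + (s <= b))%N.

(** Among the letters with the four given columns, the products [p0 p3][p1 p2] and
[p0 p2][p1 p3] have the same total spread, which exceeds that of
[p0 p1][p2 p3]. *)
Definition spread a b : nat := (a * a + b.+1 * b.+1)%N.

(** This separates crossing from nested pairs, the longer letters counting less.
Nested pairs are preferred when an X-column comes first, crossing pairs among
arcs: this is the reason for the two formulas.  The factor c is for pairs made
of a stub and an arc ([defect_cross]). *)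
Definition defect a b : nat :=
  (if s <= a then (c - (b - a)) * (c - (b - a))
   else c * (c * c - (b - a) * (b - a)))%N.

(** [pos_wt] compares products of two letters lexicographically by [numY],
[spread] and [defect]; the factors [wC] and [wB] make each criterion prevail over
the later ones, for spreads that differ by at least 2. *)
Definition wC : nat := (c * c * c).+1.
Definition wB : nat := (2 * (wC * (2 * (c.+1 * c.+1)) + c * c * c)).+1.
Definition pos_wt2 a b : nat := (wB * numY a b + wC * spread a b + defect a b)%N.
Definition pos_wt k : nat := pos_wt2 (lo k) (hi k).

Lemma defect_le a b : (a < b)%N -> (b < c)%N -> (defect a b <= c * c * c)%N.
Proof. by move=> ab bc; rewrite /defect; case: ifP => _; nia. Qed.

Lemma spread_le a b : (a < b)%N -> (b < c)%N -> (spread a b <= 2 * (c.+1 * c.+1))%N.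
Proof. by move=> ab bc; rewrite /spread; nia. Qed.

(** If p1 < s all four letters follow the formula with the factor c, and the claim
is that the squares of the lengths of a nested pair have the larger sum.  If
p1 >= s the letters at p1 are arcs, and what is gained at p0 outweighs the
change of their defects thanks to the factor c. *)
Lemma defect_cross p0 p1 p2 p3 : (p0 < s)%N -> (p0 < p1)%N -> (p1 < p2)%N -> (p2 < p3)%N ->
  (p3 < c)%N -> (defect p0 p3 + defect p1 p2 < defect p0 p2 + defect p1 p3)%N.
Proof.
move=> h0 h01 h12 h23 h3; have h0' : (s <= p0)%N = false by lia.
rewrite /defect h0'; clear h0'.
have E1 : (p0 + (p1 - p0) = p1)%N by lia.
have E2 : (p1 + (p2 - p1) = p2)%N by lia.
have E3 : (p2 + (p3 - p2) = p3)%N by lia.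
have E4 : (p3 + (c - p3) = c)%N by lia.
move: (p1 - p0)%N (p2 - p1)%N (p3 - p2)%N (c - p3)%N E1 E2 E3 E4 => x y z t E1 E2 E3 E4.
have [x0 [y0 z0]] : (0 < x)%N /\ (0 < y)%N /\ (0 < z)%N by lia.
subst p1 p2 p3.
have -> : (p0 + x + y + z - p0 = x + y + z)%N by lia.
have -> : (p0 + x + y - p0 = x + y)%N by lia.
have -> : (p0 + x + y + z - (p0 + x) = y + z)%N by lia.
rewrite -E4; set C := (p0 + x + y + z + t)%N.
have leW : ((x + y + z) * (x + y + z) <= C * C)%N by apply: leq_mul; rewrite /C; lia.
have xz : (0 < x * z)%N by rewrite muln_gt0 x0.
case: ifP => _; last first.
  rewrite -!mulnDr ltn_mul2l; apply/andP; split; first by rewrite /C; lia.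
  move: leW xz; clearbody C; lia.
have -> : (C - y = p0 + x + t + z)%N by rewrite /C; lia.
have -> : (C - (y + z) = p0 + x + t)%N by rewrite /C; lia.
have -> : (C * C - (x + y) * (x + y) =
  C * C - (x + y + z) * (x + y + z) + z * (2 * x + 2 * y + z))%N by lia.
move: (C * C - _)%N => A.
have : (z * (2 * (p0 + x + t) + z) < z * (C * 3))%N.
  by rewrite ltn_mul2l z0 /= /C; lia.
have : (z * (C * 3) <= z * (C * (2 * x + 2 * y + z)))%N.
  by rewrite !leq_mul2l; lia.
lia.
Qed.

Lemma defect_nest p0 p1 p2 p3 : (s <= p0)%N -> (p0 < p1)%N -> (p1 < p2)%N -> (p2 < p3)%N ->
  (p3 < c)%N -> (defect p0 p2 + defect p1 p3 < defect p0 p3 + defect p1 p2)%N.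
Proof.
move=> h0 h01 h12 h23 h3.
have h1 : (s <= p1)%N by lia.
rewrite /defect h0 h1.
have -> : (c - (p2 - p0) = (c - (p3 - p0)) + (p3 - p2))%N by lia.
have -> : (c - (p3 - p1) = (c - (p3 - p0)) + (p1 - p0))%N by lia.
have -> : (c - (p2 - p1) = (c - (p3 - p0)) + (p1 - p0) + (p3 - p2))%N by lia.
have : (0 < (p1 - p0) * (p3 - p2))%N by rewrite muln_gt0; lia.
move: (c - _)%N (p1 - p0)%N (p3 - p2)%N => x y z; lia.
Qed.

Lemma defect_shift a b g h : (s <= a)%N -> (a < b)%N -> (b < g)%N -> (g < h)%N ->
  (h.+1 < c)%N -> (defect a g + defect b.+1 h.+1 < defect a b + defect g.+1 h.+1)%N.
Proof.
move=> sa ab bg gh hc; rewrite /defect sa; have -> : (s <= b.+1)%N by lia.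
have -> : (s <= g.+1)%N by lia.
rewrite -addSn; apply: leq_add; first by apply: ltn_mul; lia.
by apply: leq_mul; lia.
Qed.

Section Compare.
Variables (a1 b1 a2 b2 a3 b3 a4 b4 : nat).
Hypotheses (h1 : (a1 < b1 < c)%N) (h2 : (a2 < b2 < c)%N).
Hypotheses (h3 : (a3 < b3 < c)%N) (h4 : (a4 < b4 < c)%N).

Lemma pos_wt_numY : (numY a1 b1 + numY a2 b2 < numY a3 b3 + numY a4 b4)%N ->
  (pos_wt2 a1 b1 + pos_wt2 a2 b2 < pos_wt2 a3 b3 + pos_wt2 a4 b4)%N.
Proof.
case/andP: h1 h2 => /spread_le u1 /u1 {}u1 /andP[/spread_le u2 /u2 {}u2].
case/andP: h1 h2 => /defect_le v1 /v1 {}v1 /andP[/defect_le v2 /v2 {}v2].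
rewrite /pos_wt2 => lt.
have : (wB * (numY a1 b1 + numY a2 b2).+1 <= wB * (numY a3 b3 + numY a4 b4))%N.
  by rewrite leq_mul2l lt orbT.
have := leq_mul (leqnn wC) u1; have := leq_mul (leqnn wC) u2.
rewrite /wB; lia.
Qed.

Lemma pos_wt_spread : (numY a1 b1 + numY a2 b2 = numY a3 b3 + numY a4 b4)%N ->
  (spread a1 b1 + spread a2 b2 + 2 <= spread a3 b3 + spread a4 b4)%N ->
  (pos_wt2 a1 b1 + pos_wt2 a2 b2 < pos_wt2 a3 b3 + pos_wt2 a4 b4)%N.
Proof.
case/andP: h1 h2 => /defect_le v1 /v1 {}v1 /andP[/defect_le v2 /v2 {}v2].
rewrite /pos_wt2 => eqY lt.
have : (wB * (numY a1 b1 + numY a2 b2) = wB * (numY a3 b3 + numY a4 b4))%N.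
  by rewrite eqY.
have := leq_mul (leqnn wC) lt; rewrite /wC; lia.
Qed.

Lemma pos_wt_defect : (numY a1 b1 + numY a2 b2 = numY a3 b3 + numY a4 b4)%N ->
  (spread a1 b1 + spread a2 b2 = spread a3 b3 + spread a4 b4)%N ->
  (defect a1 b1 + defect a2 b2 < defect a3 b3 + defect a4 b4)%N ->
  (pos_wt2 a1 b1 + pos_wt2 a2 b2 < pos_wt2 a3 b3 + pos_wt2 a4 b4)%N.
Proof.
rewrite /pos_wt2 => eqY eqS lt.
have : (wB * (numY a1 b1 + numY a2 b2) = wB * (numY a3 b3 + numY a4 b4))%N.
  by rewrite eqY.
have : (wC * (spread a1 b1 + spread a2 b2) = wC * (spread a3 b3 + spread a4 b4))%N.
  by rewrite eqS.
lia.
Qed.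

End Compare.

Variables (K : fieldType).
Implicit Types p q : {mpoly K[N]}.

Definition quad_below W p : Prop :=
  forall m, m \in msupp p -> mdeg m = 2 /\ (mwt pos_wt m < W)%N.

Lemma quad_belowD W p q : quad_below W p -> quad_below W q -> quad_below W (p + q).
Proof. by move=> hp hq m /msuppD_le; rewrite mem_cat => /orP[/hp|/hq]. Qed.

Lemma quad_belowZ W x p : quad_below W p -> quad_below W (x *: p).
Proof. by move=> hp m /msuppZ_le /hp. Qed.

Lemma quad_belowN W p : quad_below W p -> quad_below W (- p).
Proof. by rewrite -scaleN1r; apply: quad_belowZ. Qed.

Lemma quad_belowB W p q : quad_below W p -> quad_below W q -> quad_below W (p - q).
Proof. by move=> hp hq; apply: quad_belowD => //; apply: quad_belowN. Qed.

Lemma quad_belowXX W k k' : (pos_wt k + pos_wt k' < W)%N -> quad_below W ('X_k * 'X_k').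
Proof.
move=> lt m; rewrite -mpolyXD msuppX inE => /eqP->.
by rewrite mdegD !mdeg1 mwtD !mwtU.
Qed.

(** Linear forms in the letters that involve an X-column.  Having fewer chain
columns, they lower the weight when they replace an arc
([quad_below_x]). *)
Definition x_linear p : Prop :=
  forall m, m \in msupp p -> exists2 k, m = U_(k)%MM & (lo k < s)%N.

Lemma x_linearD p q : x_linear p -> x_linear q -> x_linear (p + q).
Proof. by move=> hp hq m /msuppD_le; rewrite mem_cat => /orP[/hp|/hq]. Qed.

Lemma x_linearZ x p : x_linear p -> x_linear (x *: p).
Proof. by move=> hp m /msuppZ_le /hp. Qed.

Lemma x_linear_sum I (r : seq I) (P : pred I) (F : I -> {mpoly K[N]}) :
  (forall i, P i -> x_linear (F i)) -> x_linear (\sum_(i <- r | P i) F i).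
Proof.
move=> sF; elim/big_rec: _ => [|i p Pi sp]; first by move=> m; rewrite msupp0.
by apply: x_linearD => //; apply: sF.
Qed.

(** The minor of the columns at positions a and b, as a signed letter. *)
Definition bracket a b : {mpoly K[N]} :=
  locked (\sum_(k | (lo k == a) && (hi k == b)) 'X_k
   - \sum_(k | (lo k == b) && (hi k == a)) 'X_k).

Lemma bracketE a b : bracket a b = \sum_(k | (lo k == a) && (hi k == b)) 'X_k
   - \sum_(k | (lo k == b) && (hi k == a)) 'X_k.
Proof. by rewrite /bracket -lock. Qed.

Lemma bracketC a b : bracket a b = - bracket b a.
Proof. by rewrite !bracketE opprB. Qed.

Lemma bracket_letter k : bracket (lo k) (hi k) = 'X_k.
Proof.
rewrite bracketE (big_pred1 k) => [|k' /=].
  rewrite big_pred0 ?subr0 // => k' /=; have := lo_hi k; have := lo_hi k'; lia.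
by apply/andP/eqP => [[/eqP ? /eqP ?]|-> //]; apply: lo_hi_inj.
Qed.

Lemma x_linear_bracket a b : (a < s)%N || (b < s)%N -> x_linear (bracket a b).
Proof.
move=> abs; have H x y : (x < s)%N || (y < s)%N -> forall k, (lo k == x) && (hi k == y) ->
  x_linear 'X_k.
  move=> xy k /andP[/eqP Ex /eqP Ey] m; rewrite msuppX inE => /eqP->; exists k => //.
  have := lo_hi k; lia.
rewrite bracketE; apply: x_linearD; first exact/x_linear_sum/H.
by rewrite -scaleN1r; apply/x_linearZ/x_linear_sum/H; rewrite orbC.
Qed.

Lemma quad_below_x k p k1 k2 :
  (s <= lo k)%N -> (s <= lo k1)%N -> (s <= lo k2)%N -> x_linear p ->
  quad_below (pos_wt k1 + pos_wt k2) (p * 'X_k).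
Proof.
move=> sk sk1 sk2 hp m; rewrite (perm_mem (msuppMX _ _)) => /mapP[m' /hp[k' -> k's] ->].
rewrite mdegD !mdeg1 mwtD !mwtU; split=> //; rewrite addnC.
have := (lo_hi k, lo_hi k1, lo_hi k2, lo_hi k'); have := (hi_lt k, hi_lt k1, hi_lt k2, hi_lt k').
move=> [[[? ?] ?] ?] [[[? ?] ?] ?].
apply: pos_wt_numY; rewrite /numY; lia.
Qed.

Variables (A : comAlgType K) (u v : nat -> A).

Definition minor a b : A := u a * v b - v a * u b.
Definition letter_minor k : A := minor (lo k) (hi k).
Local Notation ev := (ev letter_minor).

Lemma ev_bracket a b : (a < c)%N -> (b < c)%N -> ev (bracket a b) = minor a b.
Proof.
have H a' b' : (a' < b')%N -> (b' < c)%N -> ev (bracket a' b') = minor a' b'.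
  by move=> ab bc; have [k [<- <-]] := letterP ab bc; rewrite bracket_letter evXU.
move=> ac bc; case: (ltngtP a b) => [ab|ba|->]; first exact: H.
  by rewrite bracketC rmorphN /= H // /minor; ring.
by rewrite bracketE subrr rmorph0 /minor mulrC subrr.
Qed.

(** The column (e a, u a.+1) stands to the left of column a.+1 in its block, and
differs from column a by a combination of the X-columns. *)
Variables (e : nat -> A) (lam : nat -> nat -> K).
Hypothesis chain_u : forall a, (s <= a)%N -> (a.+1 < c)%N ->
  e a = u a + \sum_(i < s) lam a i *: u i.
Hypothesis chain_v : forall a, (s <= a)%N -> (a.+1 < c)%N ->
  u a.+1 = v a + \sum_(i < s) lam a i *: v i.
Hypothesis sc : (s <= c)%N.

Definition chain_rest a b : {mpoly K[N]} :=
  \sum_(j < s) lam b j *: bracket a j + \sum_(i < s) lam a i *: bracket i b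
   + \sum_(i < s) \sum_(j < s) (lam a i * lam b j) *: bracket i j.

Lemma x_linear_chain_rest a b : x_linear (chain_rest a b).
Proof.
apply: x_linearD; first apply: x_linearD.
- by apply: x_linear_sum => j _; apply/x_linearZ/x_linear_bracket; rewrite ltn_ord orbT.
- by apply: x_linear_sum => j _; apply/x_linearZ/x_linear_bracket; rewrite ltn_ord.
- apply: x_linear_sum => i _; apply: x_linear_sum => j _.
  by apply/x_linearZ/x_linear_bracket; rewrite ltn_ord.
Qed.

Lemma ev_chain_rest a b : (s <= a)%N -> (s <= b)%N -> (a.+1 < c)%N -> (b.+1 < c)%N ->
  ev (bracket a b + chain_rest a b) = e a * u b.+1 - u a.+1 * e b.
Proof.
move=> sa sb ac bc; have ic (i : 'I_s) : (i < c)%N := leq_trans (ltn_ord i) sc.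
have ac' : (a < c)%N by lia. have bc' : (b < c)%N by lia.
rewrite !rmorphD /= !rmorph_sum /= ev_bracket // (chain_u sa) // (chain_v sa) // (chain_u sb) //.
rewrite (chain_v sb) //.
under eq_bigr => j _ do rewrite evZ ev_bracket // /minor scalerBr scalerAr scalerAr.
under [X in _ + (_ + X + _)]eq_bigr => i _ do rewrite evZ ev_bracket // /minor scalerBr !scalerAl.
under [X in _ + (_ + _ + X)]eq_bigr => i _.
  rewrite rmorph_sum /=; under eq_bigr => j _.
    rewrite evZ ev_bracket // /minor scalerBr -!scalerA.
    rewrite (scalerAr (lam b j)) (scalerAl (lam a i)).
    rewrite (scalerAr (lam b j) (v i)) (scalerAl (lam a i) (v i)).
    over.
  rewrite sumrB -!mulr_sumr; over.
rewrite !sumrB -!mulr_sumr -!mulr_suml /minor; ring.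
Qed.

(** In the first two cases this is the Pluecker relation between the four columns.
In the third case let g.+1 and h.+1 be the positions of the second letter.  The
determinant of the columns (e i, u i.+1, u i.+1, v i.+1) for i = a, b, g, h has
two equal rows.  Its Laplace expansion along the first two rows is a sum of six
products of the minor of the columns to the left of two positions i.+1, by the
minor of the columns at the other two; up to [chain_rest] the former is a
letter, and the other five products are smaller than [a b][g.+1 h.+1]. *)
Lemma straighten_nonstd k k' : nonstd (lo k) (hi k) (lo k') (hi k') ->
  exists2 q, quad_below (pos_wt k + pos_wt k') q & ev q = letter_minor k * letter_minor k'.
Proof.
have [l1 l2] := (lo_hi k, lo_hi k'); have [h1 h2] := (hi_lt k, hi_lt k').
case/or3P => [/and4P[as_ ag gb bh]|/and3P[sa ag hb]|/andP[sa bg]].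
- have [k1 [E1 E1']] := letterP ag (ltn_trans gb h1).
  have [k2 [E2 E2']] := letterP bh h2.
  have [k3 [E3 E3']] := letterP (ltn_trans ag l2) h2.
  have [k4 [E4 E4']] := letterP gb h1.
  exists ('X_k1 * 'X_k2 + 'X_k3 * 'X_k4).
    apply: quad_belowD; apply: quad_belowXX; rewrite /pos_wt ?E1 ?E1' ?E2 ?E2' ?E3 ?E3' ?E4 ?E4'.
      by apply: pos_wt_spread; rewrite ?l1 ?l2 ?ag ?bh /= ?h1 ?h2 ?(ltn_trans gb h1) // /numY /spread; nia.
    apply: pos_wt_defect; rewrite ?l1 ?l2 /= ?h1 ?h2 ?(ltn_trans ag l2) ?gb //.
      by rewrite /numY; lia.
      by rewrite /spread; lia.
    by apply: defect_cross.
  rewrite rmorphD !rmorphM /= !evXU /letter_minor E1 E1' E2 E2' E3 E3' E4 E4' /minor; ring.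
- have [k1 [E1 E1']] := letterP (ltn_trans ag l2) (ltn_trans hb h1).
  have [k2 [E2 E2']] := letterP (ltn_trans l2 hb) h1.
  have [k3 [E3 E3']] := letterP ag (ltn_trans l2 h2).
  have [k4 [E4 E4']] := letterP hb h1.
  exists ('X_k1 * 'X_k2 - 'X_k3 * 'X_k4).
    apply: quad_belowB; apply: quad_belowXX; rewrite /pos_wt ?E1 ?E1' ?E2 ?E2' ?E3 ?E3' ?E4 ?E4'.
      apply: pos_wt_defect; rewrite ?l1 ?l2 /= ?h1 ?h2 ?(ltn_trans ag l2) ?(ltn_trans l2 hb) //.
        by rewrite /numY; lia.
      by rewrite /spread; lia.
      by apply: defect_nest.
    by apply: pos_wt_spread; rewrite ?l1 ?l2 ?ag ?hb /= ?h1 ?h2 ?(ltn_trans l2 h2) // /numY /spread; nia.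
  rewrite rmorphB !rmorphM /= !evXU /letter_minor E1 E1' E2 E2' E3 E3' E4 E4' /minor; ring.
have [g Eg] : exists g, lo k' = g.+1 by exists (lo k').-1; lia.
have [h Eh] : exists h, hi k' = h.+1 by exists (hi k').-1; lia.
set a := lo k in sa l1 *; set b := hi k in bg l1 h1 *.
have [ac bc gc hc] : [/\ (a.+1 < c)%N, (b.+1 < c)%N, (g.+1 < c)%N & (h.+1 < c)%N] by split; lia.
have [sb [sg sh]] : (s <= b)%N /\ (s <= g)%N /\ (s <= h)%N by lia.
have L x y : (s <= x)%N -> (x < y)%N -> (y < c)%N ->
    exists k0, [/\ bracket x y = 'X_k0, lo k0 = x & hi k0 = y].
  by move=> _ xy yc; have [k0 [<- <-]] := letterP xy yc; exists k0; rewrite bracket_letter.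
have W x y x' y' : (s <= x)%N -> (x < y)%N -> (y < c)%N ->
   (s <= x')%N -> (x' < y')%N -> (y' < c)%N ->
   (pos_wt2 x y + pos_wt2 x' y' < pos_wt2 a b + pos_wt2 g.+1 h.+1)%N ->
   quad_below (pos_wt k + pos_wt k') ((bracket x y + chain_rest x y) * bracket x' y').
  move=> sx xy yc sx' xy' yc' lt.
  have [k1 [E1 E1' E1'']] := L x y sx xy yc; have [k2 [-> E2 E2']] := L x' y' sx' xy' yc'.
  rewrite mulrDl; apply: quad_belowD; last first.
    by apply: (quad_below_x _ _ _ (@x_linear_chain_rest _ _)); rewrite -/a ?E2 ?Eg ?sx' //; lia.
  by rewrite E1; apply: quad_belowXX; rewrite /pos_wt E1' E1'' E2 E2' Eg Eh.
have [K1 [EK1 EK1' EK1'']] : exists k0, [/\ bracket g.+1 h.+1 = 'X_k0, lo k0 = g.+1 & hi k0 = h.+1].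
  by apply: L; lia.
exists ((bracket a g + chain_rest a g) * bracket b.+1 h.+1 - (bracket a h + chain_rest a h) * bracket b.+1 g.+1
  - (bracket g h + chain_rest g h) * bracket a.+1 b.+1 + (bracket b h + chain_rest b h) * bracket a.+1 g.+1
  - (bracket b g + chain_rest b g) * bracket a.+1 h.+1 - chain_rest a b * bracket g.+1 h.+1).
  apply: quad_belowB; last first.
    by rewrite EK1; apply: (quad_below_x _ _ _ (@x_linear_chain_rest _ _)); rewrite -/a ?EK1' ?Eg //; lia.
  have [bg' gh] : (b < g)%N /\ (g < h)%N by lia.
  apply: quad_belowB; [apply: quad_belowD; [apply: quad_belowB; [apply: quad_belowB|]|]|]; apply: W; try lia.
  - by apply: pos_wt_defect; try lia; rewrite ?defect_shift // /numY /spread; lia.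
  - by apply: pos_wt_spread; try lia; rewrite /numY /spread; lia.
  - by apply: pos_wt_spread; try lia; rewrite /numY /spread; lia.
  - by apply: pos_wt_spread; try lia; rewrite /numY /spread; lia.
  - by apply: pos_wt_spread; try lia; rewrite /numY /spread; lia.
have E x y x' y' : (s <= x)%N -> (x.+1 < c)%N -> (s <= y)%N -> (y.+1 < c)%N -> (x' < c)%N -> (y' < c)%N ->
    ev ((bracket x y + chain_rest x y) * bracket x' y') = (e x * u y.+1 - u x.+1 * e y) * minor x' y'.
  by move=> ? ? ? ? ? ?; rewrite rmorphM /= ev_chain_rest // ev_bracket.
have E0 : ev (chain_rest a b) = e a * u b.+1 - u a.+1 * e b - minor a b.
  have evD p q : ev (p + q) = ev p + ev q by exact: rmorphD.
  have abr : ev (bracket a b) = minor a b by apply: ev_bracket; lia.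
  by rewrite -ev_chain_rest // evD abr addrC addKr.
rewrite 2!rmorphB rmorphD 2!rmorphB /= !E //; try lia.
rewrite rmorphM /= E0 ev_bracket; try lia.
rewrite /letter_minor -/a -/b Eg Eh /minor; ring.
Qed.

Theorem letter_straightening : straightening letter_minor std_pair pos_wt.
Proof.
move=> k k'; rewrite negb_and !negbK => bd.
have [q lq eq] : exists2 q, quad_below (pos_wt k + pos_wt k') q & ev q = letter_minor k * letter_minor k'.
  by case/orP: bd => /straighten_nonstd // [q]; rewrite addnC mulrC; exists q.
exists q; split=> // [|m /lq[]//]; by apply/dhomogP => m /lq[].
Qed.

End Letters.

(** * The scroll and its letters *)
Section Ev.
Variables (K : fieldType) (N : nat).

Lemma ev_morph (A A' : comAlgType K) (g : {rmorphism A -> A'}) (l : 'I_N -> A) p :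
  (forall a : K, g a%:A = a%:A) -> g (ev l p) = ev (g \o l) p.
Proof.
move=> gA; elim/mpolyind: p => [|a m p _ _ IH]; first by rewrite !rmorph0.
rewrite !rmorphD /= IH; congr (_ + _).
rewrite !evZ -[a *: ev l _]mulr_algl rmorphM /= gA mulr_algl; congr (_ *: _).
rewrite !mpolyXE_id !rmorph_prod; apply: eq_bigr => i _.
by rewrite !rmorphXn /= !evXU.
Qed.

Lemma comp_mpoly_ev n (f : N.-tuple {mpoly K[n]}) p : p \mPo f = ev (tnth f) p.
Proof.
rewrite /comp_mpoly /ev; apply: eq_bigr => m _; congr (_ * _).
by rewrite /= -mul_mpolyC mulr1.
Qed.

Lemma ev_dhomog M (q : 'I_N -> {mpoly K[M]}) k p :
  (forall i, q i \is 1.-homog) -> p \is k.-homog -> ev q p \is k.-homog.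
Proof.
move=> hq hp; rewrite evE big_seq; apply: rpred_sum => m mp; apply: rpredZ.
rewrite -(dhomog_mf hp mp) mpolyXE_id rmorph_prod /= mdegE.
apply: (big_ind2 (fun (q : {mpoly K[M]}) d => q \is d.-homog)) => [|???? |i _].
- exact: dhomog1.
- exact: dhomogM.
rewrite rmorphXn /= evXU -[X in X.-homog]mul1n; exact: dhomogMn.
Qed.

End Ev.

Section Span.
Variables (K : fieldType) (A : comAlgType K) (c : nat) (u v : nat -> A).

Lemma bracket_dhomog a b : bracket c K a b \is 1.-homog.
Proof. by rewrite bracketE rpredB // rpred_sum // => k _; rewrite dhomogX /= mdeg1. Qed.

Definition lcomb (y z : A) : Prop := exists M : 'I_c -> K,
  y = \sum_(i < c) M i *: u i /\ z = \sum_(i < c) M i *: v i.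

Lemma lcomb_col i : (i < c)%N -> lcomb (u i) (v i).
Proof.
move=> ic; exists (fun j => (val j == i)%:R).
by split; rewrite (bigD1 (Ordinal ic)) //= eqxx scale1r big1 ?addr0 // => j /negbTE ne;
  rewrite -val_eqE /= in ne; rewrite ne scale0r.
Qed.

Lemma lcombD y z y' z' : lcomb y z -> lcomb y' z' -> lcomb (y + y') (z + z').
Proof.
case=> [M [-> ->]] [M' [-> ->]]; exists (fun i => M i + M' i).
by rewrite -!big_split; split; apply: eq_bigr => i _; rewrite scalerDl.
Qed.

Lemma lcombZ b y z : lcomb y z -> lcomb (b *: y) (b *: z).
Proof.
case=> [M [-> ->]]; exists (fun i => b * M i).
by rewrite !scaler_sumr; split; apply: eq_bigr => i _; rewrite scalerA.
Qed.

Lemma lcomb_sum I (r : seq I) (F G : I -> A) :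
  (forall i, lcomb (F i) (G i)) -> lcomb (\sum_(i <- r) F i) (\sum_(i <- r) G i).
Proof.
move=> h; elim: r => [|i r IH]; last by rewrite !big_cons; apply: lcombD.
by rewrite !big_nil; exists (fun=> 0); split; rewrite big1 // => i _; rewrite scale0r.
Qed.

(** By bilinearity, the coefficients of the letters being the 2 x 2 minors of the
coefficients of the columns. *)
Lemma minor_span (u' v' : nat -> A) a b :
  lcomb (u' a) (v' a) -> lcomb (u' b) (v' b) ->
  exists2 q, q \is 1.-homog & ev (@letter_minor c K A u v) q = minor u' v' a b.
Proof.
case=> [M1 [Eu1 Ev1]] [M2 [Eu2 Ev2]].
exists (\sum_(i < c) \sum_(j < c) (M1 i * M2 j) *: bracket c K i j).
  by rewrite rpred_sum // => i _; rewrite rpred_sum // => j _; rewrite rpredZ ?bracket_dhomog.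
rewrite /minor Eu1 Ev1 Eu2 Ev2 !mulr_suml -sumrB rmorph_sum; apply: eq_bigr => i _ /=.
rewrite !mulr_sumr -sumrB rmorph_sum; apply: eq_bigr => j _ /=.
by rewrite evZ ev_bracket ?ltn_ord // /minor scalerBr -!scalerAl -!scalerAr !scalerA.
Qed.

End Span.

Section Columns.
Variables (K : fieldType) (A : comAlgType K) (s : nat) (block_size : nat -> nat).
Hypothesis block_size_gt0 : forall k, (0 < block_size k)%N.
Variable x : nat -> nat -> A.

(** The number of pairs of neighbouring columns in the blocks before block k. *)
Definition chain_off k : nat := \sum_(l < k) (block_size l).-1.
Local Notation c := (\sum_(l < s.+1) block_size l)%N.

Lemma chain_offS k : chain_off k.+1 = (chain_off k + (block_size k).-1)%N.
Proof. exact: big_ord_recr. Qed.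

Lemma chain_off_mono k k' : (k <= k')%N -> (chain_off k <= chain_off k')%N.
Proof.
by move/subnKC <-; elim: (k' - k)%N => [|j IH]; rewrite ?addn0 // addnS chain_offS; lia.
Qed.

Lemma chain_off_last : (chain_off s.+1 + s.+1 = c)%N.
Proof.
rewrite /chain_off -[in X in (_ + X)%N](card_ord s.+1) -sum1_card -big_split /=.
by apply: eq_bigr => i _; rewrite addn1 prednK.
Qed.

(** The P-th pair of neighbouring columns, in the order of the blocks, consists of
columns number [chain_pos P] and [(chain_pos P).+1] of block
[chain_block P]. *)
Definition chain_block P : nat := find (fun k => P < chain_off k.+1)%N (iota 0 s.+1).
Definition chain_pos P : nat := (P - chain_off (chain_block P))%N.

Lemma chain_block_le P : (chain_block P <= s.+1)%N.
Proof. by rewrite -[X in (_ <= X)%N](size_iota 0) find_size. Qed.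

Lemma chain_block_before P k : (k < chain_block P)%N -> (chain_off k.+1 <= P)%N.
Proof.
move=> h; have := before_find 0%N h; rewrite nth_iota; last by have := chain_block_le P; lia.
by rewrite add0n; lia.
Qed.

Lemma chain_blockP P : (P < chain_off s.+1)%N -> [/\ (chain_block P <= s)%N, (chain_off (chain_block P) <= P)%N
  & (P < chain_off (chain_block P).+1)%N].
Proof.
move=> h; have hs : has (fun k => P < chain_off k.+1)%N (iota 0 s.+1).
  by apply/hasP; exists s; rewrite ?mem_iota //= add0n ltnSn.
have := hs; rewrite has_find size_iota ltnS => ks; split=> //.
  by have := @chain_block_before P (chain_block P).-1; case: (chain_block P) => [|k]; rewrite ?ltnSn /chain_off ?big_ord0 //; apply.
by have := nth_find 0%N hs; rewrite nth_iota ?add0n.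
Qed.

Lemma chain_block_uniq P k : (k <= s)%N -> (chain_off k <= P)%N -> (P < chain_off k.+1)%N -> chain_block P = k.
Proof.
move=> ks h1 h2; have [k1 k2 k3] : [/\ (chain_block P <= s)%N, (chain_off (chain_block P) <= P)%N
  & (P < chain_off (chain_block P).+1)%N] by apply: chain_blockP; apply: (leq_trans h2); apply: chain_off_mono.
case: (ltngtP (chain_block P) k) => // h.
  by have := chain_off_mono h; lia.
by have := chain_block_before h; lia.
Qed.

(** The two entries, for r = 0 and r = 1, of X_p for p < s, of the first column of
all, which begins the chain, for p = s, and of the right column of the pair
number P for p = s + P + 1. *)
Definition basis_col r p : A :=
  if (p < s)%N then x p.+1 r - x p ((block_size p).-1 + r)
  else if p == s then x 0 r
  else x (chain_block (p - s).-1) ((chain_pos (p - s).-1).+1 + r).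

Definition chain_col r p : A := x (chain_block (p - s)) (chain_pos (p - s) + r).

Definition chain_coef p i : K :=
  ((chain_pos (p - s) == 0) && (i < chain_block (p - s)) && (chain_off i.+1 == p - s)%N)%N%:R.

Lemma basis_colS k j r : (k <= s)%N -> (j.+1 < block_size k)%N -> basis_col r (s + (chain_off k + j).+1) = x k (j.+1 + r).
Proof.
move=> ks jn; rewrite /basis_col ifN ?ifN; [|lia|lia].
have -> : (s + (chain_off k + j).+1 - s).-1 = (chain_off k + j)%N by lia.
have kE : chain_block (chain_off k + j) = k by apply: chain_block_uniq; rewrite ?chain_offS //; lia.
by rewrite /chain_pos kE addKn.
Qed.

(** The first column of block k+1 is X_k plus the last column of block k.  The
latter is the chain column at the same position if block k has several columns;
if it has only one, it is the first column of block k, and induction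
applies. *)
Lemma basis_col_first k r : (k <= s)%N -> x k r = basis_col r (s + chain_off k) +
  \sum_(i < s) ((i < k) && (chain_off i.+1 == chain_off k))%N%:R *: basis_col r i.
Proof.
elim: k => [|k IH] ks.
  by rewrite big1 => [|i _]; rewrite ?scale0r // /chain_off big_ord0 addn0 addr0 /basis_col ltnn eqxx.
have -> : x k.+1 r = basis_col r k + x k ((block_size k).-1 + r) by rewrite /basis_col ks subrK.
case: (ltnP 1 (block_size k)) => n1.
  have E : x k ((block_size k).-1 + r) = basis_col r (s + chain_off k.+1).
    have -> : chain_off k.+1 = (chain_off k + (block_size k).-2).+1 by rewrite chain_offS; lia.
    by rewrite basis_colS ?prednK //; lia.
  rewrite E addrC; congr (_ + _).
  rewrite (bigD1 (Ordinal ks)) //= ltnSn eqxx scale1r big1 ?addr0 // => i /eqP ne.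
  case: eqP => [e|]; rewrite ?andbF ?scale0r //; case: ltnP => [ik|]; rewrite ?scale0r //.
  have {}ik : (i < k)%N.
    by rewrite ltn_neqAle -ltnS ik andbT; apply/eqP => eik; apply: ne; apply: val_inj.
  by have := chain_off_mono ik; move: e; rewrite (chain_offS k); lia.
have n1' : block_size k = 1%N by have := block_size_gt0 k; lia.
have oE : chain_off k.+1 = chain_off k by rewrite chain_offS n1' addn0.
rewrite n1' add0n IH 1?ltnW // oE addrCA; congr (_ + _).
rewrite [in RHS](bigD1 (Ordinal ks)) //= ltnSn oE eqxx scale1r; congr (_ + _).
rewrite (bigD1 (Ordinal ks)) //= ltnn scale0r add0r; apply: eq_bigr => i /eqP ne.
rewrite ltnS [(i <= k)%N]leq_eqVlt; case: (eqVneq (i : nat) k) => [e|//].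
by case: ne; apply: val_inj.
Qed.

Lemma chain_colE r p : (s <= p)%N -> (p.+1 < c)%N ->
  chain_col r p = basis_col r p + \sum_(i < s) chain_coef p i *: basis_col r i.
Proof.
move=> sp pc; have [ks h1 h2] : [/\ (chain_block (p - s) <= s)%N, (chain_off (chain_block (p - s)) <= p - s)%N
  & (p - s < chain_off (chain_block (p - s)).+1)%N] by apply: chain_blockP; have := chain_off_last; lia.
rewrite /chain_col /chain_coef; case: (posnP (chain_pos (p - s))) => [i0|ip].
  have E : (p - s)%N = chain_off (chain_block (p - s)) by move: i0; rewrite /chain_pos; lia.
  rewrite i0 add0n (basis_col_first _ ks) -E subnKC //; congr (_ + _).
rewrite big1 ?addr0 => [|i _]; last first.
  by rewrite scale0r.
have -> : p = (s + (chain_off (chain_block (p - s)) + (chain_pos (p - s)).-1).+1)%N by rewrite /chain_pos; move: ip; rewrite /chain_pos; lia.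
set P := (p - s)%N in ks h1 h2 ip *.
have -> : (s + (chain_off (chain_block P) + (chain_pos P).-1).+1 - s)%N = P by rewrite /chain_pos /P; move: ip; rewrite /chain_pos /P; lia.
rewrite basis_colS ?prednK //; move: h2; rewrite chain_offS /chain_pos; lia.
Qed.

Lemma chain_col1 p : (s <= p)%N -> chain_col 1 p = basis_col 0 p.+1.
Proof.
move=> sp; rewrite /basis_col ifN ?ifN /chain_col; [|lia|lia].
by rewrite subSn // addn0 addn1.
Qed.

End Columns.

Section Scroll.
Variables (K : fieldType) (s : nat) (n : 'I_s.+1 -> nat).
Hypothesis n_gt0 : forall i, (0 < n i)%N.
Local Notation c := (\sum_i n i)%N.
Local Notation R := (scroll_ring K n).
Local Notation N := #|column_pair n|.

Definition block_size k : nat := n (inord k).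
Definition scroll_x k j : R := scroll_var K (inord j : 'I_(n (inord k)).+1).
Definition matrix_col r t : R := if insub t is Some t' then scroll_mx K n r t' else 0.

Lemma block_size_gt0 k : (0 < block_size k)%N.
Proof. exact: n_gt0. Qed.

Lemma sum_block_size : (\sum_(l < s.+1) block_size l)%N = c.
Proof. by apply: eq_bigr => i _; rewrite /block_size inord_val. Qed.

Lemma matrix_colE r (t : 'I_c) : matrix_col r t = scroll_x (tagnat.sig1 t) (tagnat.sig2 t + r).
Proof. by rewrite /matrix_col valK /scroll_mx mxE mxE /scroll_x inord_val. Qed.

Lemma matrix_col_ex k j : (k <= s)%N -> (j < block_size k)%N ->
  exists t : 'I_c, forall r, matrix_col r t = scroll_x k (j + r).
Proof.
move=> ks jn; exists (tagnat.rank (Tagged (fun i => 'I_(n i)) (Ordinal jn))) => r.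
by rewrite matrix_colE /tagnat.sig2 /tagnat.sig1 tagnat.rankK /= inordK.
Qed.

Lemma scroll_minorE (k : 'I_N) :
  scroll_minor K (enum_val k) = @letter_minor c K R (matrix_col 0) (matrix_col 1) k.
Proof.
rewrite /scroll_minor (expand_det_row _ ord0) big_ord_recl big_ord1 /cofactor !det_mx11.
rewrite !mxE /letter_minor /minor /lo /hi /matrix_col !valK /=.
rewrite /scroll_mx !mxE.
rewrite expr0 mul1r expr1 mulN1r mulrN; rewrite (_ : bump 0 0 = 1%N) //; congr (_ - _).
by rewrite mulrC.
Qed.

Local Notation basis_col := (basis_col s block_size scroll_x).
Local Notation lR := (@letter_minor c K R (basis_col 0) (basis_col 1)).

Lemma matrix_col_lcomb (t : 'I_c) : @lcomb K R c (basis_col 0) (basis_col 1) (matrix_col 0 t) (matrix_col 1 t).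
Proof.
have cE := chain_off_last s block_size_gt0; rewrite sum_block_size in cE.
rewrite !matrix_colE; move: (tagnat.sig1 t) (tagnat.sig2 t) => k j.
have ks : (k <= s)%N by rewrite -ltnS ltn_ord.
have jn : (j < block_size k)%N by rewrite /block_size inord_val.
have o1 : (chain_off block_size k.+1 <= chain_off block_size s.+1)%N by apply: chain_off_mono.
have o2 := chain_offS block_size k; have n0 := block_size_gt0 k.
case: j jn => -[|j] /= _ jn; last first.
  by rewrite -!(basis_colS (K := K) scroll_x _ ks jn); apply: lcomb_col; rewrite -cE; lia.
rewrite !(basis_col_first (K := K) block_size_gt0 scroll_x _ ks); apply: lcombD; first by apply: lcomb_col; rewrite -cE; lia.
by apply: lcomb_sum => i; apply/lcombZ/lcomb_col; have := ltn_ord i; rewrite -cE; lia.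
Qed.

Lemma basis_col_lcomb p : (p < c)%N -> @lcomb K R c (matrix_col 0) (matrix_col 1) (basis_col 0 p) (basis_col 1 p).
Proof.
have cE := chain_off_last s block_size_gt0; rewrite sum_block_size in cE => pc; rewrite -cE in pc.
have L k j : (k <= s)%N -> (j < block_size k)%N ->
    @lcomb K R c (matrix_col 0) (matrix_col 1) (scroll_x k (j + 0)) (scroll_x k (j + 1)).
  move=> ks jn; have [t tE] := matrix_col_ex ks jn.
  have <- : matrix_col 0 t = scroll_x k (j + 0) := tE 0.
  have <- : matrix_col 1 t = scroll_x k (j + 1) := tE 1.
  by apply: lcomb_col.
rewrite /basis_col; case: ifP => [ps|ps].
  rewrite -[- _ in X in @lcomb _ _ _ _ _ X _]scaleN1r -[- _ in X in @lcomb _ _ _ _ _ _ X]scaleN1r.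
  apply: lcombD; first by apply: (L _ 0%N); rewrite ?block_size_gt0.
  by apply: lcombZ; apply: L; rewrite ?prednK ?block_size_gt0 // ltnW.
case: ifP => [_|/negbT ps']; first by apply: (L 0%N 0%N); rewrite ?block_size_gt0.
have [ks h1 h2] : [/\ (chain_block s block_size (p - s).-1 <= s)%N, (chain_off block_size (chain_block s block_size (p - s).-1) <= (p - s).-1)%N
  & ((p - s).-1 < chain_off block_size (chain_block s block_size (p - s).-1).+1)%N] by apply: chain_blockP; lia.
by apply: L => //; move: h2; rewrite /chain_pos chain_offS; lia.
Qed.

Local Notation f := (scroll_minors K n).
Local Notation A := (gen_alg f).

Lemma ev_subst (l1 l2 : 'I_N -> R) (q : 'I_N -> {mpoly K[N]}) p :
  (forall k, ev l1 (q k) = l2 k) -> ev l1 (ev q p) = ev l2 p.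
Proof.
move=> h; rewrite (@ev_morph K N {mpoly K[N]} R (ev l1) q p); last first.
  by move=> b; apply: etrans (evZ l1 b 1) _; rewrite rmorph1.
by congr (ev _ p); apply: funext => k /=; apply: h.
Qed.

Lemma minors_of_letters : exists2 q : 'I_N -> {mpoly K[N]},
  forall k, q k \is 1.-homog & forall p, p \mPo f = ev lR (ev q p).
Proof.
have H k : exists q, q \is 1.-homog /\ ev lR q = tnth f k.
  have [q h1 h2] := @minor_span K R c (basis_col 0) (basis_col 1) (matrix_col 0) (matrix_col 1) (lo k) (hi k)
     (matrix_col_lcomb _) (matrix_col_lcomb _).
  by exists q; rewrite h2 tnth_mktuple scroll_minorE.
exists (fun k => sval (cid (H k))) => [k|p]; first by case: cid => ? [].
by rewrite comp_mpoly_ev; apply/esym/ev_subst => k; case: cid => ? [].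
Qed.

Lemma letters_of_minors : exists2 q : 'I_N -> {mpoly K[N]},
  forall k, q k \is 1.-homog & forall p, ev lR p = ev q p \mPo f.
Proof.
have H k : exists q, q \is 1.-homog /\ ev (tnth f) q = lR k.
  have lc : (lo k < c)%N := ltn_trans (lo_hi k) (hi_lt k).
  have [q h1 h2] := @minor_span K R c (matrix_col 0) (matrix_col 1) (basis_col 0) (basis_col 1) (lo k) (hi k)
     (basis_col_lcomb lc) (basis_col_lcomb (hi_lt k)).
  exists q; split=> //; rewrite -[lR k]/(minor (basis_col 0) (basis_col 1) (lo k) (hi k)) -h2.
  by congr (ev _ q); apply: funext => k'; rewrite tnth_mktuple scroll_minorE.
exists (fun k => sval (cid (H k))) => [k|p]; first by case: cid => ? [].
by rewrite comp_mpoly_ev; apply/esym/ev_subst => k; case: cid => ? [].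
Qed.

Lemma letter_in k : lR k \in gen_pred f.
Proof.
have [q _ Eq] := letters_of_minors; apply/asboolP.
by exists (ev q 'X_k); rewrite -Eq evXU.
Qed.

Definition scroll_letter k : A := GenAlg (letter_in k).
Local Notation l := scroll_letter.

Lemma val_ev p : val (ev l p) = ev lR p.
Proof.
apply: (@ev_morph K N A R (val : A -> R) l p) => a.
exact: (linearZ_LR (val : {linear A -> R}) a 1).
Qed.

(** Letters and minors are linear combinations of each other. *)
Lemma gen_piece_letters k a :
  gen_piece f k a <-> exists2 p, p \is k.-homog & ev l p = a.
Proof.
split=> [[p hp Ea]|[p hp <-]].
  have [q hq Eq] := minors_of_letters; exists (ev q p); first exact: ev_dhomog.
  by apply: val_inj; rewrite /= val_ev Ea Eq.
have [q hq Eq] := letters_of_minors; exists (ev q p); first exact: ev_dhomog.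
by rewrite val_ev Eq.
Qed.

Lemma scroll_ev_surj a : exists p, ev l p = a.
Proof.
have /asboolP[p Ea] := valP a; have [q _ Eq] := minors_of_letters.
by exists (ev q p); apply: val_inj; rewrite /= val_ev -Eq Ea.
Qed.

Lemma basis_col_coef0 r p : (basis_col r p)@_0%MM = 0.
Proof.
have h k j : (scroll_x k j)@_0%MM = 0 by rewrite mcoeffX mnm1_eq0.
by rewrite /basis_col; case: ifP => _; [rewrite mcoeffB !h subrr|case: ifP => _; exact: h].
Qed.

Lemma scroll_eps_ev p : gen_eps f (ev l p) = p@_0%MM.
Proof.
rewrite /gen_eps /= -/(val (ev l p)) val_ev evE raddf_sum /= [in RHS](mpolyE p) raddf_sum /=.
apply: eq_bigr => m _; rewrite !mcoeffZ mcoeffX; congr (_ * _).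
have [->|ne] := eqVneq m 0%MM; first by rewrite mpolyX0 rmorph1 mcoeff1 eqxx.
have [i mi] : exists i, m i != 0%N.
  apply/existsP; apply: contraNT ne; rewrite negb_exists => /forallP h.
  by apply/eqP/mnmP => i; rewrite mnm0E; have := h i; rewrite negbK => /eqP.
rewrite (mnm_rem1 mi) mpolyXD rmorphM /= evXU rmorphM /= /letter_minor /minor.
by rewrite rmorphB !rmorphM /= !basis_col_coef0 !mul0r subrr mulr0.
Qed.

Lemma scroll_straightening : straightening l (@std_pair c s) (@pos_wt c s).
Proof.
have sc : (s <= c)%N.
  by have := chain_off_last s block_size_gt0; rewrite sum_block_size; lia.
have H := @letter_straightening c s K R (basis_col 0) (basis_col 1) (chain_col s block_size scroll_x 0) (chain_coef K s block_size).
move=> k k' /H[||//|q [q2 Eq wq]].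
- by move=> a sa ac; apply: chain_colE; rewrite ?sum_block_size //; apply: block_size_gt0.
- move=> a sa ac; rewrite -chain_col1 //.
  by apply: chain_colE; rewrite ?sum_block_size //; apply: block_size_gt0.
by exists q; split=> //; apply: val_inj; rewrite val_ev Eq rmorphM.
Qed.

End Scroll.

(** * Leading forms *)
Section LeadingForms.
Variables (K : fieldType) (M : nat) (u : 'I_M -> nat).
Local Notation D := {mpoly K[M]}.
Implicit Types f g : D.

(** The substitution of X_i t^(u i) for X_i. *)
Lemma spread_ex : exists h : {rmorphism D -> {poly D}},
  (forall i, h 'X_i = 'X_i *: 'X^(u i)) /\ (forall a, h a%:MP = a%:MP%:P).
Proof.
exists (mmap (polyC \o @mpolyC M K) (fun i => 'X_i *: 'X^(u i))).
by split=> [i|a] /=; rewrite ?mmapX ?mmap1U ?mmapC.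
Qed.

Definition spread_wt : {rmorphism D -> {poly D}} := sval (cid spread_ex).

Lemma spread_wtX i : spread_wt 'X_i = 'X_i *: 'X^(u i).
Proof. by rewrite /spread_wt; case: cid => ? []. Qed.

Lemma spread_wtC a : spread_wt a%:MP = a%:MP%:P.
Proof. by rewrite /spread_wt; case: cid => ? []. Qed.

(** All monomials of f have weight at most w, and f' is the part of weight w,
which may be 0. *)
Definition leading w f f' : Prop :=
  (forall k, (w < k)%N -> (spread_wt f)`_k = 0) /\ (spread_wt f)`_w = f'.

Lemma leading_eq w w' f f' : leading w f f' -> w = w' -> leading w' f f'.
Proof. by move=> h <-. Qed.

Lemma leadingX i : leading (u i) 'X_i 'X_i.
Proof.
rewrite /leading spread_wtX; split=> [k lt|]; rewrite coefZ coefXn.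
  by rewrite gtn_eqF // mulr0.
by rewrite eqxx mulr1.
Qed.

Lemma leadingD w f f' g g' : leading w f f' -> leading w g g' -> leading w (f + g) (f' + g').
Proof.
rewrite /leading rmorphD /=; case=> [h1 <-] [h2 <-]; split=> [k lt|]; last by rewrite coefD.
by rewrite coefD (h1 _ lt) (h2 _ lt) addr0.
Qed.

Lemma leadingN w f f' : leading w f f' -> leading w (- f) (- f').
Proof.
rewrite /leading rmorphN /=; case=> [h <-]; split=> [k lt|]; last by rewrite coefN.
by rewrite coefN (h _ lt) oppr0.
Qed.

Lemma leadingB w f f' g g' : leading w f f' -> leading w g g' -> leading w (f - g) (f' - g').
Proof. by move=> h1 h2; apply: leadingD => //; apply: leadingN. Qed.

Lemma leadingM w f f' w' g g' : leading w f f' -> leading w' g g' -> leading (w + w') (f * g) (f' * g').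
Proof.
rewrite /leading rmorphM /=; case=> [h1 <-] [h2 <-]; split=> [k lt|]; rewrite coefM.
  apply: big1 => i _; case: (ltnP w i) => wi; first by rewrite h1 ?mul0r.
  by rewrite h2 ?mulr0 //; lia.
have lt : (w < (w + w').+1)%N by lia.
rewrite (bigD1 (Ordinal lt)) //= addKn big1 ?addr0 // => i /eqP ne.
case: (ltnP w i) => wi; first by rewrite h1 ?mul0r.
rewrite h2 ?mulr0 //; have : (i : nat) <> w by move=> e; apply: ne; apply: val_inj.
by lia.
Qed.

Lemma leading0 w : leading w 0 0.
Proof. by rewrite /leading rmorph0; split=> *; rewrite coef0. Qed.

Lemma leading1 : leading 0 1 1.
Proof. by rewrite /leading rmorph1; split=> [[|k] // _|]; rewrite coef1. Qed.

Lemma leading_exp w f f' k : leading w f f' -> leading (k * w) (f ^+ k) (f' ^+ k).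
Proof.
move=> h; elim: k => [|k IH]; first exact: leading1.
by rewrite !exprS mulSn; apply: leadingM.
Qed.

Lemma leadingZ w f f' (a : K) : leading w f f' -> leading w (a *: f) (a *: f').
Proof.
move=> h; rewrite -!mul_mpolyC -[w]add0n; apply: leadingM => //.
by rewrite /leading spread_wtC; split=> [[|k] // _|]; rewrite coefC.
Qed.

Lemma leading_lt w w' f f' : (w < w')%N -> leading w f f' -> leading w' f 0.
Proof. by move=> lt [h _]; split=> [k lt'|]; rewrite h //; lia. Qed.

Lemma leading_sum w (I : eqType) (r : seq I) (F F' : I -> D) :
  (forall i, i \in r -> leading w (F i) (F' i)) ->
  leading w (\sum_(i <- r) F i) (\sum_(i <- r) F' i).
Proof.
move=> h; rewrite !big_seq; apply: (big_ind2 (fun f f' => leading w f f')) => //.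
- exact: leading0.
- by move=> *; apply: leadingD.
Qed.

(** Substitute X_i t^(u i) for X_i in the relation ev L p = 0: the coefficient of
the highest power of t is the part of p of highest weight, evaluated at the
leading forms. *)
Lemma leading_relation N (L L' : 'I_N -> D) (w : 'I_N -> nat) (p : {mpoly K[N]}) :
  p != 0 -> ev L p = 0 ->
  (forall m k, m \in msupp p -> m k != 0%N -> leading (w k) (L k) (L' k)) ->
  exists p', [/\ p' != 0, ev L' p' = 0, {subset msupp p' <= msupp p} &
    exists W, (forall m, m \in msupp p' -> mwt w m = W) /\
              (forall m, m \in msupp p -> (mwt w m <= W)%N)].
Proof.
move=> p0 ep tL.
pose W := \max_(m <- msupp p) mwt w m.
have maxW m : m \in msupp p -> (mwt w m <= W)%N by move=> mp; apply: leq_bigmax_seq.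
have [m0 m0p m0W] : exists2 m, m \in msupp p & mwt w m = W.
  have: ~~ nilp (msupp p) by rewrite /nilp size_eq0 msupp_eq0.
  rewrite /W; elim: (msupp p) => //= m r IH _; rewrite big_cons.
  case: (altP (@nilP _ r)) => [->|/IH[m' m'r <-]].
    by exists m; rewrite ?inE ?eqxx // big_nil maxn0.
  case: (leqP (mwt w m) (mwt w m')) => _; first by exists m'; rewrite ?inE ?m'r ?orbT.
  by exists m; rewrite ?inE ?eqxx.
have topm m : m \in msupp p -> leading (mwt w m) (ev L 'X_[m]) (ev L' 'X_[m]).
  move=> mp; rewrite !mpolyXE_id !rmorph_prod /= /mwt.
  elim: (index_enum _) => [|k r IH]; first by rewrite !big_nil; exact: leading1.
  rewrite !big_cons; apply: leadingM => //; rewrite !rmorphXn /= !evXU.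
  have [->|mk] := eqVneq (m k) 0%N; first exact: leading1.
  by apply: leading_exp; apply: tL mp mk.
pose p' : {mpoly K[N]} := \sum_(m <- msupp p | mwt w m == W) p@_m *: 'X_[m].
have p'E m : p'@_m = if mwt w m == W then p@_m else 0.
  rewrite /p' raddf_sum /= big_mkcond /=.
  have [mp|mp] := boolP (m \in msupp p).
    rewrite (bigD1_seq m) ?msupp_uniq //= big1 => [|m' ne].
      by rewrite addr0; case: ifP => _ //; rewrite mcoeffZ mcoeffX eqxx mulr1.
    by case: ifP => // _; rewrite mcoeffZ mcoeffX (negbTE ne) mulr0.
  rewrite big_seq big1 => [|m' m'p]; first by rewrite (memN_msupp_eq0 mp) if_same.
  have ne : m' != m by apply: contraNneq mp => <-.
  by case: ifP => // _; rewrite mcoeffZ mcoeffX (negbTE ne) mulr0.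
exists p'; split.
- apply: contraTneq m0p => p'0; move: (p'E m0); rewrite p'0 mcoeff0 m0W eqxx => /esym/eqP.
  by rewrite mcoeff_eq0.
- have [_ <-] : leading W (ev L p) (ev L' p').
    rewrite (evE L p) /p' (big_mkcond (fun m => mwt w m == W)) (rmorph_sum (ev L')) /=; apply: leading_sum => m mp.
    case: eqP => [Em|/eqP ne]; first by rewrite evZ; apply: leadingZ; rewrite -Em; apply: topm.
    rewrite rmorph0; apply: (@leading_lt (mwt w m)); first by rewrite ltn_neqAle ne maxW.
    exact/leadingZ/topm.
  by rewrite ep rmorph0 coef0.
- move=> m; rewrite !mcoeff_msupp p'E; case: ifP => //; by rewrite eqxx.
- exists W; split=> // m; rewrite mcoeff_msupp p'E; case: ifP => [/eqP//|]; by rewrite eqxx.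
Qed.

End LeadingForms.

(** * Standard monomials are determined by their end points *)
Section Weights.
Variable (N : nat).
Implicit Types (m : 'X_{1..N}) (w : 'I_N -> nat).

Lemma mwt_gt0P w m : reflect (exists2 k, m k != 0%N & w k != 0%N) (mwt w m != 0%N).
Proof.
rewrite /mwt sum_nat_eq0 negb_forall; apply: (iffP existsP) => [[k]|[k mk wk]].
  by rewrite /= muln_eq0 negb_or => /andP[]; exists k.
by exists k; rewrite /= muln_eq0 negb_or mk.
Qed.

Lemma eq_mwt w w' m : (forall k, m k != 0%N -> w k = w' k) -> mwt w m = mwt w' m.
Proof.
move=> e; apply: eq_bigr => k _; by have [->|/e->] := eqVneq (m k) 0%N.
Qed.

Lemma mwt_add w w' m : mwt (fun k => w k + w' k)%N m = (mwt w m + mwt w' m)%N.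
Proof. by rewrite /mwt -big_split; apply: eq_bigr => k _; rewrite /= mulnDr. Qed.

Lemma mwt_sum I (r : seq I) (F : I -> 'I_N -> nat) m :
  mwt (fun k => \sum_(i <- r) F i k)%N m = (\sum_(i <- r) mwt (F i) m)%N.
Proof.
rewrite /mwt exchange_big /=; apply: eq_bigr => k _; rewrite big_distrr //.
Qed.

End Weights.

Section Uniqueness.
Variables (c s : nat).
Local Notation N := #|letter c|.
Implicit Types (k : 'I_N) (m : 'X_{1..N}).

Definition deg_lo i := mwt (fun k : 'I_N => (lo k == i) : nat).
Definition deg_hi i := mwt (fun k : 'I_N => (hi k == i) : nat).

Lemma deg_loP i m : reflect (exists2 k, m k != 0%N & lo k = i) (deg_lo i m != 0%N).
Proof.
apply: (iffP (mwt_gt0P _ _)) => [[k mk]|[k mk <-]]; last by exists k; rewrite ?eqxx.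
by rewrite /= eqb0 negbK => /eqP e; exists k.
Qed.

Lemma deg_hiP i m : reflect (exists2 k, m k != 0%N & hi k = i) (deg_hi i m != 0%N).
Proof.
apply: (iffP (mwt_gt0P _ _)) => [[k mk]|[k mk <-]]; last by exists k; rewrite ?eqxx.
by rewrite /= eqb0 negbK => /eqP e; exists k.
Qed.

Lemma mstd_nonstd m k k' : mstd (@std_pair c s) m -> m k != 0%N -> m k' != 0%N ->
  ~~ nonstd s (lo k) (hi k) (lo k') (hi k').
Proof. by move=> /mstdP h mk mk'; have /andP[] := h k k' mk mk'. Qed.

(** Let g be the first position where an arc of m begins, and j the first position
after g where a letter ends.  An arc [g h] with h > j and a letter [i j] with
i <> g would be strictly nested, or cross with an X-column as the beginning. *)
Lemma arc_letter m g j : mstd (@std_pair c s) m -> (s <= g)%N -> (g < j)%N ->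
  deg_lo g m != 0%N -> (forall i, (s <= i)%N -> deg_lo i m != 0%N -> (g <= i)%N) ->
  deg_hi j m != 0%N -> (forall i, (g < i)%N -> deg_hi i m != 0%N -> (j <= i)%N) ->
  exists k, [/\ m k != 0%N, lo k = g & hi k = j].
Proof.
move=> sm sg gj /deg_loP[k1 mk1 E1] ming /deg_hiP[k2 mk2 E2] minj.
have l1 := lo_hi k1; have l2 := lo_hi k2.
have le1 : (j <= hi k1)%N by apply: minj; rewrite -?E1 //; apply/deg_hiP; exists k1.
have [e|ne] := eqVneq (hi k1) j; first by exists k1.
have [e|ne2] := eqVneq (lo k2) g; first by exists k2.
have b1 := mstd_nonstd sm mk1 mk2; have b2 := mstd_nonstd sm mk2 mk1.
exfalso; move: b1 b2; rewrite /nonstd; have [s2|s2] := leqP s (lo k2); last by lia.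
have := ming _ s2; rewrite (introT (deg_loP _ _)); last by exists k2.
by move=> /(_ isT); lia.
Qed.

(** If all letters begin with an X-column, let j be the first position where a
letter ends, and i the last one before j where a letter begins.  Then letters
[i h] with h > j and [i' j] with i' < i would cross. *)
Lemma cross_letter m i j : mstd (@std_pair c s) m -> (i < j)%N ->
  (forall l, deg_lo l m != 0%N -> (l < s)%N) ->
  deg_hi j m != 0%N -> (forall l, deg_hi l m != 0%N -> (j <= l)%N) ->
  deg_lo i m != 0%N -> (forall l, (l < j)%N -> deg_lo l m != 0%N -> (l <= i)%N) ->
  exists k, [/\ m k != 0%N, lo k = i & hi k = j].
Proof.
move=> sm ij los /deg_hiP[k1 mk1 E1] minj /deg_loP[k2 mk2 E2] maxi.
have l1 := lo_hi k1; have l2 := lo_hi k2.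
have le1 : (lo k1 <= i)%N by apply: maxi; rewrite -?E1 //; apply/deg_loP; exists k1.
have le2 : (j <= hi k2)%N by apply: minj; apply/deg_hiP; exists k2.
have [e|ne] := eqVneq (hi k2) j; first by exists k2.
have [e|ne2] := eqVneq (lo k1) i; first by exists k1.
have b1 := mstd_nonstd sm mk1 mk2; exfalso.
have := los (lo k1); rewrite (introT (deg_loP _ _)); last by exists k1.
by move=> /(_ isT); move: b1; rewrite /nonstd; lia.
Qed.

Lemma common_letter m m' : mstd (@std_pair c s) m -> mstd (@std_pair c s) m' ->
  (forall i, deg_lo i m = deg_lo i m') -> (forall i, deg_hi i m = deg_hi i m') ->
  m != 0%MM -> exists2 k, m k != 0%N & m' k != 0%N.
Proof.
move=> sm sm' elo ehi m0.
have [k mk] : exists k, m k != 0%N.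
  apply/existsP; apply: contraNT m0; rewrite negb_exists => /forallP h.
  by apply/eqP/mnmP => i; rewrite mnm0E; have := h i; rewrite negbK => /eqP.
suff [i [j [[k1 [mk1 l1 h1]] [k2 [mk2 l2 h2]]]]] : exists i j,
    (exists k, [/\ m k != 0%N, lo k = i & hi k = j]) /\
    (exists k, [/\ m' k != 0%N, lo k = i & hi k = j]).
  by exists k1 => //; rewrite (@lo_hi_inj c k1 k2) ?l1 ?h1.
have [[g0 /andP[sg0 g0m]]|none] := pselect (exists g, (s <= g)%N && (deg_lo g m != 0%N)).
  have exg : exists g, (s <= g)%N && (deg_lo g m != 0%N) by exists g0; rewrite sg0.
  case: (ex_minnP exg) => g /andP[sg gm] ming.
  have exj : exists j, (g < j)%N && (deg_hi j m != 0%N).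
    have /deg_loP[k1 mk1 E1] := gm; exists (hi k1); rewrite -E1 lo_hi.
    by apply/deg_hiP; exists k1.
  case: (ex_minnP exj) => j /andP[gj jm] minj.
  exists g, j; split; apply: arc_letter; rewrite -?elo -?ehi //.
  - by move=> i si im; apply: ming; rewrite si.
  - by move=> i gi im; apply: minj; rewrite gi.
  - by move=> i si im; apply: ming; rewrite si elo.
  - by move=> i gi im; apply: minj; rewrite gi ehi.
have los l : deg_lo l m != 0%N -> (l < s)%N.
  by move=> lm; rewrite ltnNge; apply/negP => sl; apply: none; exists l; rewrite sl.
have exj : exists j, deg_hi j m != 0%N by exists (hi k); apply/deg_hiP; exists k.
case: (ex_minnP exj) => j jm minj.
have exi : exists i, (i < j)%N && (deg_lo i m != 0%N).
  have /deg_hiP[k1 mk1 E1] := jm; exists (lo k1); rewrite -E1 lo_hi.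
  by apply/deg_loP; exists k1.
have ubi i : (i < j)%N && (deg_lo i m != 0%N) -> (i <= j)%N by case/andP => /ltnW.
case: (ex_maxnP exi ubi) => i /andP[ij im] maxi.
exists i, j; split; apply: cross_letter; rewrite -?elo -?ehi //.
- by move=> l lj lm; apply: maxi; rewrite lj.
- by move=> l; rewrite -elo; apply: los.
- by move=> l; rewrite -ehi; apply: minj.
- by move=> l lj lm; apply: maxi; rewrite lj elo.
Qed.

(** The letter found by the two preceding lemmas depends only on the degrees, so it
occurs in m and in m' and can be cancelled. *)
Theorem std_unique m m' : mstd (@std_pair c s) m -> mstd (@std_pair c s) m' ->
  (forall i, deg_lo i m = deg_lo i m') -> (forall i, deg_hi i m = deg_hi i m') -> m = m'.
Proof.
have [d] := ubnP (mdeg m + mdeg m'); elim: d m m' => // d IH m m' lt sm sm' elo ehi.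
have [m0|m0] := eqVneq m 0%MM.
  have [m'0|m'0] := eqVneq m' 0%MM; first by rewrite m0.
  by have [||k] := common_letter sm' sm _ _ m'0; [move=> i; rewrite elo|move=> i; rewrite ehi|rewrite m0 mnm0E].
have [k mk mk'] := common_letter sm sm' elo ehi m0.
have Em := mnm_rem1 mk; have Em' := mnm_rem1 mk'.
have Ed : mdeg m = (mdeg (m - U_(k))%MM + 1)%N by rewrite {1}Em mdegD mdeg1.
have Ed' : mdeg m' = (mdeg (m' - U_(k))%MM + 1)%N by rewrite {1}Em' mdegD mdeg1.
rewrite Em Em'; congr (_ + _)%MM; apply: IH; rewrite ?mstd_sub //; first lia.
- by move=> i; have := elo i; rewrite {1}Em {1}Em' /deg_lo !mwtD; lia.
- by move=> i; have := ehi i; rewrite {1}Em {1}Em' /deg_hi !mwtD; lia.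
Qed.

End Uniqueness.

(** * Values of the letters and descent along the chain *)
Section Forms.
Variables (K : fieldType) (c s : nat).
Local Notation N := #|letter c|.
Local Notation M := #|{: 'I_5 * 'I_c.+1}|.
Local Notation D := {mpoly K[M]}.
Implicit Types (k : 'I_N) (m : 'X_{1..N}) (p : {mpoly K[N]}) (u : nat -> nat -> nat).

(** The variables of the ring of values: y_i, p_i, z_i for a = 0, 1, 2, and nu, mu
for a = 3, 4 with i = 0. *)
Definition var (a i : nat) : D := 'X_(enum_rank (inord a : 'I_5, inord i : 'I_c.+1)).
Local Notation y := (var 0).
Local Notation pp := (var 1).
Local Notation z := (var 2).
Local Notation nu := (var 3 0).
Local Notation mu := (var 4 0).

Definition var_wt u (j : 'I_M) : nat := u (enum_val j).1 (enum_val j).2.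

Lemma leading_var u a i : (a < 5)%N -> (i <= c)%N -> leading (var_wt u) (u a i) (var a i) (var a i).
Proof.
move=> a5 ic; apply: (leading_eq (leadingX _ _ _)).
by rewrite /var_wt enum_rankK /= !inordK.
Qed.

(** The successive values of the letters.  To begin with (v = r = s, t false) a
stub has the value p_a (nu y_(b+1) - mu y_b) and an arc the value
y_a y_(b+1) - y_(a+1) y_b.  The stubs that end before v are reduced to their
second term and, if t, the other stubs to their first term; the arcs that begin
before r are reduced to their first term. *)
Definition form v (t : bool) r a b : D :=
  if (b < s)%N then pp a * nu * z b
  else if (a < s)%N then
    if (b < v)%N then - (pp a * mu * y b)
    else if t then pp a * (nu * y b.+1) else pp a * (nu * y b.+1 - mu * y b)
  else if (a < r)%N then y a * y b.+1 else y a * y b.+1 - y a.+1 * y b.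

(** The weight for u of the leading form of the letter, when the stubs that end
before v are those led by their second term. *)
Definition form_wt v u a b : nat :=
  (if b < s then u 1 a + u 3 0 + u 2 b
   else if a < s then
     if b < v then u 1 a + u 4 0 + u 0 b else u 1 a + (u 3 0 + u 0 b.+1)
   else u 0 a + u 0 b.+1)%N.

Definition letter_form v t r k : D := form v t r (lo k) (hi k).
Definition letter_wt v u k : nat := form_wt v u (lo k) (hi k).

Lemma leading_form u v v' (t t' : bool) r r' a b :
  (a < b)%N -> (b < c)%N -> (v <= v')%N -> (t -> t') -> (r <= r')%N ->
  ((a < s)%N -> (s <= b)%N -> (v <= b < v')%N ->
     ~~ t /\ (u 3 0 + u 0 b.+1 < u 4 0 + u 0 b)%N) ->
  ((a < s)%N -> (s <= b)%N -> (v' <= b)%N -> ~~ t ->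
     if t' then (u 4 0 + u 0 b < u 3 0 + u 0 b.+1)%N
     else (u 4 0 + u 0 b == u 3 0 + u 0 b.+1)%N) ->
  ((s <= a)%N -> (r <= a < r')%N -> (u 0 a.+1 + u 0 b < u 0 a + u 0 b.+1)%N) ->
  ((s <= a)%N -> (r' <= a)%N -> (u 0 a.+1 + u 0 b = u 0 a + u 0 b.+1)%N) ->
  leading (var_wt u) (form_wt v' u a b) (form v t r a b) (form v' t' r' a b).
Proof.
move=> ab bc vv' tt' rr' Hmu Hnu Harc Harc'; rewrite /form /form_wt.
have Y i : (i <= c)%N -> leading (var_wt u) (u 0 i) (y i) (y i) by apply: leading_var.
have P : leading (var_wt u) (u 1 a) (pp a) (pp a) by apply: leading_var => //; lia.
have NU : leading (var_wt u) (u 3 0) nu nu by apply: leading_var.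
have MU : leading (var_wt u) (u 4 0) mu mu by apply: leading_var.
have ac : (a <= c)%N by lia.
have bc' : (b <= c)%N by lia.
case: ltnP => [bs|sb]; first by apply: leadingM; [exact: leadingM|apply: leading_var].
case: ltnP => [as_|sa].
  case: (ltnP b v) => bv.
    by rewrite (leq_trans bv vv'); apply: leadingN; do !apply: leadingM; auto.
  case: (ltnP b v') => bv'.
    have [/negbTE -> lt] := Hmu as_ sb (introT andP (conj bv bv')).
    rewrite (_ : - (pp a * mu * y b) = pp a * (0 - mu * y b)); last by ring.
    rewrite -addnA; apply: leadingM => //; apply: leadingB; last by apply: leadingM; auto.
    by apply: (leading_lt lt (f' := nu * y b.+1)); apply: leadingM; auto.
  case: t tt' Hnu {Hmu} => [/(_ isT) -> _|_ /(_ as_ sb bv' isT)].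
    by do !apply: leadingM; auto.
  case: t' => [e|/eqP e]; apply: leadingM => //.
    rewrite -[X in leading _ _ _ X]subr0; apply: leadingB; first by apply: leadingM; auto.
    by apply: (leading_lt e (f' := mu * y b)); apply: leadingM; auto.
  by apply: leadingB; last rewrite -e; apply: leadingM; auto.
case: (ltnP a r) => ar; first by rewrite (leq_trans ar rr'); apply: leadingM; auto.
have ac' : (a.+1 <= c)%N by lia.
case: (ltnP a r') => ar'.
  rewrite -[X in leading _ _ _ X]subr0; apply: leadingB; first by apply: leadingM; auto.
  apply: (leading_lt (Harc sa (introT andP (conj ar ar'))) (f' := y a.+1 * y b)).
  by apply: leadingM; auto.
by apply: leadingB; last rewrite -Harc' //; apply: leadingM; auto.
Qed.

(** Passing to the leading forms for the weight u on the variables. *)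
Lemma form_stage u v v' (t t' : bool) r r' p :
  p != 0 -> ev (letter_form v t r) p = 0 ->
  (v <= v')%N -> (t -> t') -> (r <= r')%N ->
  (forall b, (s <= b)%N -> (v <= b < v')%N ->
     ~~ t /\ (u 3 0 + u 0 b.+1 < u 4 0 + u 0 b)%N) ->
  (forall b, (s <= b)%N -> (v' <= b)%N -> ~~ t ->
     if t' then (u 4 0 + u 0 b < u 3 0 + u 0 b.+1)%N
     else (u 4 0 + u 0 b == u 3 0 + u 0 b.+1)%N) ->
  (forall a b, (a < b < c)%N -> (s <= a)%N -> (r <= a < r')%N ->
     (u 0 a.+1 + u 0 b < u 0 a + u 0 b.+1)%N) ->
  (forall a b, (a < b < c)%N -> (s <= a)%N -> (r' <= a)%N ->
     (u 0 a.+1 + u 0 b = u 0 a + u 0 b.+1)%N) ->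
  exists p', [/\ p' != 0, ev (letter_form v' t' r') p' = 0, {subset msupp p' <= msupp p} &
    exists W, (forall m, m \in msupp p' -> mwt (letter_wt v' u) m = W) /\
              (forall m, m \in msupp p -> (mwt (letter_wt v' u) m <= W)%N)].
Proof.
move=> p0 ep vv' tt' rr' H1 H2 H3 H4; apply: (leading_relation p0 ep (u := var_wt u)) => m k mp mk.
have l := lo_hi k; have h := hi_lt k.
apply: leading_form => //.
- by move=> _; apply: H1.
- by move=> _; apply: H2.
- by apply: H3; rewrite l h.
- by apply: H4; rewrite l h.
Qed.

Lemma var_neq0 a i : var a i != 0.
Proof. by rewrite -msupp_eq0 msuppX. Qed.

Definition ind (a i a' i' : nat) : nat := ((a' == a) && (i' == i)).

(** The case where all letters have monomial values. *)
Section Terminal.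
Variables (v : nat) (t : bool) (r : nat).
Hypothesis stub_mono : forall b, (s <= b < c)%N -> (v <= b)%N -> t.
Hypothesis arc_mono : (c <= r)%N.

Lemma letter_form_neq0 k : letter_form v t r k != 0.
Proof.
rewrite /letter_form /form; have l := lo_hi k; have h := hi_lt k.
case: ltnP => bs; first by rewrite !mulf_neq0 ?var_neq0.
case: ltnP => as_.
  case: ltnP => bv; first by rewrite oppr_eq0 !mulf_neq0 ?var_neq0.
  by rewrite (stub_mono _ bv) ?bs // !mulf_neq0 ?var_neq0.
by rewrite (_ : (lo k < r)%N) ?mulf_neq0 ?var_neq0 //; lia.
Qed.

(** Monomial values are homogeneous for every weight on the variables, and taking
leading forms selects the part of the relation of highest weight. *)
Lemma homogeneous_relation (us : seq (nat * nat)) p :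
  p != 0 -> ev (letter_form v t r) p = 0 ->
  exists p', [/\ p' != 0, ev (letter_form v t r) p' = 0, {subset msupp p' <= msupp p} &
    forall ai, ai \in us -> forall m m', m \in msupp p' -> m' \in msupp p' ->
      mwt (letter_wt v (ind ai.1 ai.2)) m = mwt (letter_wt v (ind ai.1 ai.2)) m'].
Proof.
elim: us p => [|ai us IH] p p0 ep; first by exists p; split.
have [p1 [p10 ep1 sub1 [W [HW _]]]] : exists p', [/\ p' != 0, ev (letter_form v t r) p' = 0, {subset msupp p' <= msupp p} &
    exists W, (forall m, m \in msupp p' -> mwt (letter_wt v (ind ai.1 ai.2)) m = W) /\
              (forall m, m \in msupp p -> (mwt (letter_wt v (ind ai.1 ai.2)) m <= W)%N)].
  apply: (leading_relation p0 ep (u := var_wt (ind ai.1 ai.2))) => m' k _ _.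
  have l := lo_hi k; have h := hi_lt k; apply: leading_form => //; try lia.
  by move=> _ sb vb nt; have := stub_mono (introT andP (conj sb h)) vb; rewrite (negbTE nt).
have [p2 [p20 ep2 sub2 H2]] := IH p1 p10 ep1.
exists p2; split=> // [m /sub2/sub1//|ai']; rewrite inE => /predU1P[->|/H2//].
by move=> m m' /sub2/HW-> /sub2/HW->.
Qed.

(** Making the relation homogeneous in each of the variables leaves a single
monomial, by the hypothesis on m and m', and its value is not 0. *)
Lemma terminal p : p != 0 -> ev (letter_form v t r) p = 0 ->
  (forall m m', m \in msupp p -> m' \in msupp p ->
     (forall a i, (a < 3)%N -> (i <= c)%N ->
        mwt (letter_wt v (ind a i)) m = mwt (letter_wt v (ind a i)) m') -> m = m') ->
  False.
Proof.
move=> p0 ep uniqp.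
have [p1 [p10 ep1 sub1 H1]] := homogeneous_relation
  [seq (a, i) | a <- iota 0 3, i <- iota 0 c.+1] p0 ep.
have [m mp] : exists m, m \in msupp p1.
  by case: (msupp p1) (msupp_eq0 p1) => [/esym/eqP/eqP|m r0 _]; [rewrite (negbTE p10)|exists m; rewrite inE eqxx].
have supp1 m' : m' \in msupp p1 -> m' = m.
  move=> m'p; apply: uniqp; rewrite ?sub1 // => a i a3 ic.
  by apply: (H1 (a, i)) => //; apply: allpairs_f; rewrite mem_iota /= ?ltnS.
have Ep : p1 = p1@_m *: 'X_[m].
  apply/mpolyP => m'; rewrite mcoeffZ mcoeffX.
  have [->|ne] := eqVneq m m'; first by rewrite mulr1.
  rewrite mulr0; apply: memN_msupp_eq0; apply/negP => /supp1 e.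
  by rewrite e eqxx in ne.
move: ep1; rewrite Ep evZ => /eqP; rewrite scaler_eq0 mcoeff_eq0 mp /=.
apply/negP; rewrite mpolyXE_id rmorph_prod /=; apply/prodf_neq0 => k _.
by rewrite rmorphXn /= evXU expf_neq0 // letter_form_neq0.
Qed.

End Terminal.
End Forms.

Section Descent.
Variables (K : fieldType) (c s : nat).
Local Notation N := #|letter c|.
Implicit Types (k : 'I_N) (m : 'X_{1..N}) (p : {mpoly K[N]}).
Local Notation form := (@letter_form K c s).
Local Notation fwt := (@letter_wt c s).
Local Notation std_pair := (@std_pair c s).

Definition num (P : pred 'I_N) m : nat := mwt (fun k => P k : nat) m.

Lemma num_add (P Q R : pred 'I_N) m :
  (forall k, m k != 0%N -> (P k + Q k = R k :> nat)%N) -> (num P m + num Q m = num R m)%N.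
Proof. by move=> h; rewrite /num -mwt_add; apply: eq_mwt. Qed.

Lemma numP (P : pred 'I_N) m : reflect (exists2 k, m k != 0%N & P k) (num P m != 0%N).
Proof.
apply: (iffP (mwt_gt0P _ _)) => [[k mk]|[k mk Pk]]; last by exists k; rewrite ?Pk.
by rewrite eqb0 negbK; exists k.
Qed.

Definition xx_num := num (fun k => hi k < s)%N.
Definition x_num := num (fun k => lo k < s)%N.
Definition stub_num v := num (fun k => (lo k < s) && (s <= hi k < v))%N.

(** If T i < T' i and T' j < T j, then Q' i < Q i and Q j < Q' j, and the two
hypotheses on the order give j <= i and i <= j. *)
Lemma split_counts (T T' Q Q' : nat -> nat) n :
  (forall i, (i < n)%N -> T i + Q i = T' i + Q' i)%N ->
  (forall i j, T i != 0%N -> Q j != 0%N -> (i <= j)%N) ->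
  (forall i j, T' i != 0%N -> Q' j != 0%N -> (i <= j)%N) ->
  (\sum_(i < n) T i = \sum_(i < n) T' i)%N ->
  forall i, (i < n)%N -> T i = T' i.
Proof.
move=> e le le' eS.
have lt_ex (A B : nat -> nat) : (\sum_(i < n) A i = \sum_(i < n) B i)%N ->
    forall i : nat, (i < n)%N -> (A i < B i)%N -> exists2 j, (j < n)%N & (B j < A j)%N.
  move=> eAB i lti ltAB; apply: contrapT => h.
  have leAB (j : 'I_n) : true -> (A j <= B j)%N.
    by move=> _; rewrite leqNgt; apply/negP => lt; apply: h; exists j.
  move: eAB; rewrite (bigD1 (Ordinal lti)) //= [in RHS](bigD1 (Ordinal lti)) //=.
  have : (\sum_(j < n | j != Ordinal lti) A j <= \sum_(j < n | j != Ordinal lti) B j)%N.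
    by apply: leq_sum => j _; apply: leAB.
  by move: (bigop.body _ _ _) (bigop.body _ _ _) => SA SB; lia.
have key i j : (i < n)%N -> (j < n)%N -> (T i < T' i)%N -> (T' j < T j)%N -> False.
  move=> lti ltj h1 h2; have e1 := e i lti; have e2 := e j ltj.
  have l1 : (j <= i)%N by apply: le; lia.
  have l2 : (i <= j)%N by apply: le'; lia.
  have ij : i = j by lia.
  by move: h1 h2; rewrite ij; lia.
move=> i lti; case: (ltngtP (T i) (T' i)) => // h.
  have [j ltj h'] := lt_ex T T' eS i lti h; by case: (key i j).
have [j ltj h'] := lt_ex T' T (esym eS) i lti h; by case: (key j i).
Qed.

Lemma wt_z v i m : (i < s)%N -> mwt (fwt v (ind 2 i)) m = deg_hi i m.
Proof.
move=> is_; apply: eq_mwt => k _; rewrite /letter_wt /form_wt /ind /=.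
have l := lo_hi k; case: (ltnP (hi k) s) => ?; first lia.
by case: (ltnP (lo k) s) => ?; case: (ltnP (hi k) v) => ?; lia.
Qed.

Lemma wt_p v i m : (i < s)%N -> mwt (fwt v (ind 1 i)) m = deg_lo i m.
Proof.
move=> is_; apply: eq_mwt => k _; rewrite /letter_wt /form_wt /ind /=.
have l := lo_hi k; case: (ltnP (hi k) s) => ?; first lia.
by case: (ltnP (lo k) s) => ?; case: (ltnP (hi k) v) => ?; lia.
Qed.

Lemma deg_hi_ge i m : (c <= i)%N -> deg_hi i m = 0%N.
Proof.
move=> ci; apply/eqP; rewrite -[_ == _]negbK; apply/deg_hiP => -[k _ e].
by have := hi_lt k; lia.
Qed.

Lemma deg_lo_ge i m : (c <= i)%N -> deg_lo i m = 0%N.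
Proof.
move=> ci; apply/eqP; rewrite -[_ == _]negbK; apply/deg_loP => -[k _ e].
by have := hi_lt k; have := lo_hi k; lia.
Qed.

(** The exponents of z_i, p_i and y_i are the numbers of letters that end at a
position i < s, that begin at i, and that are stubs ending at i. *)
Lemma stubs_unique m m' : mstd std_pair m -> mstd std_pair m' ->
  (forall k, m k != 0%N -> (lo k < s)%N) -> (forall k, m' k != 0%N -> (lo k < s)%N) ->
  (forall a i, (a < 3)%N -> (i <= c)%N -> mwt (fwt c (ind a i)) m = mwt (fwt c (ind a i)) m') ->
  m = m'.
Proof.
move=> sm sm' na na' e; apply: (std_unique sm sm') => i.
  case: (ltnP i s) => [is_|si]; last first.
    have Z m0 : (forall k, m0 k != 0%N -> (lo k < s)%N) -> deg_lo i m0 = 0%N.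
      move=> h; apply/eqP; rewrite -[_ == _]negbK; apply/deg_loP => -[k /h]; lia.
    by rewrite !Z.
  have [ci|ic] := leqP c i; first by rewrite !deg_lo_ge.
  by rewrite -!(wt_p c) // e //; lia.
have [ci|ic] := leqP c i; first by rewrite !deg_hi_ge.
case: (ltnP i s) => [is_|si]; first by rewrite -!(wt_z c) // e //; lia.
have Y m0 : (forall k, m0 k != 0%N -> (lo k < s)%N) -> mwt (fwt c (ind 0 i)) m0 = deg_hi i m0.
  move=> h; apply: eq_mwt => k /h ls; rewrite /letter_wt /form_wt /ind ls hi_lt /=.
  by case: (ltnP (hi k) s) => ?; lia.
by rewrite -!Y // e //; lia.
Qed.

(** The exponent of y_i counts, in m, the arcs that begin at i (T), the arcs, and
the stubs ending after v, that end at i - 1 (Q), and the stubs ending at i <= v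
(S).  The numbers S are known.  Since m contains an arc that begins at v,
standardness makes every position counted by T at most equal to every position
counted by Q, so T and Q are determined by their sum ([split_counts]). *)
Lemma arcs_unique v m m' : (s <= v)%N -> mstd std_pair m -> mstd std_pair m' ->
  (forall k, m k != 0%N -> (s <= lo k)%N -> (v <= lo k)%N) ->
  (forall k, m' k != 0%N -> (s <= lo k)%N -> (v <= lo k)%N) ->
  deg_lo v m != 0%N -> deg_lo v m' != 0%N ->
  x_num m = x_num m' -> xx_num m = xx_num m' ->
  (forall b, (b <= v.+1)%N -> stub_num b m = stub_num b m') ->
  (forall a i, (a < 3)%N -> (i <= c)%N ->
     mwt (fwt v.+1 (ind a i)) m = mwt (fwt v.+1 (ind a i)) m') ->
  m = m'.
Proof.
move=> sv sm sm' na na' am am' ex exx es e.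
pose T m0 i := num (fun k => (s <= lo k) && (lo k == i))%N m0.
pose hiside k := ((s <= lo k) || [&& lo k < s, s <= hi k & v < hi k])%N.
pose Q m0 i := num (fun k => hiside k && ((hi k).+1 == i))%N m0.
pose S m0 i := num (fun k => [&& lo k < s, s <= hi k, hi k <= v & hi k == i])%N m0.
have ES i : S m i = S m' i.
  have [vi|iv] := ltnP v i.
    have Z m0 : S m0 i = 0%N.
      by apply/eqP; rewrite -[_ == _]negbK; apply/numP => -[k _]; lia.
    by rewrite !Z.
  have Sd m0 : (stub_num i m0 + S m0 i = stub_num i.+1 m0)%N by apply: num_add => k _; lia.
  by have := Sd m; have := Sd m'; rewrite (es i.+1) // (es i); lia.
have EY m0 i : (T m0 i + Q m0 i + S m0 i = mwt (fwt v.+1 (ind 0 i)) m0)%N.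
  rewrite /T /Q /S /num -!mwt_add; apply: eq_mwt => k _.
  rewrite /letter_wt /form_wt /ind /hiside /= ltnS; have l := lo_hi k.
  by case: (ltnP (hi k) s) => ?; case: (ltnP (lo k) s) => ?; case: (ltnP v (hi k)) => ?; lia.
have ETQ i : (i < c.+1)%N -> (T m i + Q m i = T m' i + Q m' i)%N.
  move=> ic; have := EY m i; have := EY m' i; rewrite (e 0%N i) // (ES i); lia.
have TQ m0 : mstd std_pair m0 -> (forall k, m0 k != 0%N -> (s <= lo k)%N -> (v <= lo k)%N) ->
    deg_lo v m0 != 0%N -> forall i j, T m0 i != 0%N -> Q m0 j != 0%N -> (i <= j)%N.
  move=> sm0 na0 /deg_loP[k0 mk0 E0] i j /numP[k1 mk1 /andP[s1 /eqP<-]] /numP[k2 mk2 /andP[h2 /eqP<-]].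
  have b01 := mstd_nonstd sm0 mk0 mk1; have b20 := mstd_nonstd sm0 mk2 mk0.
  have b21 := mstd_nonstd sm0 mk2 mk1; have n1 := na0 k1 mk1 s1.
  by move: b01 b20 b21 h2; rewrite /nonstd /hiside; have := (lo_hi k0, lo_hi k1, lo_hi k2) => -[[]]; lia.
have sumT m0 : (\sum_(i < c.+1) T m0 i = num (fun k => s <= lo k)%N m0)%N.
  rewrite /T /num -mwt_sum; apply: eq_mwt => k _; have l := lo_hi k; have h := hi_lt k.
  have lc : (lo k < c.+1)%N by lia.
  rewrite (bigD1 (Ordinal lc)) //= eqxx andbT big1 ?addn0 // => i /eqP ne.
  by case: eqP => [E|_]; rewrite ?andbF //; case: ne; apply: val_inj.
have sumQ m0 : (\sum_(i < c.+1) Q m0 i = num hiside m0)%N.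
  rewrite /Q /num -mwt_sum; apply: eq_mwt => k _; have h := hi_lt k.
  have hc : ((hi k).+1 < c.+1)%N by lia.
  rewrite (bigD1 (Ordinal hc)) //= eqxx andbT big1 ?addn0 // => i /eqP ne.
  by case: eqP => [E|_]; rewrite ?andbF //; case: ne; apply: val_inj.
have numQ m0 : (num hiside m0 + xx_num m0 + stub_num v.+1 m0 = num (fun k => s <= lo k)%N m0 + x_num m0)%N.
  rewrite /xx_num /stub_num /x_num /num -!mwt_add; apply: eq_mwt => k _.
  by rewrite /hiside; have := lo_hi k; lia.
have ET i : (i < c.+1)%N -> T m i = T m' i.
  apply: (split_counts ETQ (TQ m sm na am) (TQ m' sm' na' am')).
  have : (\sum_(i < c.+1) (T m i + Q m i) = \sum_(i < c.+1) (T m' i + Q m' i))%N.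
    by apply: eq_bigr => i0 _; apply: ETQ.
  rewrite !big_split /= !sumT !sumQ; have := numQ m; have := numQ m'.
  by rewrite ex exx (es v.+1) //; lia.
have EQ i : (i < c.+1)%N -> Q m i = Q m' i by move=> ic; have := ETQ i ic; rewrite ET //; lia.
apply: (std_unique sm sm') => i.
  have [ci|ic] := leqP c i; first by rewrite !deg_lo_ge.
  case: (ltnP i s) => [is_|si]; first by rewrite -!(wt_p v.+1) // e //; lia.
  have ED m0 : deg_lo i m0 = T m0 i by apply: eq_mwt => k _; lia.
  by rewrite !ED ET //; lia.
have [ci|ic] := leqP c i; first by rewrite !deg_hi_ge.
case: (ltnP i s) => [is_|si]; first by rewrite -!(wt_z v.+1) // e //; lia.
have ED m0 : (Q m0 i.+1 + S m0 i)%N = deg_hi i m0.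
  by apply: num_add => k _; rewrite /hiside; have := lo_hi k; lia.
by rewrite -!ED ES EQ.
Qed.

(** Take the leading forms for the degree in y_v: in the monomials that remain, the
number of arcs beginning at v plus that of stubs ending at v is constant.  If
there is no such arc, v can be replaced by v + 1.
Otherwise take the leading forms for the degree in nu.  This keeps the monomials
with the most stubs ending after v, thus with the fewest ending at v and the
most arcs beginning at v, so every remaining monomial contains such an arc.
With weight i^2 for y_i the values of all the arcs become monomials, and
[arcs_unique] applies. *)
Lemma descent v p : (s <= v <= c)%N -> p != 0 -> pstd std_pair p ->
  ev (form v false v) p = 0 ->
  (forall m k, m \in msupp p -> m k != 0%N -> (s <= lo k)%N -> (v <= lo k)%N) ->
  (forall m m', m \in msupp p -> m' \in msupp p ->
    [/\ xx_num m = xx_num m', x_num m = x_num m'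
      & forall b, (b <= v)%N -> stub_num b m = stub_num b m']) ->
  False.
Proof.
have [n] := ubnP (c - v)%N; elim: n v p => // n IH v p lt /andP[sv vc] p0 /allP sp ep na cst.
have [vc'|cv] := ltnP v c; last first.
  have {vc cv} Ev : v = c by lia. subst v.
  have no k m : m \in msupp p -> m k != 0%N -> (lo k < s)%N.
    move=> mp mk; have := na m k mp mk; have := lo_hi k; have := hi_lt k; lia.
  apply: (@terminal K c s c false c _ _ p p0 ep) => // [b|m m' mp m'p e]; first lia.
  by apply: stubs_unique e; [exact: sp|exact: sp|move=> k; apply: no|move=> k; apply: no].
have [|||||||p1 [p10 ep1 sub1 [W1 [HW1 _]]]] := @form_stage K c s (ind 0 v) v v.+1 false false v v.+1 p p0 ep.
- lia.
- by [].
- lia.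
- by move=> b sb vb; rewrite /ind /=; split=> //; lia.
- by move=> b sb vb _; rewrite /ind /=; lia.
- by move=> a b ab sa va; rewrite /ind /=; lia.
- by move=> a b ab sa va; rewrite /ind /=; lia.
pose stubv := num (fun k => [&& lo k < s, s <= hi k & hi k == v])%N.
have E1 m : m \in msupp p1 -> (deg_lo v m + stubv m = W1)%N.
  move=> mp1; rewrite -(HW1 m mp1) /stubv /deg_lo /num -mwt_add; apply: eq_mwt => k mk.
  have := na m k (sub1 _ mp1) mk; rewrite /letter_wt /form_wt /ind /= ltnS.
  have l := lo_hi k.
  by case: (ltnP (hi k) s) => ?; case: (ltnP (lo k) s) => ?; case: (ltnP v (hi k)) => ?; lia.
have Estub m : (stub_num v m + stubv m = stub_num v.+1 m)%N.
  by apply: num_add => k _; have := lo_hi k; lia.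
have [[m1 m1p am1]|noarc] := pselect (exists2 m, m \in msupp p1 & deg_lo v m != 0%N); last first.
  have na1 m : m \in msupp p1 -> deg_lo v m = 0%N.
    by move=> mp; apply/eqP/negPn/negP => h; apply: noarc; exists m.
  apply: (IH v.+1 p1) => //; first lia.
  - by apply/andP; split; lia.
  - by apply/allP => m /sub1/sp.
  - move=> m k mp mk sk; have := na m k (sub1 _ mp) mk sk.
    rewrite leq_eqVlt => /orP[/eqP e|//].
    by have /negP[] : ~~ (deg_lo v m != 0%N); [rewrite na1|apply/deg_loP; exists k].
  - move=> m m' mp m'p; have [c1 c2 c3] := cst m m' (sub1 _ mp) (sub1 _ m'p); split=> // b.
    rewrite leq_eqVlt => /orP[/eqP->|]; last exact: c3.
    have := E1 m mp; have := E1 m' m'p; rewrite !na1 // -!Estub (c3 v) //; lia.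
have [|||||||p2 [p20 ep2 sub2 [W2 [HW2 HW2']]]] := @form_stage K c s (ind 3 0) v.+1 v.+1 false true v.+1 v.+1 p1 p10 ep1.
- by [].
- by [].
- by [].
- by move=> b sb vb; rewrite /ind /=; lia.
- by move=> b sb vb _; rewrite /ind /=.
- by move=> a b ab sa va; rewrite /ind /=; lia.
- by move=> a b ab sa va; rewrite /ind /=; lia.
have E2 m : (mwt (fwt v.+1 (ind 3 0)) m + stub_num v.+1 m = x_num m)%N.
  rewrite /stub_num /x_num /num -mwt_add; apply: eq_mwt => k mk.
  rewrite /letter_wt /form_wt /ind /= ltnS; have l := lo_hi k.
  by case: (ltnP (hi k) s) => ?; case: (ltnP (lo k) s) => ?; case: (ltnP v (hi k)) => ?; lia.
(* Not more stubs end at v in m than in m1, so at least as many arcs begin there. *)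
have arcs m : m \in msupp p2 -> deg_lo v m != 0%N.
  move=> mp; have mp1 := sub2 _ mp; have [c1 c2 c3] := cst m m1 (sub1 _ mp1) (sub1 _ m1p).
  have := E1 m mp1; have := E1 m1 m1p; have := E2 m; have := E2 m1.
  have := HW2 m mp; have := HW2' m1 m1p; have := Estub m; have := Estub m1.
  have := c3 v (leqnn v); lia.
have cst2 m m' : m \in msupp p2 -> m' \in msupp p2 -> forall b, (b <= v.+1)%N -> stub_num b m = stub_num b m'.
  move=> mp m'p b; have [c1 c2 c3] := cst m m' (sub1 _ (sub2 _ mp)) (sub1 _ (sub2 _ m'p)).
  rewrite leq_eqVlt => /orP[/eqP->|]; last exact: c3.
  by have := E2 m; have := E2 m'; rewrite (HW2 m) // (HW2 m') //; lia.
have [|||||||p3 [p30 ep3 sub3 _]] := @form_stage K c s (fun a i => if a == 0%N then i * i else 0)%N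
    v.+1 v.+1 true true v.+1 c p2 p20 ep2.
- by [].
- by [].
- lia.
- by move=> b sb vb; lia.
- by [].
- by move=> a b ab sa va /=; nia.
- by move=> a b ab sa va /=; lia.
apply: (@terminal K c s v.+1 true c _ _ p3 p30 ep3) => // m m' /sub3 mp /sub3 m'p.
have mp' := sub1 _ (sub2 _ mp); have m'p' := sub1 _ (sub2 _ m'p).
have [c1 c2 _] := cst m m' mp' m'p'.
apply: (@arcs_unique v) => //.
- exact: sp.
- exact: sp.
- by move=> k; apply: na.
- by move=> k; apply: na.
- exact: arcs.
- exact: arcs.
- exact: cst2.
Qed.

(** Homogeneity in the z_i and in the p_i makes the numbers of letters without a
chain column, and of letters with an X-column, constant. *)
Theorem form_independence p : (s <= c)%N -> p != 0 -> pstd std_pair p ->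
  ev (form s false s) p = 0 -> False.
Proof.
move=> sc p0 /allP sp ep.
have [|||||||p1 [p10 ep1 sub1 [W1 [HW1 _]]]] := @form_stage K c s (fun a i => a == 2) s s false false s s p p0 ep.
- by [].
- by [].
- by [].
- by move=> b; lia.
- by [].
- by move=> a b; lia.
- by [].
have [|||||||p2 [p20 ep2 sub2 [W2 [HW2 _]]]] := @form_stage K c s (fun a i => a == 1) s s false false s s p1 p10 ep1.
- by [].
- by [].
- by [].
- by move=> b; lia.
- by [].
- by move=> a b; lia.
- by [].
apply: (descent _ p20 _ ep2) => //; first by rewrite leqnn.
  by apply/allP => m /sub2/sub1/sp.
move=> m m' mp m'p; split.
- have Ex m0 : m0 \in msupp p2 -> xx_num m0 = W1.
    move=> /sub2 /HW1 <-; apply: eq_mwt => k _; rewrite /letter_wt /form_wt /=.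
    by case: (ltnP (hi k) s); rewrite ?if_same.
  by rewrite !Ex.
- have Ex m0 : m0 \in msupp p2 -> x_num m0 = W2.
    move=> /HW2 <-; apply: eq_mwt => k _; rewrite /letter_wt /form_wt /=.
    by have := lo_hi k; case: (ltnP (hi k) s) => ?; case: (ltnP (lo k) s) => ? //=; lia.
  by rewrite !Ex.
- move=> b bs; have Z m0 : stub_num b m0 = 0%N :> nat.
    by apply/eqP; rewrite -[_ == _]negbK; apply/numP => -[k _]; lia.
  by rewrite !Z.
Qed.

End Descent.

(** * Specialization of the scroll *)
Section Independence.
Variables (K : fieldType) (s : nat) (n : 'I_s.+1 -> nat).
Hypothesis n_gt0 : forall i, (0 < n i)%N.
Local Notation c := (\sum_i n i)%N.
Local Notation R := (scroll_ring K n).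
Local Notation N := #|column_pair n|.
Local Notation M := #|{: 'I_5 * 'I_c.+1}|.
Local Notation D := {mpoly K[M]}.
Local Notation var := (@var K c).
Local Notation y := (var 0).
Local Notation pp := (var 1).
Local Notation z := (var 2).
Local Notation nu := (var 3 0).
Local Notation mu := (var 4 0).
Local Notation block_size := (block_size n).
Local Notation chain_off := (chain_off block_size).
Local Notation scroll_x := (scroll_x K n).
Local Notation basis_col := (@basis_col K R s block_size scroll_x).
Local Notation lR := (@letter_minor c K R (basis_col 0) (basis_col 1)).

(** The value of the entry i of X_l. *)
Definition jump l i : D :=
  if i == 0%N then pp l * nu else if i == 1%N then pp l * mu + z l else 0.

(** The value of x_(k,j) for P = chain_off k + j.  All blocks follow the sequence
y, up to the jumps at the X-columns: X_l is the difference of two columns of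
values, of which only the one in block l + 1 contains [jump l]. *)
Definition path_value k P : D := y (s + P)%N + \sum_(l < k) jump l (P - chain_off l.+1)%N.

Definition specialize_var (j : 'I_#|scroll_index n|) : D :=
  path_value (tag (enum_val j)) (chain_off (tag (enum_val j)) + tagged (enum_val j))%N.

Definition specialize : R -> D := mmap (@mpolyC M K) specialize_var.

HB.instance Definition _ := GRing.RMorphism.copy specialize (mmap (@mpolyC M K) specialize_var).

Lemma specializeA (a : K) : specialize a%:A = a%:A.
Proof. by rewrite /specialize alg_mpolyC mmapC alg_mpolyC. Qed.

Lemma specialize_x k j : (k <= s)%N -> (j <= block_size k)%N ->
  specialize (scroll_x k j) = path_value k (chain_off k + j)%N.
Proof.
move=> ks jn; rewrite /specialize /scroll_x /scroll_var mmapX mmap1U /specialize_var enum_rankK /=.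
by rewrite !inordK.
Qed.

Lemma specialize_col_x r p : (r < 2)%N -> (p < s)%N -> specialize (basis_col r p) = jump p r.
Proof.
move=> r2 ps; have n0 := block_size_gt0 n_gt0 p; have n1 := block_size_gt0 n_gt0 p.+1.
rewrite /basis_col ps rmorphB /= !specialize_x //; [|lia|lia|lia].
have E : (chain_off p + ((block_size p).-1 + r) = chain_off p.+1 + r)%N by rewrite chain_offS addnA.
rewrite E /path_value [\sum_(l < p.+1) _]big_ord_recr /= addKn.
by rewrite addrA [LHS]addrAC subrr add0r.
Qed.

Lemma specialize_col_y r p : (r < 2)%N -> (s <= p < c)%N ->
  exists2 k, (k <= s)%N & specialize (basis_col r p) = path_value k (p - s + r)%N.
Proof.
move=> r2 /andP[sp pc]; rewrite /basis_col ifN -?leqNgt //.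
case: ifP => [/eqP->|/negbT ps].
  exists 0%N => //; rewrite specialize_x ?subnn //; last by have := block_size_gt0 n_gt0 0; lia.
  by rewrite /chain_off big_ord0.
have cE := chain_off_last s (block_size_gt0 n_gt0); rewrite sum_block_size in cE; rewrite -cE in pc.
have [ks h1 h2] : [/\ (chain_block s block_size (p - s).-1 <= s)%N, (chain_off (chain_block s block_size (p - s).-1) <= (p - s).-1)%N
  & ((p - s).-1 < chain_off (chain_block s block_size (p - s).-1).+1)%N] by apply: chain_blockP; lia.
exists (chain_block s block_size (p - s).-1) => //; rewrite specialize_x //; last first.
  by move: h2; rewrite /chain_pos chain_offS; lia.
by congr path_value; rewrite /chain_pos; lia.
Qed.

(** The y dominate the p, the p dominate the z, and the z increase with their
index: thus p_a nu z_b is the leading form of [a b] when a < b < s. *)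
Definition scale_wt (a i : nat) : nat :=
  if a == 0%N then s.+1 else if a == 1%N then s else if a == 2%N then i else 0%N.
Local Notation ldg := (leading (@var_wt c scale_wt)).

Lemma sc : (s < c)%N.
Proof. by have := chain_off_last s (block_size_gt0 n_gt0); rewrite sum_block_size => <-; lia. Qed.

Lemma ltsW i : (i < s)%N -> (i <= c)%N.
Proof. by move=> is_; apply/ltnW/(ltn_trans is_ sc). Qed.

Lemma leading_jump0 l : (l < s)%N -> ldg s (jump l 0) (pp l * nu).
Proof.
move=> ls; rewrite /jump /= -[X in leading _ X]addn0; apply: leadingM.
  by apply: (leading_var K scale_wt (a := 1)) => //; apply: ltsW.
by apply: (leading_var K scale_wt (a := 3)).
Qed.

Lemma leading_jump1 l : (l < s)%N -> ldg s (jump l 1) (pp l * mu).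
Proof.
move=> ls; rewrite /jump /= -[X in leading _ _ _ X]addr0; apply: leadingD.
  rewrite -[X in leading _ X]addn0; apply: leadingM.
    by apply: (leading_var K scale_wt (a := 1)) => //; apply: ltsW.
  by apply: (leading_var K scale_wt (a := 4)).
by apply: (leading_lt ls); apply: (leading_var K scale_wt (a := 2)) => //; apply: ltsW.
Qed.

Lemma leading_path k P : (k <= s)%N -> (s + P <= c)%N -> ldg s.+1 (path_value k P) (y (s + P)%N).
Proof.
move=> ks Pc; rewrite /path_value -[X in leading _ _ _ X]addr0; apply: leadingD.
  exact: (leading_var K scale_wt (a := 0)).
have E0 : \sum_(l < k) 0 = 0 :> D by apply: big1.
rewrite -[X in leading _ _ _ X]E0.
apply: leading_sum => l _; have ls : (l < s)%N := leq_trans (ltn_ord l) ks.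
case: (P - _)%N => [|[|i]]; last exact: leading0.
  exact: (leading_lt (ltnSn s) (leading_jump0 ls)).
exact: (leading_lt (ltnSn s) (leading_jump1 ls)).
Qed.

Lemma leading_col r p : (r < 2)%N -> (s <= p < c)%N -> ldg s.+1 (specialize (basis_col r p)) (y (p + r)%N).
Proof.
move=> r2 /[dup] /andP[sp pc] spc; have [k ks ->] := specialize_col_y r2 spc.
rewrite -[in y _](subnKC sp) -addnA; apply: leading_path => //.
by rewrite addnA subnKC //; case: r r2 => [|[]] // _; rewrite ?addn0 ?addn1 // ltnW.
Qed.

Lemma leading_col0 p : (s <= p < c)%N -> ldg s.+1 (specialize (basis_col 0 p)) (y p).
Proof. by move=> /(leading_col (r := 0%N) isT); rewrite [(p + 0)%N]addn0. Qed.

Lemma leading_col1 p : (s <= p < c)%N -> ldg s.+1 (specialize (basis_col 1 p)) (y p.+1).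
Proof. by move=> /(leading_col (r := 1%N) isT); rewrite [(p + 1)%N]addn1. Qed.

Lemma leading_letter k : exists w, ldg w (specialize (lR k)) (letter_form K s s false s k).
Proof.
have l := lo_hi k; have h := hi_lt k.
rewrite /letter_minor /minor rmorphB !rmorphM /= /letter_form /form.
case: (ltnP (hi k) s) => hs.
  have ls := ltn_trans l hs.
  rewrite (specialize_col_x (r := 0%N) isT ls) (specialize_col_x (r := 1%N) isT ls).
  rewrite (specialize_col_x (r := 0%N) isT hs) (specialize_col_x (r := 1%N) isT hs).
  exists (s + hi k)%N; rewrite /jump /=.
  rewrite (_ : _ - _ = pp (lo k) * nu * z (hi k) - z (lo k) * (pp (hi k) * nu)); last by ring.
  rewrite -[X in leading _ _ _ X]subr0; apply: leadingB.
    apply: leadingM; first exact: (leading_jump0 (ltn_trans l hs)).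
    by apply: (leading_var K scale_wt (a := 2)) => //; apply: ltsW.
  apply: (@leading_lt _ _ _ (lo k + s)); first by rewrite addnC ltn_add2l.
  apply: leadingM; last exact: leading_jump0.
  by apply: (leading_var K scale_wt (a := 2)) => //; apply/ltsW/(ltn_trans l hs).
case: (ltnP (lo k) s) => ls.
  rewrite (specialize_col_x (r := 0%N) isT ls) (specialize_col_x (r := 1%N) isT ls); exists (s + s.+1)%N.
  rewrite mulrBr !mulrA; apply: leadingB; apply: leadingM.
  - exact: leading_jump0.
  - by apply: leading_col1; rewrite ?hs.
  - exact: leading_jump1.
  - by apply: leading_col0; rewrite ?hs.
exists (s.+1 + s.+1)%N; have lc : (lo k < c)%N := ltn_trans l h.
apply: leadingB; apply: leadingM.
- by apply: leading_col0; rewrite ?ls.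
- by apply: leading_col1; rewrite ?hs.
- by apply: leading_col1; rewrite ?ls.
- by apply: leading_col0; rewrite ?hs.
Qed.

Theorem scroll_independence p :
  pstd (@std_pair c s) p -> ev (scroll_letter K n_gt0) p = 0 -> p = 0.
Proof.
move=> /allP sp ep; have [//|p0] := eqVneq p 0; exfalso.
have e0 : ev (specialize \o lR) p = 0.
  by rewrite -(ev_morph _ _ specializeA) /= -val_ev ep !rmorph0.
have [w tw] : exists w, forall k, ldg (w k) (specialize (lR k)) (letter_form K s s false s k).
  by exists (fun k => sval (cid (leading_letter k))) => k; case: cid.
have [p1 [p10 ep1 sub1 _]] := leading_relation p0 e0 (fun m k _ _ => tw k).
apply: (form_independence (ltnW sc) p10 _ ep1).
by apply/allP => m /sub1/sp.
Qed.

End Independence.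

Theorem corollary3p14 (K : fieldType) (d : nat) (n : 'I_d -> nat)
    (hd : (0 < d)%N) (hn : forall i : 'I_d, (0 < n i)%N) :
  Koszul (gen_alg (scroll_minors K n))
         (gen_piece (scroll_minors K n)) (gen_eps (scroll_minors K n)).
Proof.
case: d n hd hn => // s n _ hn.
exact: (standard_basis_Koszul (@std_pair_refl _ s) (@std_pair_sym _ s) (scroll_straightening K hn)
  (@scroll_independence K s n hn) (scroll_ev_surj hn) (gen_piece_letters hn)
  (scroll_eps_ev hn)).
Qed.
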